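(* The pointed quandle counting invariant is invariant under Reidemeister moves: if $\mathcal{X}$ is a $2n$-pointed quandle and $L$, $L'$ are ordered oriented $n$-linkoid diagrams related by a finite sequence of Reidemeister moves (respecting the ordering of open components), then $\Phi^{\mathbb{Z}}_{\mathcal{X}}(L)=\Phi^{\mathbb{Z}}_{\mathcal{X}}(L')$.
   Context: A quandle is a set $X$ with a binary operation $\triangleright$ such that (1) $x\triangleright x=x$ for all $x$; (2) for every $y$ the map $\beta_y:X\to X$, $\beta_y(x)=x\triangleright y$, is bijective; (3) $(x\triangleright y)\triangleright z=(x\triangleright z)\triangleright(y\triangleright z)$ for all $x,y,z$. Write $x\triangleright^{-1}y=\beta_y^{-1}(x)$ and $\triangleright^{1}=\triangleright$. An $m$-pointed quandle $(X,x_1,\dots,x_m)$ is a quandle $X$ together with an ordered list of $m$ elements (basepoints) of $X$. A homomorphism $(X,x_1,\dots,x_m)\to(Y,y_1,\dots,y_m)$ is a quandle homomorphism $\varphi:X\to Y$ with $\varphi(x_i)=y_i$ for all $i$. An oriented $n$-linkoid diagram ($n\ge 0$) is a generic immersion into $S^2$ of $n$ unit intervals $[0,1]$ (oriented from $0$ to $1$; the open components) and a number of oriented circles (the closed components), with finitely many transverse double points (crossings), each endowed with over/under information. The image of $0$ in an open component is its leg and the image of $1$ its head; these are the endpoints. It is ordered if an ordering of the open components is given. The Reidemeister moves are isotopy and the oriented moves R1, R2, R3, all taking place away from the endpoints (no endpoint is moved over or under a strand). An arc of a diagram is a maximal piece of a component containing no passage under a crossing (arcs end at undercrossings or endpoints).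 If $A(L)$ is the set of arcs of $L$, the fundamental quandle $Q(L)$ is the quandle presented by generators $A(L)$ and one relation $r_\tau$ for each crossing $\tau$: if $y$ is the over-arc, $x$ the incoming under-arc, $z$ the outgoing under-arc and $\varepsilon\in\{1,-1\}$ the sign of the crossing, then $r_\tau$ is $z=x\triangleright^{\varepsilon}y$. The fundamental pointed quandle of $L$ is $P(L)=(Q(L),l_1,h_1,\dots,l_n,h_n)$, where $l_i$ and $h_i$ are the generators corresponding to the arcs adjacent to the leg and head of the $i$-th open component. The pointed quandle counting invariant $\Phi^{\mathbb{Z}}_{\mathcal{X}}(L)$ is the cardinality of the set of homomorphisms of $2n$-pointed quandles $P(L)\to\mathcal{X}$. *)

(* Defs.v *)
From HB Require Import structures.
From Stdlib Require Import Relation_Operators.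
From mathcomp Require Import all_boot all_order all_algebra all_fingroup.
From mathcomp Require Import generic_quotient.
From mathcomp Require Import all_classical all_reals all_analysis.

Set Implicit Arguments.
Unset Strict Implicit.
Unset Printing Implicit Defensive.

Import Order.TTheory GRing.Theory Num.Theory.
Import numFieldNormedType.Exports.

Local Open Scope classical_set_scope.
Local Open Scope quotient_scope.
Local Open Scope ring_scope.

(** * Quandles *)

Record quandle := Quandle {
  qcar :> Type;
  qop : qcar -> qcar -> qcar;
  qop_idem : forall x, qop x x = x;
  qop_bij : forall y, bijective (fun x => qop x y);
  qop_distr : forall x y z, qop (qop x y) z = qop (qop x z) (qop y z)
}.

Record pointed_quandle (k : nat) := PointedQuandle {
  pq_quandle :> quandle;
  basepoint : 'I_k -> pq_quandle
}.

Definition pq_hom (k : nat) (P X : pointed_quandle k) : set (P -> X) :=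
  [set f | (forall a b : P, f (qop a b) = qop (f a) (f b)) /\
           (forall i : 'I_k, f (basepoint P i) = basepoint X i)].
Arguments pq_hom {k} P X.

(** * Quandles presented by generators and relations *)

Inductive qterm (A : Type) : Type :=
| QGen of A
| QOp of qterm A & qterm A
| QInv of qterm A & qterm A.

HB.instance Definition _ (A : Type) := gen_eqMixin (qterm A).
HB.instance Definition _ (A : Type) := gen_choiceMixin (qterm A).

Section Presentation.
Variables (A : Type) (rel : set (qterm A * qterm A)).

Inductive qcong : qterm A -> qterm A -> Prop :=
| qcong_refl t : qcong t t
| qcong_sym t u : qcong t u -> qcong u t
| qcong_trans t u v : qcong t u -> qcong u v -> qcong t v
| qcong_op t t' u u' : qcong t t' -> qcong u u' -> qcong (QOp t u) (QOp t' u')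
| qcong_inv t t' u u' :
    qcong t t' -> qcong u u' -> qcong (QInv t u) (QInv t' u')
| qcong_idem t : qcong (QOp t t) t
| qcong_opK t u : qcong (QInv (QOp t u) u) t
| qcong_invK t u : qcong (QOp (QInv t u) u) t
| qcong_distr t u v :
    qcong (QOp (QOp t u) v) (QOp (QOp t v) (QOp u v))
| qcong_rel t u : rel (t, u) -> qcong t u.

Definition qcongb (t u : qterm A) : bool := `[< qcong t u >].

Lemma qcongb_refl : reflexive qcongb.
Proof. by move=> t; apply/asboolP/qcong_refl. Qed.

Lemma qcongb_sym : symmetric qcongb.
Proof. by move=> t u; apply/asboolP/asboolP; apply: qcong_sym. Qed.

Lemma qcongb_trans : transitive qcongb.
Proof.
by move=> u t v /asboolP tu /asboolP uv; apply/asboolP/(qcong_trans tu uv).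
Qed.

Canonical qcong_equiv := EquivRel qcongb qcongb_refl qcongb_sym qcongb_trans.

Definition presented := {eq_quot qcong_equiv}.

Definition presented_op (a b : presented) : presented :=
  \pi_presented (QOp (repr a) (repr b)).
Definition presented_inv (a b : presented) : presented :=
  \pi_presented (QInv (repr a) (repr b)).

Lemma presented_eq t u :
  qcong t u -> \pi_presented t = \pi_presented u :> presented.
Proof. by move=> tu; apply/eqmodP/asboolP. Qed.

Lemma qcong_repr t : qcong (repr (\pi_presented t)) t.
Proof.
by have /eqmodP/asboolP := reprK (\pi_presented t).
Qed.

Lemma presented_idem a : presented_op a a = a.
Proof. by rewrite -[RHS]reprK; apply/presented_eq/qcong_idem. Qed.

Lemma presented_bij b : bijective (fun a => presented_op a b).
Proof.
exists (fun a => presented_inv a b) => a; rewrite -[RHS]reprK;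
  apply/presented_eq.
- apply: qcong_trans (qcong_opK _ (repr b)).
  by apply: qcong_inv (qcong_refl _); apply: qcong_repr.
- apply: qcong_trans (qcong_invK _ (repr b)).
  by apply: qcong_op (qcong_refl _); apply: qcong_repr.
Qed.

Lemma presented_distr a b c :
  presented_op (presented_op a b) c =
  presented_op (presented_op a c) (presented_op b c).
Proof.
apply/presented_eq.
apply: (@qcong_trans _ (QOp (QOp (repr a) (repr b)) (repr c))).
  by apply: qcong_op (qcong_refl _); apply: qcong_repr.
apply: qcong_trans (qcong_distr _ _ _) _.
by apply: qcong_op; apply/qcong_sym/qcong_repr.
Qed.

Definition presented_quandle : quandle :=
  Quandle presented_idem presented_bij presented_distr.

End Presentation.

(** * Smooth maps and the sphere *)

(* For maps between finite-dimensional spaces (the only ones used below) this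
   is the usual class C^k.  A map defined on a closed subset ([0, 1], S^2,
   [0, 1] x S^2, a square) is smooth when it extends to a smooth map of the
   ambient vector space, so below every map is given on the ambient space and
   only its values on the relevant subset matter. *)
Fixpoint Ck (R : realType) (V W : normedModType R) (k : nat) (f : V -> W) :
    Prop :=
  match k with
  | 0 => continuous f
  | k'.+1 => (forall x, differentiable f x) /\
             (forall v, Ck k' (fun x => 'D_v f x))
  end.

Definition smooth (R : realType) (V W : normedModType R) (f : V -> W) : Prop :=
  forall k, Ck k f.

Definition sphere (R : realType) : set 'rV[R]_3 :=
  [set p | \sum_i p 0 i ^+ 2 = 1].

(* For p on the sphere and u, v tangent at p, this is positive iff (u, v) is a
   positive basis of the tangent plane, S^2 being oriented by its outward
   normal; it vanishes iff u and v are linearly dependent. *)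
Definition orient (R : realType) (p u v : 'rV[R]_3) : R :=
  \det (col_mx p (col_mx u v) : 'M[R]_3).

(** * Linkoid diagrams *)

(* [inl i] is the i-th open component and [inr j] is the j-th closed one. *)
Definition component (n m : nat) : Type := ('I_n + 'I_m)%type.

(* Closed components are parametrized by 1-periodic maps on R, i.e. by R/Z. *)
Definition in_domain (R : realType) n m (c : component n m) (t : R) : Prop :=
  if c is inl _ then 0 <= t <= 1 else True.

Definition in_fundamental (R : realType) n m (c : component n m) (t : R) :
    Prop :=
  if c is inl _ then 0 <= t <= 1 else 0 <= t < 1.

Definition same_parameter (R : realType) n m (c : component n m) (s t : R) :
    Prop :=
  if c is inl _ then s = t else exists k : int, t = s + k%:~R.

Definition double_point (R : realType) n m (g : component n m -> R -> 'rV[R]_3)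
    (p q : component n m * R) : Prop :=
  [/\ in_fundamental p.1 p.2, in_fundamental q.1 q.2, p <> q &
      g p.1 p.2 = g q.1 q.2].

(* [is_under c] is the set of parameters at which the component c passes under
   a crossing; on open components only its trace on [0, 1] matters. *)
Record diagram (R : realType) (n m : nat) := Diagram {
  curve : component n m -> R -> 'rV[R]_3;
  is_under : component n m -> set R;
  curve_smooth : forall c, smooth (curve c : R^o -> 'rV[R]_3);
  curve_sphere : forall c t, in_domain c t -> sphere (curve c t);
  curve_periodic : forall j t, curve (inr j) (t + 1) = curve (inr j) t;
  curve_immersion : forall c t, in_domain c t -> derive1 (curve c) t != 0;
  curve_finite : finite_set [set p | exists q, double_point curve p q];
  curve_no_triple : forall p q r,
    double_point curve p q -> double_point curve p r -> q = r;
  curve_transverse : forall p q, double_point curve p q ->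
    orient (curve p.1 p.2)
           (derive1 (curve p.1) p.2) (derive1 (curve q.1) q.2) != 0;
  curve_endpoint : forall (i : 'I_n) (t : R) q, t = 0 \/ t = 1 ->
    ~ double_point curve (inl i, t) q;
  under_periodic : forall j t, is_under (inr j) (t + 1) <-> is_under (inr j) t;
  under_double : forall c t, in_fundamental c t -> is_under c t ->
    exists q, double_point curve (c, t) q;
  under_over : forall p q, double_point curve p q ->
    (is_under p.1 p.2 <-> ~ is_under q.1 q.2)
}.

(** * Arcs and the fundamental pointed quandle *)

Section Fundamental.
Variables (R : realType) (n m : nat) (L : diagram R n m).

Definition joined (p q : component n m * R) : Prop :=
  [/\ p.1 = q.1, in_domain p.1 p.2, in_domain q.1 q.2 &
      exists u v : R, [/\ same_parameter p.1 p.2 u, same_parameter q.1 q.2 v &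
        forall w, Num.min u v <= w <= Num.max u v -> ~ is_under L p.1 w]].

Definition arc_of (p : component n m * R) : set (component n m * R) :=
  [set q | joined p q].

(* On a closed component, an arc is represented by the set of all the real
   parameters of its points. *)
Definition diagram_arc : Type :=
  {a : set (component n m * R) |
    exists p, [/\ in_domain p.1 p.2, ~ is_under L p.1 p.2 & a = arc_of p]}.

Definition incoming (p : component n m * R) (x : diagram_arc) : Prop :=
  exists2 d : R, 0 < d & forall r, p.2 - d < r < p.2 -> sval x (p.1, r).

Definition outgoing (p : component n m * R) (z : diagram_arc) : Prop :=
  exists2 d : R, 0 < d & forall r, p.2 < r < p.2 + d -> sval z (p.1, r).

(* p is the under-passage and q the over-passage of the crossing; the sign is
   +1 iff (over tangent, under tangent) is a positive basis. *)
Definition crossing_sign (p q : component n m * R) : bool :=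
  0 < orient (curve L p.1 p.2)
             (derive1 (curve L q.1) q.2) (derive1 (curve L p.1) p.2).

Definition crossing_relations : set (qterm diagram_arc * qterm diagram_arc) :=
  [set e | exists p q (x y z : diagram_arc),
    [/\ double_point (curve L) p q, is_under L p.1 p.2,
        incoming p x, outgoing p z & sval y q] /\
    e = (QGen z, if crossing_sign p q then QOp (QGen x) (QGen y)
                 else QInv (QGen x) (QGen y))].

Definition fundamental_quandle : quandle :=
  presented_quandle crossing_relations.

Lemma endpoint_domain (i : 'I_n) (h : bool) :
  in_domain (inl i : component n m) (h%:R : R).
Proof. by case: h; rewrite /= ?lexx ?ler01. Qed.

Lemma endpoint_not_under (i : 'I_n) (h : bool) : ~ is_under L (inl i) h%:R.
Proof.
move=> u.
have [q] := under_double (endpoint_domain i h : in_fundamental (inl i) _) u.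
by apply: curve_endpoint; case: h {u}; [right | left].
Qed.

(* The arc adjacent to the leg (h = false, parameter 0) or to the head
   (h = true, parameter 1) of the i-th open component. *)
Definition end_arc (i : 'I_n) (h : bool) : diagram_arc :=
  exist _ (arc_of (inl i, h%:R))
    (ex_intro _ (inl i, h%:R)
       (And3 (endpoint_domain i h) (@endpoint_not_under i h) erefl)).

Lemma half_ord_subproof (k : 'I_(2 * n)) : (k./2 < n)%N.
Proof. by rewrite -divn2 ltn_divLR // [X in (_ < X)%N]mulnC. Qed.

(* The basepoints are l_1, h_1, ..., l_n, h_n in this order. *)
Definition fundamental_pointed_quandle : pointed_quandle (2 * n) :=
  @PointedQuandle (2 * n) fundamental_quandle
    (fun k : 'I_(2 * n) => \pi_(presented crossing_relations)
       (QGen (end_arc (Ordinal (half_ord_subproof k)) (odd k)))).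

End Fundamental.

(* The counting invariant is the cardinality of this set. *)
Definition counting_homs (R : realType) (n m : nat)
    (X : pointed_quandle (2 * n)) (L : diagram R n m) :
    set (fundamental_pointed_quandle L -> X) :=
  pq_hom (fundamental_pointed_quandle L) X.
Arguments counting_homs {R n m} X L.

(** * Isotopy *)

Definition ambient_isotopy (R : realType)
    (H : R^o * 'rV[R]_3 -> 'rV[R]_3) : Prop :=
  [/\ smooth H,
      (forall p, sphere p -> H (0, p) = p) &
      exists K : R^o * 'rV[R]_3 -> 'rV[R]_3, smooth K /\
        forall (t : R) p, 0 <= t <= 1 -> sphere p ->
          [/\ sphere (H (t, p)), sphere (K (t, p)),
              K (t, H (t, p)) = p & H (t, K (t, p)) = p]].

Definition reparametrization (R : realType) n m (c : component n m)
    (r : R -> R) : Prop :=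
  [/\ smooth (r : R^o -> R^o), (forall t, 0 < derive1 r t) &
      if c is inl _ then r 0 = 0 /\ r 1 = 1
      else forall t, r (t + 1) = r t + 1].

Definition relabel n m (s : 'S_m) (c : component n m) : component n m :=
  if c is inr j then inr (s j) else c.

(* Isotopic diagrams, up to orientation-preserving reparametrization; the open
   components are ordered, the closed ones are not. *)
Definition isotopic (R : realType) n m (L L' : diagram R n m) : Prop :=
  exists (H : R^o * 'rV[R]_3 -> 'rV[R]_3) (s : 'S_m)
         (r : component n m -> R -> R),
    [/\ ambient_isotopy H,
        (forall c, reparametrization c (r c)) &
        forall c t, in_domain c t ->
          curve L' (relabel s c) t = H (1, curve L c (r c t)) /\
          (is_under L' (relabel s c) t <-> is_under L c (r c t))].

(** * Reidemeister moves *)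

Definition square (R : realType) : set (R^o * R^o) :=
  [set z | -1 <= z.1 <= 1 /\ -1 <= z.2 <= 1].
Definition open_square (R : realType) : set (R^o * R^o) :=
  [set z | -1 < z.1 < 1 /\ -1 < z.2 < 1].

(* An orientation-preserving embedding of the square in the sphere; its image
   is the disk in which a move takes place. *)
Definition disk_chart (R : realType) (e : R^o * R^o -> 'rV[R]_3) : Prop :=
  [/\ smooth e,
      (forall z, square z -> sphere (e z)),
      (forall z w, square z -> square w -> e z = e w -> z = w) &
      forall z, square z -> 0 < orient (e z) ('D_(1, 0) e z) ('D_(0, 1) e z)].

Record strand (R : realType) n m := Strand {
  strand_comp : component n m;
  strand_start : R;
  strand_end : R
}.

Definition on_strand (R : realType) n m (s : strand R n m) (c : component n m)
    (t : R) : Prop :=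
  c = strand_comp s /\ strand_start s <= t <= strand_end s.

(* L and L' coincide away from the disk e(square); they meet the disk in the
   given strands only, which avoid the endpoints.  That strands of closed
   components do not contain the point of parameter 0 is achieved by
   reparametrization. *)
Definition local_change (R : realType) n m k (e : R^o * R^o -> 'rV[R]_3)
    (st : 'I_k -> strand R n m) (L L' : diagram R n m) : Prop :=
  [/\ disk_chart e,
      (forall i, [/\ 0 < strand_start (st i),
                     strand_start (st i) < strand_end (st i) &
                     strand_end (st i) < 1]),
      (forall i j c t, on_strand (st i) c t -> on_strand (st j) c t -> i = j) &
      forall c t, in_fundamental c t -> (forall i, ~ on_strand (st i) c t) ->
        [/\ curve L c t = curve L' c t, ~ (e @` @square R) (curve L c t) &
            (is_under L c t <-> is_under L' c t)]].

Definition strand_in_disk (R : realType) n m (e : R^o * R^o -> 'rV[R]_3)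
    (s : strand R n m) (L : diagram R n m) : Prop :=
  (forall t, strand_start s <= t <= strand_end s ->
     (e @` @square R) (curve L (strand_comp s) t)) /\
  (forall t, strand_start s < t < strand_end s ->
     (e @` @open_square R) (curve L (strand_comp s) t)).

(* R1: a strand without crossings in the disk is replaced by a strand with
   exactly one self-crossing in the disk, with any over/under information. *)
Definition R1_move (R : realType) n m (L L' : diagram R n m) : Prop :=
  exists e (st : 'I_1 -> strand R n m),
    let c := strand_comp (st 0) in
    let a := strand_start (st 0) in
    let b := strand_end (st 0) in
    [/\ local_change e st L L',
        strand_in_disk e (st 0) L /\ strand_in_disk e (st 0) L',
        (forall s t, a <= s -> s < t -> t <= b -> curve L c s <> curve L c t) &
        exists s0 t0, [/\ a <= s0, s0 < t0, t0 <= b &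
          forall s t, a <= s -> s < t -> t <= b ->
            (curve L' c s = curve L' c t <-> s = s0 /\ t = t0)]].

(* The affine bijection from the parameter interval of s onto [-1, 1],
   increasing if d and decreasing otherwise. *)
Definition abscissa (R : realType) n m (s : strand R n m) (d : bool) (t : R) :
    R :=
  (if d then 1 else -1) *
  (2 * (t - strand_start s) / (strand_end s - strand_start s) - 1).

(* In the square, the i-th strand is the graph of f i over [-1, 1], run
   through from left to right iff d i; at a crossing, the strand with the
   higher level is the over-strand. *)
Definition graph_tangle (R : realType) n m k (e : R^o * R^o -> 'rV[R]_3)
    (st : 'I_k -> strand R n m) (d : 'I_k -> bool) (level : 'I_k -> nat)
    (f : 'I_k -> R -> R) (L : diagram R n m) : Prop :=
  [/\ (forall i, smooth (f i : R^o -> R^o)),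
      (forall i x, -1 <= x <= 1 -> -1 < f i x < 1) &
      forall i t, strand_start (st i) <= t <= strand_end (st i) ->
        let x := abscissa (st i) (d i) t in
        curve L (strand_comp (st i)) t = e (x, f i x) /\
        (is_under L (strand_comp (st i)) t <->
           exists j, f j x = f i x /\ (level i < level j)%N)].

(* R2: two disjoint strands are replaced by two strands which cross exactly
   twice, one of them lying over the other at both crossings. *)
Definition R2_move (R : realType) n m (L L' : diagram R n m) : Prop :=
  exists e (st : 'I_2 -> strand R n m) (d : 'I_2 -> bool)
         (level : 'I_2 -> nat) (f g : 'I_2 -> R -> R),
    [/\ local_change e st L L', injective level,
        graph_tangle e st d level f L, graph_tangle e st d level g L' &
        (forall x, -1 <= x <= 1 -> f 0 x <> f 1 x) /\
        exists x1 x2 : R, [/\ -1 < x1, x1 < x2, x2 < 1 &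
          forall x, -1 <= x <= 1 -> (g 0 x = g 1 x <-> x = x1 \/ x = x2)]].

(* R3: three strands at three different levels, with every two of them crossing
   exactly once, before and after the move.  They are numbered from bottom to
   top on the left side of the square; from left to right the crossings are
   (0,1), (0,2), (1,2) before the move and (1,2), (0,2), (0,1) after it. *)
Definition R3_move (R : realType) n m (L L' : diagram R n m) : Prop :=
  exists e (st : 'I_3 -> strand R n m) (d : 'I_3 -> bool)
         (level : 'I_3 -> nat) (f g : 'I_3 -> R -> R),
    [/\ local_change e st L L', injective level,
        graph_tangle e st d level f L, graph_tangle e st d level g L' &
        [/\ f 0 (-1) < f 1 (-1) /\ f 1 (-1) < f 2 (-1),
            g 0 (-1) < g 1 (-1) /\ g 1 (-1) < g 2 (-1),
            (exists x01 x02 x12 : R,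
              (-1 < x01 /\ x01 < x02 /\ x02 < x12 /\ x12 < 1) /\
              forall x, -1 <= x <= 1 ->
                [/\ f 0 x = f 1 x <-> x = x01, f 0 x = f 2 x <-> x = x02 &
                    f 1 x = f 2 x <-> x = x12]) &
            (exists x01 x02 x12 : R,
              (-1 < x12 /\ x12 < x02 /\ x02 < x01 /\ x01 < 1) /\
              forall x, -1 <= x <= 1 ->
                [/\ g 0 x = g 1 x <-> x = x01, g 0 x = g 2 x <-> x = x02 &
                    g 1 x = g 2 x <-> x = x12])]].

Definition reidemeister_step (R : realType) n m (L L' : diagram R n m) : Prop :=
  [\/ isotopic L L', R1_move L L', R2_move L L' | R3_move L L'].

Definition reidemeister_equiv (R : realType) n m :
    diagram R n m -> diagram R n m -> Prop :=
  clos_refl_sym_trans _ (@reidemeister_step R n m).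

(* Main.v *)
Require Import Defs.
From HB Require Import structures.
From mathcomp Require Import all_boot all_order all_algebra all_fingroup.
From mathcomp Require Import generic_quotient.
From mathcomp Require Import all_classical all_reals all_analysis.
From mathcomp Require Import zify ring lra.

Set Implicit Arguments.
Unset Strict Implicit.
Unset Printing Implicit Defensive.

Import Order.TTheory GRing.Theory Num.Theory.
Import numFieldNormedType.Exports.

Local Open Scope classical_set_scope.
Local Open Scope quotient_scope.
Local Open Scope ring_scope.

(** A homomorphism from the fundamental pointed quandle to [X] amounts to a
    coloring: a function on the points of the curve with values in [X] that is
    locally constant away from the under-passages, jumps by the signed
    operation of the over-strand at each crossing, and has prescribed values
    at the legs and heads ([card_homs_coloring]).  All of these conditions are
    local in the parameter, so colorings can be transported along
    reparametrizations, cut and glued.  It then suffices to match the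
    colorings of two diagrams related by a single step.

    Isotopies.  Colorings are pulled back along the reparametrization
    ([pull_coloring]).  What is not formal is that the signs of the crossings
    agree.  If p is the image of a crossing with tangent vectors u and v, the
    determinant of H_t(p), dH_t(u), dH_t(v) is continuous in t, and it never
    vanishes because the smooth inverse of H_t provides a left inverse of dH_t
    on tangent vectors; so it has the same sign at t = 0, where H_0 is the
    identity of the sphere, and at t = 1 ([isotopy_orient_sign]).

    Local moves.  The two diagrams agree outside a disk, so it suffices that
    every coloring of one diagram, restricted to the outside, extends uniquely
    to the strands of the other one ([local_card]).

    For R1, both before and after the move the strand has one color: at the
    kink, either the over-passage has the incoming color x and the jump is
    trivial since x |> x = x, or it has the outgoing color, and the jump is
    trivial because the translations of a quandle are injective
    ([kink_color]).

    For R2 and R3 the strands are graphs over a common abscissa.  A coloring of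
    the strands is determined by the colors at the left side of the square,
    and when the abscissa sweeps the square each crossing changes one entry of
    this vector of colors; every initial vector occurs ([tangle_exists],
    [tangle_unique]).  Hence two tangles of this kind can be exchanged as soon
    as the composites of these elementary operations coincide
    ([tangle_card]).  When everything is read from left to right, the sign of
    an operation depends only on the direction of the over-strand and on the
    slopes of the two graphs, not on the direction of the under-strand
    ([graph_sign]).  For R2 the two graphs cross in opposite directions, so the
    two operations are inverse to each other; for R3 the equality of the
    composites is self-distributivity ([R3_fold]). *)

(** * The signed quandle operation *)

Section SignedOperation.
Variable X : quandle.

Definition qinv (x y : X) : X :=
  (let: exist g _ := cid (let: Bijective g gK Kg := qop_bij y in
     ex_intro (fun g => cancel (fun x => qop x y) g /\
                        cancel g (fun x => qop x y)) g (conj gK Kg)) in g) x.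

Definition qact (e : bool) (x y : X) : X := if e then qop x y else qinv x y.

Lemma qopK x y : qinv (qop x y) y = x.
Proof. by rewrite /qinv; case: cid => g []. Qed.

Lemma qinvK x y : qop (qinv x y) y = x.
Proof. by rewrite /qinv; case: cid => g []. Qed.

Lemma qactK e x y : qact (~~ e) (qact e x y) y = x.
Proof. by case: e; rewrite /qact /= ?qopK ?qinvK. Qed.

Lemma qactVK e x y : qact e (qact (~~ e) x y) y = x.
Proof. by rewrite -{1}[e]negbK qactK. Qed.

Lemma qact_idem e x : qact e x x = x.
Proof. by case: e; rewrite /qact ?qop_idem// -{1}[x]qop_idem qopK. Qed.

(** Translations are automorphisms of the quandle, and so are their inverses;
    automorphisms also respect the inverse operation. *)
Lemma qact_distr e e' x y z :
  qact e (qact e' x y) z = qact e' (qact e x z) (qact e y z).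
Proof.
have opinv a b c : qop (qinv a b) c = qinv (qop a c) (qop b c).
  by rewrite -[LHS](qopK _ (qop b c)) -qop_distr qinvK.
have inj (a b c : X) : qop a c = qop b c -> a = b.
  by move=> /(congr1 (fun u => qinv u c)); rewrite !qopK.
case: e; case: e'; rewrite /qact //; first exact: qop_distr.
- by apply: (inj _ _ z); rewrite qop_distr !qinvK.
- by apply: (inj _ _ z); rewrite [RHS]opinv !qinvK.
Qed.

End SignedOperation.

(** Stated for a relation rather than a map because the target type may be
    empty, so that no default value is available to extend a partial map. *)
Lemma card_eq_corr T U (A : set T) (B : set U) (rho : T -> U -> Prop) :
  (forall x, A x -> exists2 y, B y & rho x y) ->
  (forall y, B y -> exists2 x, A x & rho x y) ->
  (forall x y y', A x -> B y -> B y' -> rho x y -> rho x y' -> y = y') ->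
  (forall x x' y, A x -> A x' -> B y -> rho x y -> rho x' y -> x = x') ->
  (A #= B)%card.
Proof.
move=> AB BA funAB funBA; apply/card_bijP.
have f_ (x : A) : {y : B | rho (set_val x) (set_val y)}.
  apply: cid; case: x => x /= Ax; have [y By xy] := AB _ (set_mem Ax).
  by exists (exist _ y (mem_set By)).
have g_ (y : B) : {x : A | rho (set_val x) (set_val y)}.
  apply: cid; case: y => y /= By; have [x Ax xy] := BA _ (set_mem By).
  by exists (exist _ x (mem_set Ax)).
exists (fun x => sval (f_ x)); exists (fun y => sval (g_ y)) => [x|y].
- case: f_ => y /= xy; case: g_ => x' /= x'y; apply: val_inj.
  by apply: (funBA _ _ (set_val y)) => //; apply/set_mem/valP.
- case: g_ => x /= xy; case: f_ => y' /= xy'; apply: val_inj.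
  by apply: (funAB (set_val x)) => //; apply/set_mem/valP.
Qed.

(** * Germs and real induction *)

Section Germs.
Variable R : realType.
Implicit Types (t d : R) (P : R -> Prop).

Lemma near_leftP t P :
  (\forall r \near t^'-, P r) <->
  exists2 d, 0 < d & forall r, t - d < r < t -> P r.
Proof.
split.
- move=> /nbhs_ballP[d /= d0 dP]; exists d => // r /andP[r1 r2]; apply: dP => //=.
  by rewrite /ball/= ltr_norml; apply/andP; split; lra.
- move=> [d d0 dP]; near=> r; apply: dP; apply/andP; split => //.
  by near: r; apply: nbhs_left_gt; rewrite ltrBlDr ltrDl.
Unshelve. all: by end_near. Qed.

Lemma near_rightP t P :
  (\forall r \near t^'+, P r) <->
  exists2 d, 0 < d & forall r, t < r < t + d -> P r.
Proof.
split.
- move=> /nbhs_ballP[d /= d0 dP]; exists d => // r /andP[r1 r2]; apply: dP => //=.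
  by rewrite /ball/= ltr_norml; apply/andP; split; lra.
- move=> [d d0 dP]; near=> r; apply: dP; apply/andP; split => //.
  by near: r; apply: nbhs_right_lt; rewrite ltrDl.
Unshelve. all: by end_near. Qed.

Lemma near_twoP t P :
  (\forall r \near t, P r) <->
  exists2 d, 0 < d & forall r, t - d < r < t + d -> P r.
Proof.
split.
- move=> /nbhs_ballP[d /= d0 dP]; exists d => // r /andP[r1 r2]; apply: dP => //=.
  by rewrite /ball/= ltr_norml; apply/andP; split; lra.
- move=> [d d0 dP]; apply/nbhs_ballP; exists d => //= r.
  rewrite /ball/= ltr_norml => /andP[r1 r2]; apply: dP; apply/andP; split; lra.
Qed.

Lemma near_two_left t P : (\forall r \near t, P r) -> \forall r \near t^'-, P r.
Proof. exact: cvg_within. Qed.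

Lemma near_two_right t P : (\forall r \near t, P r) -> \forall r \near t^'+, P r.
Proof. exact: cvg_within. Qed.

Lemma near_sides t P : (\forall r \near t^'-, P r) -> P t ->
  (\forall r \near t^'+, P r) -> \forall r \near t, P r.
Proof.
move=> /near_leftP[d d0 dP] Pt /near_rightP[e e0 eP]; apply/near_twoP.
exists (Num.min d e); first by rewrite lt_min d0.
move=> r /andP[r1 r2]; have [rt|rt|->//] := ltgtP r t.
- apply: dP; rewrite rt andbT; apply: le_lt_trans r1.
  by rewrite lerD2l lerN2 ge_min lexx.
- apply: eP; rewrite rt /=; apply: lt_le_trans r2 _.
  by rewrite lerD2l ge_min lexx orbT.
Qed.

Lemma near_open_itv t a b : a < t < b -> \forall r \near t, a < r < b.
Proof.
move=> /andP[at_ tb]; apply/near_twoP; exists (Num.min (t - a) (b - t)).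
  by rewrite lt_min !subr_gt0 at_.
move=> r /andP[r1 r2]; apply/andP; split.
  apply: le_lt_trans r1.
  have : Num.min (t - a) (b - t) <= t - a by rewrite ge_min lexx.
  lra.
apply: (lt_le_trans r2).
have : Num.min (t - a) (b - t) <= b - t by rewrite ge_min lexx orbT.
lra.
Qed.

Lemma germ_unique T (F : set_system R) {PF : ProperFilter F} (f : R -> T) x y :
  (\forall r \near F, f r = x) -> (\forall r \near F, f r = y) -> x = y.
Proof.
move=> fx fy; have [r [<- <-]] : exists r, f r = x /\ f r = y.
  by apply: (@filter_ex _ F); apply: filterI.
by [].
Qed.

(** The supremum of the points up to which [P] holds can neither fail [P] nor
    lie below [b].  This is the form of connectedness that lets a local rule
    propagate past points where the propagated property says nothing. *)
Lemma real_induction (a b : R) (P : R -> Prop) : P a ->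
  (forall x, a <= x < b -> (forall y, a <= y <= x -> P y) ->
     \forall y \near x^'+, P y) ->
  (forall x, a < x <= b -> (forall y, a <= y < x -> P y) -> P x) ->
  forall x, a <= x <= b -> P x.
Proof.
move=> Pa Pr Pl z /andP[az zb].
pose S : set R := [set x | a <= x <= b /\ forall y, a <= y <= x -> P y].
have Sa : S a.
  split; first by rewrite lexx (le_trans az).
  by move=> y /andP[? ?]; have -> : y = a by apply/le_anti/andP.
have Sub : ubound S b by move=> x [/andP[]].
have hS : has_sup S by split; [exists a|exists b].
set s := sup S.
have as_ : a <= s by apply: ub_le_sup Sa; exists b.
have sb : s <= b by apply: ge_sup => //; exists a.
have Plt y : a <= y < s -> P y.
  move=> /andP[ay ys]; have [x Sx yx] := sup_adherent (eps:=s - y) (ltac:(lra)) hS.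
  case: Sx => _; apply; rewrite ay/= ltW//.
  by apply: le_lt_trans yx; rewrite -/s; lra.
have Ps y : a <= y <= s -> P y.
  move=> /andP[ay]; rewrite le_eqVlt => /predU1P[->|ys]; last first.
    by apply: Plt; rewrite ay.
  have [<-//|/eqP ns] := eqVneq a s.
  by apply: Pl => //; rewrite sb andbT lt_neqAle as_ andbT; apply/eqP.
suff sE : s = b by apply: Ps; rewrite az sE.
apply/le_anti; rewrite sb/= leNgt; apply/negP => sltb.
have /near_rightP[d d0 dP] := Pr s (ltac:(rewrite as_ sltb//)) Ps.
pose u := s + Num.min (d / 2) (b - s).
have m0 : 0 < Num.min (d / 2) (b - s) by rewrite lt_min subr_gt0 sltb andbT; lra.
have su : s < u by rewrite /u; lra.
have : S u.
  split.
    apply/andP; split; first by lra.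
    have : Num.min (d / 2) (b - s) <= b - s by rewrite ge_min lexx orbT.
    rewrite /u; lra.
  move=> y /andP[ay yu]; have [ys|sy] := leP y s; first by apply: Ps; rewrite ay.
  apply: dP; rewrite sy/=; apply: le_lt_trans yu _.
  have : Num.min (d / 2) (b - s) <= d / 2 by rewrite ge_min lexx.
  rewrite /u; lra.
move=> Su; have : u <= s by apply: ub_le_sup Su; exists b.
by rewrite leNgt su.
Qed.

Lemma locally_constant_const T (f : R -> T) (a b : R) :
  (forall x, a <= x <= b -> \forall y \near x, a <= y <= b -> f y = f x) ->
  forall x, a <= x <= b -> f x = f a.
Proof.
move=> fc; apply: real_induction => //.
- move=> x /andP[ax xb] Px; have axb : a <= x <= b by rewrite ax ltW.
  apply: filterS3 (near_two_right (fc x axb)) (nbhs_right_gt x) (nbhs_right_lt xb).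
  move=> w fw xw wb; rewrite fw; first by apply: Px; rewrite ax lexx.
  by rewrite (ltW wb) (le_trans ax (ltW xw)).
- move=> x /andP[ax xb] Px; have axb : a <= x <= b by rewrite (ltW ax).
  have /near_leftP[d d0 dP] := near_two_left (fc x axb).
  have m0 : Num.min d (x - a) <= x - a by rewrite ge_min lexx orbT.
  have m1 : Num.min d (x - a) <= d by rewrite ge_min lexx.
  have m2 : 0 < Num.min d (x - a) by rewrite lt_min d0 subr_gt0.
  rewrite -(dP (x - Num.min d (x - a) / 2)).
  - by apply: Px; apply/andP; split; lra.
  - by apply/andP; split; lra.
  - by apply/andP; split; lra.
Qed.

Lemma near_notin_finite (F : set R) t : finite_set F ->
  \forall r \near t, r != t -> ~ F r.
Proof.
move=> finF; have cF : closed (F `\ t).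
  apply: (accessible_finite_set_closed.1 _); last exact: finite_setD.
  exact/hausdorff_accessible/norm_hausdorff.
have : nbhs t (~` (F `\ t)).
  by apply: open_nbhs_nbhs; split; [exact: closed_openC|case=> _; exact].
by apply: filterS => r nF /eqP rt Fr; apply: nF.
Qed.

Section MonotoneBijection.
Variables (f g : R -> R) (d : bool).
Hypothesis gK : cancel g f.
Hypothesis f_lt : forall x y, (f x < f y) = (if d then x < y else y < x).

Lemma monotone_near_left x P :
  (if d then \forall r \near (f x)^'-, P r else \forall r \near (f x)^'+, P r) ->
  \forall y \near x^'-, P (f y).
Proof.
case: d f_lt => flt.
- move=> /near_leftP[e e0 eP]; apply/near_leftP; exists (x - g (f x - e)).
    by rewrite subr_gt0 -flt gK; lra.
  move=> y; rewrite opprB addrC subrK => /andP[y1 y2]; apply: eP.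
  by rewrite flt y2 andbT -[_ - _](gK) flt.
- move=> /near_rightP[e e0 eP]; apply/near_leftP; exists (x - g (f x + e)).
    by rewrite subr_gt0 -flt gK; lra.
  move=> y; rewrite opprB addrC subrK => /andP[y1 y2]; apply: eP.
  by rewrite flt y2 -[_ + _](gK) flt.
Qed.

Lemma monotone_near_right x P :
  (if d then \forall r \near (f x)^'+, P r else \forall r \near (f x)^'-, P r) ->
  \forall y \near x^'+, P (f y).
Proof.
case: d f_lt => flt.
- move=> /near_rightP[e e0 eP]; apply/near_rightP; exists (g (f x + e) - x).
    by rewrite subr_gt0 -flt gK; lra.
  move=> y; rewrite addrC subrK => /andP[y1 y2]; apply: eP.
  by rewrite flt y1 -[_ + _](gK) flt.
- move=> /near_leftP[e e0 eP]; apply/near_rightP; exists (g (f x - e) - x).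
    by rewrite subr_gt0 -flt gK; lra.
  move=> y; rewrite addrC subrK => /andP[y1 y2]; apply: eP.
  by rewrite flt y1 andbT -[_ - _](gK) flt.
Qed.

Lemma monotone_near x P :
  (\forall r \near f x, P r) -> \forall y \near x, P (f y).
Proof.
move=> nP; apply: near_sides.
- by apply: monotone_near_left; case: d; [exact: near_two_left|exact: near_two_right].
- exact: nbhs_singleton nP.
- by apply: monotone_near_right; case: d; [exact: near_two_right|exact: near_two_left].
Qed.

End MonotoneBijection.

End Germs.

(** * Parameters and crossings of a diagram *)

Section Reduction.
Variable R : realType.

Lemma periodicz T (f : R -> T) (k : int) t :
  (forall t, f (t + 1) = f t) -> f (t + k%:~R) = f t.
Proof.
move=> f1; have fn (i : nat) s : f (s + i%:R) = f s.
  elim: i s => [|i IH] s; first by rewrite addr0.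
  by rewrite -natr1 addrA f1 IH.
case: k => i; first exact: fn.
by rewrite NegzE mulrNz -pmulrn -[LHS](fn i.+1) subrK.
Qed.

Variables n m : nat.
Implicit Types (c : component n m) (t : R).

(** Closed components are parametrized by the real line, crossings and strands
    by the fundamental domain; this is the passage from the former to the
    latter. *)
Definition reduce c t : R := if c is inr _ then t - (Num.floor t)%:~R else t.

Lemma reduce_fundamental c t : in_domain c t -> in_fundamental c (reduce c t).
Proof.
case: c => //= j _; have := floor_itv t.
by rewrite intrD1 => /andP[? ?]; apply/andP; split; lra.
Qed.

Lemma fundamental_domain c t : in_fundamental c t -> in_domain c t.
Proof. by case: c. Qed.

Lemma reduce_id c t : in_fundamental c t -> reduce c t = t.
Proof.
case: c => //= j /andP[t0 t1]; rewrite (_ : Num.floor t = 0) ?subr0//.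
by apply: floor_def; rewrite add0r; apply/andP.
Qed.

Lemma reduceE c t : reduce c t = t \/
  exists j (k : int), c = inr j /\ reduce c t = t + k%:~R.
Proof.
case: c => [i|j]; [by left|right]; exists j, (- Num.floor t); split => //=.
by rewrite mulrNz.
Qed.

Lemma reduce_shift (j : 'I_m) (l : int) t : 0 <= t + l%:~R < 1 ->
  reduce (inr j : component n m) t = t + l%:~R.
Proof.
move=> H; rewrite -(@reduce_id (inr j) (t + l%:~R) H) /=.
suff -> : Num.floor (t + l%:~R) = Num.floor t + l by rewrite intrD; ring.
have /andP[t1 t2] := floor_itv t; rewrite intrD1 in t2.
by apply: floor_def; rewrite !intrD; apply/andP; split; lra.
Qed.

Lemma reduce_periodic (j : 'I_m) t :
  reduce (inr j : component n m) (t + 1) = reduce (inr j : component n m) t.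
Proof.
have /andP[t1 t2] := @reduce_fundamental (inr j) t Logic.I.
rewrite (@reduce_shift j (- Num.floor t - 1)); last first.
  by rewrite intrB mulrNz /=; apply/andP; split; move: t1 t2; rewrite /=; lra.
by rewrite intrB mulrNz /=; ring.
Qed.

Lemma unit_fundamental c t : 0 < t < 1 -> in_fundamental c t.
Proof. by case: c => c /= /andP[t0 t1]; apply/andP; split=> //; apply: ltW. Qed.

End Reduction.

Section DiagramBasics.
Variables (R : realType) (n m : nat) (L : diagram R n m).
Implicit Types (c : component n m) (t : R) (p q : component n m * R).

Definition good p := in_domain p.1 p.2 /\ ~ is_under L p.1 p.2.

(** Unlike [double_point], this ranges over all parameters of closed
    components, which makes it compatible with reparametrizations; the two
    notions agree up to [reduce].  The point [p] is the under-passage. *)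
Definition crossing p q :=
  [/\ in_domain p.1 p.2, in_domain q.1 q.2,
      curve L p.1 p.2 = curve L q.1 q.2, is_under L p.1 p.2 &
      ~ is_under L q.1 q.2].

Lemma curve_shift j (k : int) t :
  curve L (inr j) (t + k%:~R) = curve L (inr j) t.
Proof. exact/periodicz/curve_periodic. Qed.

Lemma derive_shift j (k : int) t :
  derive1 (curve L (inr j)) (t + k%:~R) = derive1 (curve L (inr j)) t.
Proof.
have H t' : derive1 (curve L (inr j)) (t' + 1) = derive1 (curve L (inr j)) t'.
  rewrite !derive1E /derive; set f := fun h => _; set g := fun h => _.
  suff -> : f = g by []; apply/funext => h; rewrite /f /g /=.
  by rewrite addrA curve_periodic curve_periodic.
exact: (periodicz k t H).
Qed.

Lemma under_shift j (k : int) t :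
  is_under L (inr j) (t + k%:~R) = is_under L (inr j) t.
Proof. by apply: periodicz => {}t; exact: (propext (under_periodic L j t)). Qed.

Lemma reduce_curve c t : curve L c (reduce c t) = curve L c t.
Proof.
by have [->//|[j [k [-> ->]]]] := reduceE c t; rewrite curve_shift.
Qed.

Lemma reduce_derive c t :
  derive1 (curve L c) (reduce c t) = derive1 (curve L c) t.
Proof.
by have [->//|[j [k [-> ->]]]] := reduceE c t; rewrite derive_shift.
Qed.

Lemma reduce_under c t : is_under L c (reduce c t) = is_under L c t.
Proof.
by have [->//|[j [k [-> ->]]]] := reduceE c t; rewrite under_shift.
Qed.

Lemma crossing_double p q : crossing p q ->
  double_point (curve L) (p.1, reduce p.1 p.2) (q.1, reduce q.1 q.2).
Proof.
move=> [dp dq pq up uq]; split => /=; try exact: reduce_fundamental.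
  move=> [c1]; rewrite -c1 => r12; apply: uq.
  by rewrite -c1 -reduce_under -r12 reduce_under.
by rewrite !reduce_curve.
Qed.

Lemma double_crossing p q : double_point (curve L) p q -> is_under L p.1 p.2 ->
  crossing p q.
Proof.
move=> pq up; have /(under_over pq) uq := up; case: pq => dp dq _ epq.
by split => //; exact: fundamental_domain.
Qed.

Lemma reduce_crossing_sign p q :
  crossing_sign L (p.1, reduce p.1 p.2) (q.1, reduce q.1 q.2) =
  crossing_sign L p q.
Proof. by rewrite /crossing_sign /= reduce_curve !reduce_derive. Qed.

(** Crossings are away from the endpoints, so a curve is defined on both sides
    of a crossing. *)
Lemma crossing_near_domain p q : crossing p q ->
  (\forall x \near p.2, in_domain p.1 x) /\ (\forall x \near q.2, in_domain q.1 x).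
Proof.
move=> pq; have dpq := crossing_double pq.
have inner (d : component n m) t u : in_domain d t ->
    double_point (curve L) (d, reduce d t) u -> \forall x \near t, in_domain d x.
  case: d => [i|j] /= dt du; last by apply: filterE.
  have dt' := dt; case/andP: dt' => t0 t1.
  have /near_open_itv : 0 < t < 1.
    by rewrite !lt_neqAle t0 t1 !andbT; apply/andP; split; apply/eqP => tE;
    apply: (@curve_endpoint _ _ _ L i t u) => //; [left|right].
  by apply: filterS => x /andP[? ?]; apply/andP; split; apply: ltW.
case: pq => dp dq pq _ _; split; first exact: inner dp dpq.
apply: (inner _ _ _ dq); case: dpq => d1 d2 d12 d12'.
by split; [exact: d2|exact: d1|by move=> E; apply: d12|].
Qed.

Lemma crossing_transverse p q : crossing p q ->
  orient (curve L p.1 p.2) (derive1 (curve L q.1) q.2) (derive1 (curve L p.1) p.2)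
    != 0.
Proof.
move=> pq; have [d1 d2 d12 d12'] := crossing_double pq; case: pq => _ _ pq _ _.
have dqp : double_point (curve L) (q.1, reduce q.1 q.2) (p.1, reduce p.1 p.2).
  by split => //; move=> E; apply: d12.
by have := curve_transverse dqp; rewrite /= reduce_curve !reduce_derive -pq.
Qed.

Lemma crossing_signE c d t u :
  crossing_sign L (c, t) (d, u) =
  (0 < orient (curve L c t) (derive1 (curve L d) u) (derive1 (curve L c) t)).
Proof. by []. Qed.

(** There are finitely many crossings in the fundamental domain; near [t], a
    parameter of a closed component is reduced by one of two consecutive
    integers. *)
Lemma under_isolated c t :
  \forall r \near t, r != t -> in_domain c r -> ~ is_under L c r.
Proof.
pose F : set R := [set s | in_fundamental c s /\ is_under L c s].
(* Every under-passage is a double point. *)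
have finF : finite_set F.
  apply: sub_finite_set (finite_image snd (curve_finite L)) => s [ds us].
  by exists (c, s) => //; exact: under_double.
have Fred r : in_domain c r -> is_under L c r -> F (reduce c r).
  by move=> dr ur; split; [exact: reduce_fundamental|rewrite reduce_under].
case: c @F finF Fred => [i|j] F finF Fred.
  apply: filterS (near_notin_finite t finF) => r nF rt dr ur.
  by apply: nF => //; exact: Fred.
pose a := (Num.floor t)%:~R : R.
have /andP[at1 at2] := floor_itv t.
rewrite intrD1 -/a in at1 at2.
have := @near_notin_finite _ ([set x + a | x in F] `|` [set x + (a - 1) | x in F]) t.
rewrite finite_setU => /(_ (conj (finite_image _ finF) (finite_image _ finF))).
have /near_open_itv : a - 1 < t < a + 1 by apply/andP; split; lra.
apply: filterS2 => r /andP[r1 r2] nF rt dr ur; apply: nF rt _.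
have := Fred r dr ur; rewrite /reduce /=.
have /andP[b1 b2] := floor_itv r.
rewrite intrD1 in b1 b2.
have k1 : (Num.floor r < Num.floor t + 1)%R by rewrite -(ltr_int R) intrD1 -/a; lra.
have k2 : (Num.floor t < Num.floor r + 1 + 1)%R.
  by rewrite -(ltr_int R) !intrD1 -/a; lra.
move=> Fr.
have [kE|kE] : Num.floor r = Num.floor t \/ Num.floor r = Num.floor t - 1.
- by case: (eqVneq (Num.floor r) (Num.floor t)) => ?; [left|right; lia].
- by left; exists (r - (Num.floor r)%:~R) => //; rewrite kE -/a subrK.
- right; exists (r - (Num.floor r)%:~R) => //.
  by rewrite kE intrB -/a subrK.
Qed.

End DiagramBasics.

(** * Colorings *)

Section Colorings.
Variables (R : realType) (n m : nat) (X : pointed_quandle (2 * n)).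
Implicit Types (L : diagram R n m) (phi psi : component n m -> R -> X).
Implicit Types (c : component n m) (t : R) (p q : component n m * R).

(** Points rather than arcs carry the colors, and all conditions but the first
    and the last are local: this is what allows colorings to be glued.  At a
    crossing the condition bears on the germs on the two sides of the
    under-passage. *)
Record coloring L phi : Prop := Coloring {
  color_periodic : forall j t, phi (inr j) (t + 1) = phi (inr j) t;
  color_const : forall c t, in_fundamental c t -> ~ is_under L c t ->
    \forall r \near t, in_domain c r -> phi c r = phi c t;
  color_cross : forall p q, double_point (curve L) p q ->
    is_under L p.1 p.2 -> exists x z,
    [/\ \forall r \near p.2^'-, phi p.1 r = x,
        \forall r \near p.2^'+, phi p.1 r = z &
        z = qact (crossing_sign L p q) x (phi q.1 q.2)];
  color_ends : forall k : 'I_(2 * n),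
    phi (inl (Ordinal (half_ord_subproof k))) (odd k)%:R = basepoint X k
}.

(** Two colorings that agree in this sense come from the same homomorphism. *)
Definition eq_good L phi psi :=
  forall p, good L p -> phi p.1 p.2 = psi p.1 p.2.

Section Properties.
Variables (L : diagram R n m) (phi : component n m -> R -> X).
Hypothesis col : coloring L phi.

Lemma color_shift j (k : int) t :
  phi (inr j) (t + k%:~R) = phi (inr j) t.
Proof. exact/periodicz/(color_periodic col). Qed.

Lemma color_reduce c t : phi c (reduce c t) = phi c t.
Proof. by have [->//|[j [k [-> ->]]]] := reduceE c t; rewrite color_shift. Qed.

Lemma near_color_reduce c t (P : X -> Prop) : in_domain c t ->
  (\forall r \near reduce c t, in_domain c r -> P (phi c r)) ->
  \forall r \near t, in_domain c r -> P (phi c r).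
Proof.
move=> dt; have [->//|[j [k [-> ->]]]] := reduceE c t.
move=> /near_twoP[d d0 dP]; apply/near_twoP; exists d => // r /andP[r1 r2] _.
by rewrite -(color_shift j k); apply: dP => //; apply/andP; split; lra.
Qed.

Lemma left_color_reduce c t (P : X -> Prop) :
  (\forall r \near (reduce c t)^'-, P (phi c r)) ->
  \forall r \near t^'-, P (phi c r).
Proof.
have [->//|[j [k [-> ->]]]] := reduceE c t.
move=> /near_leftP[d d0 dP]; apply/near_leftP; exists d => // r /andP[r1 r2].
by rewrite -(color_shift j k); apply: dP => //; apply/andP; split; lra.
Qed.

Lemma right_color_reduce c t (P : X -> Prop) :
  (\forall r \near (reduce c t)^'+, P (phi c r)) ->
  \forall r \near t^'+, P (phi c r).
Proof.
have [->//|[j [k [-> ->]]]] := reduceE c t.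
move=> /near_rightP[d d0 dP]; apply/near_rightP; exists d => // r /andP[r1 r2].
by rewrite -(color_shift j k); apply: dP => //; apply/andP; split; lra.
Qed.

Lemma color_const_domain c t : good L (c, t) ->
  \forall r \near t, in_domain c r -> phi c r = phi c t.
Proof.
move=> [/= dt ut]; apply: (near_color_reduce (P := fun x => x = _)) => //.
rewrite -color_reduce; apply: (color_const col); first exact: reduce_fundamental.
by rewrite reduce_under.
Qed.

Lemma color_crossing p q : crossing L p q -> exists x z,
  [/\ \forall r \near p.2^'-, phi p.1 r = x,
      \forall r \near p.2^'+, phi p.1 r = z &
      z = qact (crossing_sign L p q) x (phi q.1 q.2)].
Proof.
move=> pq; have dpq := crossing_double pq.
have [|x [z [/= xl zr zE]]] := color_cross col dpq.
  by case: pq => ? ? ? ?; rewrite /= reduce_under.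
exists x, z; split; [exact: (left_color_reduce (P := eq^~ x))| |].
- exact: (right_color_reduce (P := eq^~ z)).
- by rewrite zE reduce_crossing_sign color_reduce.
Qed.

Lemma color_itv c (u v : R) : u <= v ->
  (forall w, u <= w <= v -> in_domain c w) ->
  (forall w, u <= w <= v -> ~ is_under L c w) -> phi c u = phi c v.
Proof.
move=> uv dw uw; symmetry.
apply: (locally_constant_const (a := u) (b := v)); last by rewrite uv lexx.
move=> w wuv.
have := color_const_domain (conj (dw w wuv) (uw w wuv) : good L (c, w)).
by apply: filterS => r Pr ruv; apply: Pr; apply: dw.
Qed.

Lemma color_same_parameter c s t : same_parameter c s t -> phi c s = phi c t.
Proof. by case: c => [i /= ->//|j /= [k ->]]; rewrite color_shift. Qed.

(** A locally constant function is constant on an arc. *)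
Lemma color_joined p q : joined L p q -> phi p.1 p.2 = phi q.1 q.2.
Proof.
case: p q => [c s] [c' t] [/= <- ds dt [u [v [su tv nu]]]].
rewrite (color_same_parameter su) (color_same_parameter tv).
have inw w : Num.min u v <= w <= Num.max u v -> in_domain c w.
  case: c ds dt su tv {nu} => //= i /andP[s0 s1] /andP[t0 t1] <- <-.
  rewrite ge_min le_max => /andP[/orP[a|a] /orP[b|b]];
  by apply/andP; split; lra.
have [uv|/ltW vu] := leP u v.
- apply: color_itv => // w ?; [apply: inw|apply: nu];
  by rewrite (min_idPl uv) (max_idPr uv).
- symmetry; apply: color_itv => // w ?; [apply: inw|apply: nu];
  by rewrite (min_idPr vu) (max_idPl vu).
Qed.

End Properties.
End Colorings.

(** * Arcs *)

Section Arcs.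
Variables (R : realType) (n m : nat) (L : diagram R n m).
Implicit Types (c : component n m) (t : R) (p q : component n m * R).

Lemma joined_good p q : joined L p q -> good L p /\ good L q.
Proof.
have suff_under c s u : same_parameter c s u ->
    ~ is_under L c u -> ~ is_under L c s.
  by case: c => [i /= ->|j /= [k ->]] //; rewrite under_shift.
case: p q => [c s] [c' t] [/= <- ds dt [u [v [su tv nu]]]].
split; split=> //=.
- apply: (suff_under _ _ _ su); apply: nu.
  by rewrite ge_min le_max lexx.
- apply: (suff_under _ _ _ tv); apply: nu.
  by rewrite ge_min le_max lexx !orbT.
Qed.

Lemma joined_sym p q : joined L p q -> joined L q p.
Proof.
case: p q => [c s] [c' t] [/= <- ds dt [u [v [su tv nu]]]]; split => //=.
by exists v, u; split => // w; rewrite minC maxC; exact: nu.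
Qed.

Lemma joined_refl p : good L p -> joined L p p.
Proof.
case: p => c s [/= ds us]; split => //=; exists s, s.
have ss : same_parameter c s s by case: c {ds us} => //= j; exists 0; rewrite addr0.
split => // w; rewrite minxx maxxx => /andP[? ?].
by rewrite (_ : w = s)//; apply/le_anti/andP.
Qed.

(** On a closed component the two paths are lifted to the real line, and the
    second lift is shifted by an integer so as to start where the first one
    ends. *)
Lemma joined_trans p q r : joined L p q -> joined L q r -> joined L p r.
Proof.
case: p q r => [c s] [c' t] [c'' t'].
move=> [/= <- ds dt [u [v [su tv nu]]]] [/= <- _ dt' [v' [w [tv' tw' nu']]]].
split => //=.
(* [k] is the integer by which the second path is shifted, and 0 on open
   components. *)
have [k [vE kw]] : exists k : R, v = v' + k /\ same_parameter c t' (w + k) /\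
    forall x, is_under L c (x + k) = is_under L c x.
  case: c {su nu nu'} ds dt dt' tv tv' tw' => [i|j] /= ds dt dt'.
    move=> <- <- <-; exists 0; rewrite !addr0; split=> //; split=> // x.
    by rewrite addr0.
  move=> [k ->] [k' ->] [l ->]; exists (k%:~R - k'%:~R); split; first by lra.
  split; first by exists (l + k - k'); rewrite !intrD intrN; lra.
  by move=> x; rewrite -intrB under_shift.
case: kw => tw uk; exists u, (w + k); split => // x /andP[].
have nu2 y : Num.min v (w + k) <= y <= Num.max v (w + k) -> ~ is_under L c y.
  move=> yv; rewrite -(subrK k y) uk; apply: nu'.
  by move: yv; rewrite vE -addr_minl -addr_maxl lerBrDr lerBlDr.
rewrite ge_min le_max => /orP[a|a] /orP[b|b].
- have [xv|/ltW vx] := leP x v.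
    by apply: nu; rewrite ge_min a le_max xv orbT.
  by apply: nu; rewrite ge_min a le_max b.
- have [xv|/ltW vx] := leP x v.
    by apply: nu; rewrite ge_min a le_max xv orbT.
  by apply: nu2; rewrite ge_min vx le_max b orbT.
- have [xv|/ltW vx] := leP x v.
    by apply: nu2; rewrite ge_min a orbT le_max xv.
  by apply: nu; rewrite ge_min vx orbT le_max b.
- have [xv|/ltW vx] := leP x v.
    by apply: nu2; rewrite ge_min a orbT le_max xv.
  by apply: nu2; rewrite ge_min vx le_max b orbT.
Qed.

Lemma joined_reduce p : good L p -> joined L p (p.1, reduce p.1 p.2).
Proof.
case: p => c t [/= dt ut]; split => //=.
  exact/fundamental_domain/reduce_fundamental.
exists t, t; split => //.
- by case: (c) => //= j; exists 0; rewrite addr0.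
- by case: (c) => //= j; exists (Num.floor t); rewrite subrK.
- move=> w; rewrite minxx maxxx => /andP[? ?].
  by rewrite (_ : w = t)//; apply/le_anti/andP.
Qed.

Lemma arc_of_eq p q : joined L p q -> arc_of L p = arc_of L q.
Proof.
move=> pq; apply/seteqP; split => r; apply: joined_trans => //.
exact: joined_sym.
Qed.

Definition good_arc p (gp : good L p) : diagram_arc L :=
  exist _ (arc_of L p) (ex_intro _ p (And3 gp.1 gp.2 erefl)).

Lemma arc_good (a : diagram_arc L) p : sval a p -> good L p.
Proof. by case: a => a /= [q [dq uq ->]] /joined_good[]. Qed.

Lemma arc_eq (a b : diagram_arc L) p : sval a p -> sval b p -> a = b.
Proof.
case: a b => [a [q [dq uq aE]]] [b [r [dr ur bE]]] /= ap bp.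
apply: eq_exist => /=; rewrite aE bE in ap bp *.
by apply: arc_of_eq; apply: joined_trans ap (joined_sym bp).
Qed.

Lemma arc_inhabited (a : diagram_arc L) : exists p, sval a p.
Proof.
by case: a => a /= [q [dq uq ->]]; exists q; exact: joined_refl.
Qed.

Lemma good_exists c : exists t, good L (c, t).
Proof.
have /near_rightP[d d0 dP] := near_two_right (under_isolated L c 0).
have m2 : 0 < Num.min (d / 2) 1 by rewrite lt_min ltr01 andbT; lra.
have m1 : Num.min (d / 2) 1 <= d / 2 by rewrite ge_min lexx.
have m0 : Num.min (d / 2) 1 <= 1 by rewrite ge_min lexx orbT.
exists (Num.min (d / 2) 1).
have dom : in_domain c (Num.min (d / 2) 1).
  by case: (c) => //= _; rewrite (ltW m2).
split => //=; apply: dP => //; last by rewrite gt_eqF.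
by rewrite m2 /=; lra.
Qed.

Lemma good_near p : good L p ->
  \forall r \near p.2, in_domain p.1 r -> joined L p (p.1, r).
Proof.
case: p => c t gt; have [/= dt ut] := gt.
have /near_twoP[d d0 dP] := under_isolated L c t.
apply/near_twoP; exists d => //= r /andP[r1 r2] dr; split => //=; exists t, r.
have ss u : same_parameter c u u by case: (c) => //= j; exists 0; rewrite addr0.
split=> // w /andP[w1 w2]; have [->//|wt] := eqVneq w t.
apply: dP => //.
- move: w1 w2; rewrite ge_min le_max => /orP[a|a] /orP[b|b];
  by apply/andP; split; lra.
- case: (c) dt dr => //= _ /andP[? ?] /andP[? ?].
  by move: w1 w2; rewrite ge_min le_max => /orP[a|a] /orP[b|b];
  apply/andP; split; lra.
Qed.

(** Where there is no arc, as at an under-passage, some arc of the same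
    component serves as default value; this makes sense even if the quandle is
    empty. *)
Definition arc_at p : diagram_arc L :=
  if pselect (good L p) is left gp then good_arc gp
  else good_arc (projT2 (cid (good_exists p.1))).

Lemma arc_atP p : good L p -> sval (arc_at p) p.
Proof. by rewrite /arc_at; case: pselect => // gp _; exact: joined_refl. Qed.

Lemma arc_at_eq (a : diagram_arc L) p : sval a p -> arc_at p = a.
Proof. by move=> ap; apply: (arc_eq (arc_atP (arc_good ap)) ap). Qed.

(** By [under_isolated], the points on each side of a crossing are joined to
    each other. *)
Lemma incoming_outgoing p q : crossing L p q ->
  (exists x : diagram_arc L, incoming p x) /\
  (exists z : diagram_arc L, outgoing p z).
Proof.
move=> pq; have [+ _] := crossing_near_domain pq.
case: p pq => c t [/= dt _ _ ut _] /near_twoP[d d0 dP].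
have /near_twoP[e e0 eP] := under_isolated L c t.
pose h := Num.min d e.
have h0 : 0 < h by rewrite lt_min d0.
have hd : h <= d by rewrite ge_min lexx.
have he : h <= e by rewrite ge_min lexx orbT.
have ok r : t - h < r < t + h -> r != t -> good L (c, r).
  move=> /andP[r1 r2] rt; have dr : in_domain c r by apply: dP; apply/andP; split; lra.
  by split => //=; apply: eP => //; apply/andP; split; lra.
have ss u : same_parameter c u u by case: (c) => //= j; exists 0; rewrite addr0.
have jn r s : (t - h < r < t /\ t - h < s < t) \/ (t < r < t + h /\ t < s < t + h) ->
    joined L (c, r) (c, s).
  move=> H; have H' w : Num.min r s <= w <= Num.max r s ->
      t - h < w < t \/ t < w < t + h.
    rewrite ge_min le_max => /andP[a b].
    case: H => -[/andP[? ?] /andP[? ?]]; [left|right];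
    by case/orP: a => a; case/orP: b => b; apply/andP; split; lra.
  have gd w : Num.min r s <= w <= Num.max r s -> good L (c, w).
    move=> /H'[/andP[? ?]|/andP[? ?]]; apply: ok.
    - by apply/andP; split; lra.
    - by rewrite lt_eqF.
    - by apply/andP; split; lra.
    - by rewrite gt_eqF.
  split => //=.
  - by apply: (gd r _).1; rewrite ge_min le_max lexx.
  - by apply: (gd s _).1; rewrite ge_min le_max lexx !orbT.
  - by exists r, s; split => // w /gd[].
have gl : good L (c, t - h / 2).
  by apply: ok; [apply/andP; split; lra|rewrite lt_eqF//; lra].
have gr : good L (c, t + h / 2).
  by apply: ok; [apply/andP; split; lra|rewrite gt_eqF//; lra].
split; [exists (good_arc gl)|exists (good_arc gr)]; exists h => // r /= rr;
  apply: jn; [left|right]; split=> //; apply/andP; split; lra.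
Qed.

End Arcs.

(** * Homomorphisms from the fundamental quandle *)

Section Homs.
Variables (R : realType) (n m : nat) (X : pointed_quandle (2 * n)).
Variable L : diagram R n m.
Implicit Types (c : component n m) (t : R) (p q : component n m * R).

Let Q := presented (crossing_relations (L := L)).
Let gen (a : diagram_arc L) : fundamental_pointed_quandle L :=
  \pi_Q (QGen a).

Lemma pi_op (t u : qterm (diagram_arc L)) :
  \pi_Q (QOp t u) = @qop (fundamental_quandle L) (\pi_Q t) (\pi_Q u).
Proof.
apply: (presented_eq (rel := crossing_relations (L := L))).
by apply: qcong_op; apply/qcong_sym/qcong_repr.
Qed.

Lemma pi_inv (t u : qterm (diagram_arc L)) :
  \pi_Q (QInv t u) = @qinv (fundamental_quandle L) (\pi_Q t) (\pi_Q u).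
Proof.
have inj (b a a' : fundamental_quandle L) : qop a b = qop a' b -> a = a'.
  by move=> /(congr1 (fun u => qinv u b)); rewrite !qopK.
apply: (inj (\pi_Q u)); rewrite qinvK -pi_op.
apply: (presented_eq (rel := crossing_relations (L := L))).
exact: qcong_invK.
Qed.

Lemma hom_inv (f : fundamental_quandle L -> X) :
  (forall a b, f (qop a b) = qop (f a) (f b)) ->
  forall a b, f (qinv a b) = qinv (f a) (f b).
Proof. by move=> fop a b; rewrite -[LHS](qopK _ (f b)) -fop qinvK. Qed.

(** The homomorphism [f] and the coloring [phi] determine each other, up to the
    values of [phi] at under-passages. *)
Definition has_color (f : fundamental_pointed_quandle L -> X)
    (phi : component n m -> R -> X) :=
  forall a p, sval a p -> f (gen a) = phi p.1 p.2.

Lemma pi_rel p q x y z : double_point (curve L) p q -> is_under L p.1 p.2 ->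
  incoming p x -> outgoing p z -> sval y q ->
  gen z = qact (crossing_sign L p q) (gen x) (gen y).
Proof.
move=> pq up xp zp yq.
have -> : gen z = \pi_Q (if crossing_sign L p q then QOp (QGen x) (QGen y)
                 else QInv (QGen x) (QGen y)).
  apply: (presented_eq (rel := crossing_relations (L := L))).
  by apply: qcong_rel; exists p, q, x, y, z.
by case: ifP => _; rewrite /qact ?pi_op ?pi_inv.
Qed.

Lemma hom_coloring f : counting_homs X L f ->
  exists2 phi, coloring L phi & has_color f phi.
Proof.
move=> [fop fbase].
pose phi c t := f (gen (arc_at L (c, reduce c t))).
have fphi : has_color f phi.
  move=> a [c t] ap; rewrite /phi (@arc_at_eq _ _ _ L a (c, reduce c t)) //.
  have := joined_reduce (arc_good ap); case: a ap => a /= [q [_ _ ->]].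
  exact: joined_trans.
exists phi => //; split.
- by move=> j t; rewrite /phi reduce_periodic.
- move=> c t /fundamental_domain dt ut; have gt : good L (c, t) by split.
  apply: filterS (good_near gt) => r /= jr dr.
  rewrite -(fphi (arc_at L (c, t)) (c, r)) -?(fphi (arc_at L (c, t)) (c, t)) //.
  + exact: arc_atP.
  + by rewrite /arc_at; case: pselect => // gt' /=; apply: jr.
- move=> p q pq up; have cpq := double_crossing pq up.
  have [[x xp] [z zp]] := incoming_outgoing cpq.
  have gq : good L q by case: cpq.
  exists (f (gen x)), (f (gen z)); split.
  + by apply/near_leftP; case: xp => d d0 dP; exists d => // r /dP /fphi.
  + by apply/near_rightP; case: zp => d d0 dP; exists d => // r /dP /fphi.
  + rewrite (pi_rel pq up xp zp (arc_atP gq)) -(fphi _ _ (arc_atP gq)).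
    by rewrite /qact; case: ifP => _; [exact: fop|exact: hom_inv].
- move=> k; rewrite -fbase /= -/(gen _).
  apply/esym; apply: (fphi _ (_, _)).
  by apply: joined_refl; split; [exact: endpoint_domain|exact: endpoint_not_under].
Qed.

(** Terms are evaluated in [X], each generator having the color of any point of
    its arc; the jump condition at a crossing is the relation of this crossing,
    so the evaluation respects the congruence. *)
Lemma coloring_hom phi : coloring L phi ->
  exists2 f, counting_homs X L f & has_color f phi.
Proof.
move=> col; pose pt a := projT1 (cid (arc_inhabited (a : diagram_arc L))).
have ptP a : sval a (pt a) := projT2 (cid (arc_inhabited a)).
pose val a := phi (pt a).1 (pt a).2.
have valE a p : sval a p -> val a = phi p.1 p.2.
  move=> ap; apply: (color_joined col); have := ptP a.
  case: a ap => a [q [dq uq aE]] /= ap; move: (pt _) => r ar.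
  by rewrite aE in ap ar; apply: joined_trans ap; exact: joined_sym.
pose ev := fix ev (t : qterm (diagram_arc L)) : X := match t with
  QGen a => val a | QOp t u => qop (ev t) (ev u)
  | QInv t u => qinv (ev t) (ev u) end.
have evE (t u : qterm (diagram_arc L)) :
    qcong (crossing_relations (L := L)) t u -> ev t = ev u.
  elim=> //=.
  - by move=> t1 t2 u1 _ -> _ ->.
  - by move=> t1 t2 u1 u2 _ -> _ ->.
  - by move=> t1 t2 u1 u2 _ -> _ ->.
  - by move=> t1; rewrite qop_idem.
  - by move=> t1 u1; rewrite qopK.
  - by move=> t1 u1; rewrite qinvK.
  - by move=> t1 u1 v1; rewrite qop_distr.
  - move=> t1 u1 [p [q [x [y [z [[pq up xp zp yq] [-> ->]]]]]]].
    have [x' [z' [xl zr zE]]] := color_cross col pq up.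
    have -> : ev (QGen z) = z'; rewrite /=.
      have H : \forall r \near p.2^'+, phi p.1 r = val z.
        by apply/near_rightP; case: zp => d d0 dP; exists d => // r /dP /valE ->.
      exact: germ_unique H zr.
    have xE : val x = x'.
      have H : \forall r \near p.2^'-, phi p.1 r = val x.
        by apply/near_leftP; case: xp => d d0 dP; exists d => // r /dP /valE ->.
      exact: germ_unique H xl.
    by rewrite zE -(valE _ _ yq) -xE /qact; case: ifP.
pose f (a : fundamental_pointed_quandle L) : X := ev (repr (a : Q)).
have fpi (t : qterm (diagram_arc L)) : f (\pi_Q t) = ev t by apply/evE/qcong_repr.
exists f; last by move=> a p /valE <-; rewrite /gen fpi.
split.
- by move=> a b; rewrite -[a in LHS](reprK (a : Q)) -[b in LHS](reprK (b : Q)) -pi_op fpi.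
- move=> k; rewrite -(color_ends col) /= fpi /=; apply: (valE _ (_, _)).
  by apply: joined_refl; split; [exact: endpoint_domain|exact: endpoint_not_under].
Qed.

(** The classes of the generators generate the presented quandle, also under
    the inverse operation, which homomorphisms respect. *)
Lemma hom_ext f g : counting_homs X L f -> counting_homs X L g ->
  (forall a, f (gen a) = g (gen a)) -> f = g.
Proof.
move=> [fop _] [gop _] fg; apply/funext => a; rewrite -(reprK (a : Q)).
elim: (repr (a : Q)) => [b|t IHt u IHu|t IHt u IHu]; first exact: fg.
- by rewrite pi_op fop gop IHt IHu.
- by rewrite pi_inv (hom_inv fop) (hom_inv gop) IHt IHu.
Qed.

End Homs.

(** The correspondence [rho] need only be compatible with equality of colorings
    away from the under-passages, where colorings carry no information. *)
Lemma card_homs_coloring (R : realType) n m (X : pointed_quandle (2 * n))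
    (L L' : diagram R n m)
    (rho : (component n m -> R -> X) -> (component n m -> R -> X) -> Prop) :
  (forall phi, coloring L phi -> exists2 phi', coloring L' phi' & rho phi phi') ->
  (forall phi', coloring L' phi' -> exists2 phi, coloring L phi & rho phi phi') ->
  (forall phi phi' psi psi', coloring L phi -> coloring L' phi' ->
    coloring L psi -> coloring L' psi' -> rho phi phi' -> rho psi psi' ->
    eq_good L phi psi <-> eq_good L' phi' psi') ->
  (counting_homs X L #= counting_homs X L')%card.
Proof.
move=> LL' L'L rhoE.
have eqg (K : diagram R n m) (f : fundamental_pointed_quandle K -> X) phi psi :
    has_color (L := K) f phi ->
    has_color f psi -> eq_good K phi psi.
  by move=> fphi fpsi p /arc_atP gp; rewrite -(fphi _ _ gp) (fpsi _ _ gp).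
have eqh (K : diagram R n m) f g phi psi : counting_homs X K f ->
    counting_homs X K g -> has_color f phi -> has_color g psi ->
    eq_good K phi psi -> f = g.
  move=> hf hg fphi gpsi pp; apply: (hom_ext hf hg) => a.
  have [p ap] := arc_inhabited a.
  by rewrite (fphi _ _ ap) (gpsi _ _ ap); apply/pp/arc_good/ap.
apply: (card_eq_corr (rho := fun f f' => exists phi phi',
  [/\ coloring L phi, coloring L' phi', has_color f phi, has_color f' phi' &
      rho phi phi'])).
- move=> f /hom_coloring[phi cphi fphi]; have [phi' cphi' r] := LL' _ cphi.
  by have [f' hf' f'phi'] := coloring_hom cphi'; exists f' => //; exists phi, phi'.
- move=> f' /hom_coloring[phi' cphi' fphi']; have [phi cphi r] := L'L _ cphi'.
  by have [f hf fphi] := coloring_hom cphi; exists f => //; exists phi, phi'.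
- move=> f g g' _ hg hg' [phi [phi' [cphi cphi' fphi gphi' r]]].
  move=> [psi [psi' [cpsi cpsi' fpsi gpsi' s]]].
  apply: (eqh _ _ _ _ _ hg hg' gphi' gpsi').
  apply/(rhoE _ _ _ _ cphi cphi' cpsi cpsi' r s); exact: (eqg L f).
- move=> f f' g hf hf' _ [phi [phi' [cphi cphi' fphi gphi' r]]].
  move=> [psi [psi' [cpsi cpsi' fpsi gpsi' s]]].
  apply: (eqh _ _ _ _ _ hf hf' fphi fpsi).
  apply/(rhoE _ _ _ _ cphi cphi' cpsi cpsi' r s); exact: (eqg L' g).
Qed.

(** * Derivatives and orientation on the sphere *)

Section Calculus.
Variable R : realType.

Lemma derive1_comp_diff (V W : normedModType R) (F : V -> W) (g : R -> V)
    (s : R) :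
  differentiable (g : R^o -> V) s -> differentiable F (g s) ->
  derive1 (F \o g) s = 'D_(derive1 g s) F (g s).
Proof.
move=> dg dF; rewrite (derive1E' (f := F \o g)); last exact: differentiable_comp.
by rewrite diff_comp //= -(derive1E' dg) -deriveE.
Qed.

Lemma derive_comb (V W : normedModType R) (F : V -> W) (x u v : V) (a b : R) :
  differentiable F x ->
  'D_(a *: u + b *: v) F x = a *: 'D_u F x + b *: 'D_v F x.
Proof. by move=> dF; rewrite !deriveE// linearD !linearZ. Qed.

Lemma derive1_pair (V W : normedModType R) (f : R -> V) (g : R -> W) (s : R) :
  differentiable (f : R^o -> V) s -> differentiable (g : R^o -> W) s ->
  differentiable ((fun x => (f x, g x)) : R^o -> (V * W)%type) s /\
  derive1 ((fun x => (f x, g x)) : R -> (V * W)%type) s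
    = (derive1 f s, derive1 g s).
Proof.
move=> df dg; have dfg : differentiable ((fun x => (f x, g x)) : R^o -> (V * W)%type) s.
  exact: differentiable_pair.
split => //; rewrite (derive1E' dfg) diff_pair //.
by rewrite (derive1E' df) (derive1E' dg).
Qed.

Lemma derive1_near (V : normedModType R) (f g : R -> V) (s : R) :
  (\forall x \near s, f x = g x) -> derive1 f s = derive1 g s.
Proof.
move=> fg; rewrite !derive1E; exact: (near_eq_derive (f := (f : R^o -> V))).
Qed.

Lemma smooth_differentiable (V W : normedModType R) (F : V -> W) x :
  smooth F -> differentiable F x.
Proof. by move=> /(_ 1)[]. Qed.

Lemma smooth_derive_continuous (V W : normedModType R) (F : V -> W) v :
  smooth F -> continuous (fun x => 'D_v F x).
Proof. by move=> /(_ 1)[_ /(_ v)]. Qed.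

End Calculus.

Section Orientation.
Variable R : realType.
Implicit Types (p u v : 'rV[R]_3).

Lemma det_mx33 (M : 'M[R]_3) : \det M =
  M 0 0 * (M 1 1 * M 2 2 - M 1 2 * M 2 1)
  - M 0 1 * (M 1 0 * M 2 2 - M 1 2 * M 2 0)
  + M 0 2 * (M 1 0 * M 2 1 - M 1 1 * M 2 0).
Proof.
rewrite (expand_det_row _ (0 : 'I_3)) !big_ord_recl big_ord0 /cofactor.
rewrite !(expand_det_row _ (0 : 'I_2)) !big_ord_recl !big_ord0 /cofactor.
rewrite !det_mx11 !mxE.
have l0 : lift (0 : 'I_3) (0 : 'I_2) = 1 by exact: val_inj.
have l1 : lift (0 : 'I_3) (lift (0 : 'I_2) (0 : 'I_1)) = 2 by exact: val_inj.
have l2 : lift (1 : 'I_3) (0 : 'I_2) = 0 by exact: val_inj.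
have l3 : lift (1 : 'I_3) (lift (0 : 'I_2) (0 : 'I_1)) = 2 by exact: val_inj.
have l4 : lift (2 : 'I_3) (0 : 'I_2) = 0 by exact: val_inj.
have l5 : lift (2 : 'I_3) (lift (0 : 'I_2) (0 : 'I_1)) = 1 by exact: val_inj.
have l6 : lift (lift (0 : 'I_2) (0 : 'I_1)) (0 : 'I_1) = 0 by exact: val_inj.
rewrite ?l0 ?l1 ?l2 ?l3 ?l4 ?l5 ?l6 ?l0 ?l1 ?l2 ?l3 ?l4 ?l5 /=.
by rewrite /bump /= !expr0 !expr1 ?sqrrN ?expr2; ring.
Qed.

Lemma orientE p u v : orient p u v =
  p 0 0 * (u 0 1 * v 0 2 - u 0 2 * v 0 1)
  - p 0 1 * (u 0 0 * v 0 2 - u 0 2 * v 0 0)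
  + p 0 2 * (u 0 0 * v 0 1 - u 0 1 * v 0 0).
Proof.
rewrite /orient det_mx33; set M : 'M[R]_(1 + (1 + 1), 3) := col_mx _ _.
have M0 j : M (0 : 'I_3) j = p 0 j.
  by rewrite -(col_mxEu p (col_mx u v)); congr (M _ _); exact: val_inj.
have M1 j : M (1 : 'I_3) j = u 0 j.
  rewrite -(col_mxEu u v) -(col_mxEd p (col_mx u v)); congr (M _ _).
  exact: val_inj.
have M2 j : M (2 : 'I_3) j = v 0 j.
  rewrite -(col_mxEd u v) -(col_mxEd p (col_mx u v)); congr (M _ _).
  exact: val_inj.
by rewrite !M0 !M1 !M2.
Qed.

Lemma orient_comb p u v (a b c d : R) :
  orient p (a *: u + b *: v) (c *: u + d *: v) = (a * d - b * c) * orient p u v.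
Proof. by rewrite !orientE !mxE; ring. Qed.

Lemma orient_scale p u v (a b : R) :
  orient p (a *: u) (b *: v) = a * b * orient p u v.
Proof. by rewrite !orientE !mxE; ring. Qed.

(** Linear dependence of the three rows. *)
Lemma orient0P p u v :
  orient p u v = 0 <-> exists a b c : R,
    (a, b, c) <> (0, 0, 0) /\ a *: p + b *: u + c *: v = 0.
Proof.
pose M : 'M[R]_(1 + (1 + 1), 3) := col_mx p (col_mx u v).
have mulM (a b c : R) :
    row_mx ((a)%:M : 'M[R]_1) (row_mx (b)%:M (c)%:M) *m M = a *: p + b *: u + c *: v.
  by rewrite !mul_row_col !mul_scalar_mx addrA.
split.
- move=> /eqP /det0P[w w0 wM].
  exists (lsubmx (w : 'M[R]_(1, 1 + (1 + 1))) 0 0),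
    (lsubmx (rsubmx (w : 'M[R]_(1, 1 + (1 + 1)))) 0 0),
    (rsubmx (rsubmx (w : 'M[R]_(1, 1 + (1 + 1)))) 0 0).
  rewrite -mulM -!mx11_scalar !hsubmxK wM; split => //.
  move=> [a0 b0 c0]; move/eqP: w0; apply.
  rewrite -[w](hsubmxK (w : 'M[R]_(1, 1 + (1 + 1)))).
  rewrite -[rsubmx _](hsubmxK (rsubmx (w : 'M[R]_(1, 1 + (1 + 1))))).
  rewrite [lsubmx (w : 'M[R]_(1, 1 + (1 + 1)))]mx11_scalar.
  rewrite [lsubmx (rsubmx _)]mx11_scalar [rsubmx (rsubmx _)]mx11_scalar.
  by rewrite a0 b0 c0 !raddf0 !row_mx0.
- move=> [a [b [c [abc]]]]; rewrite -mulM => wM.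
  apply/eqP/det0P; exists (row_mx ((a)%:M : 'M[R]_1) (row_mx (b)%:M (c)%:M)) => //.
  apply/eqP => w0; apply: abc.
  have /eq_row_mx[a0 /eq_row_mx[b0 c0]] :
    row_mx ((a)%:M : 'M[R]_1) (row_mx ((b)%:M : 'M[R]_1) ((c)%:M : 'M[R]_1)) =
    row_mx 0 (row_mx 0 0) by rewrite w0 !row_mx0.
  have E (x : R) : ((x)%:M : 'M[R]_1) = 0 -> x = 0.
    by move=> /(congr1 (fun N : 'M[R]_1 => N 0 0)); rewrite !mxE eqxx mulr1n.
  by move/E: a0 => ->; move/E: b0 => ->; move/E: c0 => ->.
Qed.

Lemma orient_continuous (T : topologicalType) (p u v : T -> 'rV[R]_3) :
  continuous p -> continuous u -> continuous v ->
  continuous (fun x => orient (p x) (u x) (v x) : R).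
Proof.
have coord (w : T -> 'rV[R]_3) j : continuous w -> continuous (fun x => w x 0 j).
  move=> cw x; apply: (@continuous_comp _ _ _ w (fun N : 'rV[R]_3 => N 0 j : R)).
    exact: cw.
  exact: coord_continuous.
move=> cp cu cv; have -> : (fun x => orient (p x) (u x) (v x)) = (fun x =>
  p x 0 0 * (u x 0 1 * v x 0 2 - u x 0 2 * v x 0 1)
  - p x 0 1 * (u x 0 0 * v x 0 2 - u x 0 2 * v x 0 0)
  + p x 0 2 * (u x 0 0 * v x 0 1 - u x 0 1 * v x 0 0)).
  by apply/funext => x; rewrite orientE.
by move=> x; apply: cvgD; [apply: cvgB|]; apply: cvgM; try exact: coord;
  apply: cvgB; apply: cvgM; exact: coord.
Qed.

End Orientation.

(** * Diagrams that differ by a change of parameters *)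

Section Equivalence.
Variables (R : realType) (n m : nat).
Implicit Types (L : diagram R n m) (c : component n m) (t : R).
Implicit Types (p q : component n m * R).

Lemma relabelK (s : 'S_m) : cancel (@relabel n m s) (relabel s^-1).
Proof. by case=> //= j; rewrite permK. Qed.

Lemma relabelVK (s : 'S_m) : cancel (relabel s^-1) (@relabel n m s).
Proof. by case=> //= j; rewrite permKV. Qed.

Lemma domain_relabel (s : 'S_m) c t :
  in_domain (relabel s c) t = in_domain c t.
Proof. by case: c. Qed.

(** Here [tau] sends the parameters of [L'] to those of [L], and [taui] is its
    inverse.  Only the combinatorial effect of an isotopy is recorded, which
    makes the notion symmetric ([equiv_sym]) without any smoothness of inverse
    reparametrizations. *)
Record diagram_equiv L L' (s : 'S_m) (tau taui : component n m -> R -> R) : Prop :=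
  DiagramEquiv {
  equiv_incr : forall c x y, x < y -> tau c x < tau c y;
  equivK : forall c, cancel (tau c) (taui c);
  equivVK : forall c, cancel (taui c) (tau c);
  equiv_shift : forall j t, tau (inr j) (t + 1) = tau (inr j) t + 1;
  equiv_leg : forall i, tau (inl i) 0 = 0;
  equiv_head : forall i, tau (inl i) 1 = 1;
  equiv_under : forall c t, in_domain c t ->
    (is_under L' (relabel s c) t <-> is_under L c (tau c t));
  equiv_curve : forall c d t u, in_domain c t -> in_domain d u ->
    (curve L' (relabel s c) t = curve L' (relabel s d) u <->
     curve L c (tau c t) = curve L d (tau d u));
  equiv_sign : forall c d t u,
    crossing L' (relabel s c, t) (relabel s d, u) ->
    crossing_sign L' (relabel s c, t) (relabel s d, u) =
    crossing_sign L (c, tau c t) (d, tau d u)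
}.

Section OneEquivalence.
Variables (L L' : diagram R n m) (s : 'S_m) (tau taui : component n m -> R -> R).
Hypothesis E : diagram_equiv L L' s tau taui.

Lemma equiv_lt c x y : (tau c x < tau c y) = (x < y).
Proof.
apply/idP/idP; last exact: equiv_incr E _ _ _.
by apply: contraTT; rewrite -!leNgt le_eqVlt => /predU1P[->//|/(equiv_incr E c)/ltW].
Qed.

Lemma equiv_inv_incr c x y : x < y -> taui c x < taui c y.
Proof. by move=> xy; rewrite -(equiv_lt c) !(equivVK E). Qed.

Lemma equiv_domain c t : in_domain c (tau c t) <-> in_domain c t.
Proof.
case: c => //= i; rewrite -{1}(equiv_leg E i) -{1}(equiv_head E i).
by rewrite !leNgt !equiv_lt.
Qed.

Lemma equiv_inv_domain c t : in_domain c (taui c t) <-> in_domain c t.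
Proof. by have := equiv_domain c (taui c t); rewrite (equivVK E) => H; split => /H. Qed.

Lemma equiv_crossing c d t u :
  crossing L' (relabel s c, t) (relabel s d, u) <->
  crossing L (c, tau c t) (d, tau d u).
Proof.
rewrite /crossing /= !domain_relabel !(propext (equiv_domain _ _)).
by split => -[dt du ctu uc ud]; move: ctu uc ud;
  rewrite (propext (equiv_under E dt)) (propext (equiv_under E du))
  (propext (equiv_curve E dt du)).
Qed.

Lemma equiv_sym : diagram_equiv L' L s^-1
  (fun c => taui (relabel s^-1 c)) (fun c => tau (relabel s^-1 c)).
Proof.
split => /=.
- by move=> c x y; exact: equiv_inv_incr.
- by move=> c; exact: equivVK E _.
- by move=> c; exact: equivK E _.
- move=> j t; apply: (can_inj (equivK E (inr ((s^-1)%g j)))).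
  by rewrite (equiv_shift E) !(equivVK E).
- by move=> i; rewrite -{1}(equiv_leg E i) (equivK E).
- by move=> i; rewrite -{1}(equiv_head E i) (equivK E).
- move=> c t dt; have dt' : in_domain (relabel s^-1 c) (taui (relabel s^-1 c) t).
    by apply/equiv_inv_domain; rewrite domain_relabel.
  by rewrite -{2}(relabelVK s c) (equiv_under E dt') (equivVK E).
- move=> c d t u dt du.
  have dt' : in_domain (relabel s^-1 c) (taui (relabel s^-1 c) t).
    by apply/equiv_inv_domain; rewrite domain_relabel.
  have du' : in_domain (relabel s^-1 d) (taui (relabel s^-1 d) u).
    by apply/equiv_inv_domain; rewrite domain_relabel.
  by rewrite -{2}(relabelVK s c) -{2}(relabelVK s d) (equiv_curve E dt' du')
    !(equivVK E).
- move=> c d t u ctu.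
  rewrite -{2}(relabelVK s c) -{2}(relabelVK s d) (equiv_sign E) ?(equivVK E) //.
  by apply/equiv_crossing; rewrite !(equivVK E).
Qed.

Lemma equiv_near_left c t (P : R -> Prop) :
  (\forall r \near (tau c t)^'-, P r) -> \forall r \near t^'-, P (tau c r).
Proof. exact: (monotone_near_left (d := true) (equivVK E c) (equiv_lt c)). Qed.

Lemma equiv_near_right c t (P : R -> Prop) :
  (\forall r \near (tau c t)^'+, P r) -> \forall r \near t^'+, P (tau c r).
Proof. exact: (monotone_near_right (d := true) (equivVK E c) (equiv_lt c)). Qed.

Lemma equiv_near c t (P : R -> Prop) :
  (\forall r \near tau c t, P r) -> \forall r \near t, P (tau c r).
Proof. exact: (monotone_near (d := true) (equivVK E c) (equiv_lt c)). Qed.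

Variable X : pointed_quandle (2 * n).

Definition pull (phi : component n m -> R -> X) c t : X :=
  phi (relabel s^-1 c) (tau (relabel s^-1 c) t).

Lemma pull_coloring phi : coloring L phi -> coloring L' (pull phi).
Proof.
move=> col; split.
- by move=> j t; rewrite /pull /= (equiv_shift E) (color_periodic col).
- move=> c t /fundamental_domain; rewrite -(relabelVK s c).
  move: (relabel s^-1 c) => {}c; rewrite domain_relabel => dt.
  rewrite (equiv_under E dt) /pull relabelK => ut.
  have gt : good L (c, tau c t) by split => //=; exact/equiv_domain.
  apply: filterS (equiv_near (color_const_domain col gt)) => r Pr.
  by rewrite domain_relabel => dr; apply: Pr; exact/equiv_domain.
- move=> [c t] [d u] /= ctu uc; have := double_crossing ctu uc.
  rewrite /pull; clear ctu uc.
  have := relabelVK s c; have := relabelVK s d.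
  move: (relabel s^-1 c) (relabel s^-1 d) => c' d' <- <- cr.
  have [x [z [/= xl zr zE]]] := color_crossing col ((equiv_crossing _ _ _ _).1 cr).
  exists x, z; split.
  + exact: (equiv_near_left (P := fun r => phi c' r = x)).
  + exact: (equiv_near_right (P := fun r => phi c' r = z)).
  + by rewrite zE (equiv_sign E).
- move=> k; rewrite -(color_ends col) /pull /=; case: (odd k).
  + by rewrite (equiv_head E).
  + by rewrite (equiv_leg E).
Qed.
End OneEquivalence.

Lemma equiv_card (X : pointed_quandle (2 * n)) L L' s tau taui :
  diagram_equiv L L' s tau taui ->
  (counting_homs X L #= counting_homs X L')%card.
Proof.
move=> E; have E' := equiv_sym E.
apply: (card_homs_coloring (rho := fun phi phi' => forall c t, in_domain c t ->
  phi' (relabel s c) t = phi c (tau c t))).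
- move=> phi col; exists (pull s tau phi); first exact: (pull_coloring E col).
  by move=> c t _; rewrite /pull relabelK.
- move=> phi' col; exists (pull s^-1 (fun c => taui (relabel s^-1 c)) phi').
    exact: (pull_coloring E' col).
  move=> c t dt; rewrite /pull invgK.
  by rewrite relabelK (equivK E).
- move=> phi phi' psi psi' _ _ _ _ r r'; split=> eqg [c t] [/= dt ut].
  + move: dt ut; rewrite -(relabelVK s c) domain_relabel => dt.
    rewrite (equiv_under E dt) r // r' // => ut.
    by apply: (eqg (_, _)); split => //=; apply/(equiv_domain E).
  + have dt' : in_domain c (taui c t) by apply/(equiv_inv_domain E).
    have := r c _ dt'; have := r' c _ dt'; rewrite (equivVK E) => <- <-.
    apply: (eqg (_, _)); split => /=; first by rewrite domain_relabel.
    by rewrite (equiv_under E dt') (equivVK E).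
Qed.

End Equivalence.

(** * Isotopies *)

Section SphereCurves.
Variable R : realType.

Lemma derive1_coord (g : R -> 'rV[R]_3) (s : R) j :
  differentiable (g : R^o -> 'rV[R]_3) s ->
  is_derive (s : R^o) 1 (fun x => g x 0 j : R^o) (derive1 g s 0 j).
Proof.
move=> dg; pose F : 'rV[R]_3 -> R^o := fun N => N 0 j.
have dF x : differentiable F x by exact: differentiable_coord.
have lF : linear F by move=> a u v; rewrite /F !mxE.
pose Fl : {linear 'rV[R]_3 -> R^o} := HB.pack F (GRing.isLinear.Build _ _ _ _ F lF).
have cF : continuous Fl by exact: coord_continuous.
have dFg : differentiable (F \o g : R^o -> R^o) s.
  exact: differentiable_comp.
apply: DeriveDef; first exact/derivable1_diffP.
have := derive1_comp_diff dg (dF (g s)); rewrite derive1E => ->.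
by rewrite deriveE// (diff_lin (g s) cF).
Qed.

(** Derivative of the constant squared norm. *)
Lemma sphere_curve_orthogonal (g : R -> 'rV[R]_3) (s : R) :
  differentiable (g : R^o -> 'rV[R]_3) s -> (\forall x \near s, sphere (g x)) ->
  \sum_i g s 0 i * derive1 g s 0 i = 0.
Proof.
move=> dg sg; have dc j := derive1_coord j dg.
pose h (j : 'I_3) : R^o -> R^o := (fun x => g x 0 j : R^o) ^+ 2.
have hd j : is_derive (s : R^o) 1 (h j) (2 * (g s 0 j * derive1 g s 0 j)).
  have := is_deriveX 1 (dc j) => hX; apply: is_derive_eq.
  by rewrite expr1 /GRing.scale /=; ring.
have sq := is_derive_sum hd.
have : 'D_1 (\sum_(j < 3) h j) (s : R^o) = 0.
  rewrite -(derive_cst (1 : R^o) (s : R^o) 1); apply: near_eq_derive.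
  apply: filterS sg => x; rewrite /sphere /= => <-.
  by rewrite fct_sumE; apply: eq_bigr => j _; rewrite /h exprfctE.
case: sq => _ ->; rewrite -mulr_sumr => /eqP; rewrite mulf_eq0 => /orP[|/eqP//].
by rewrite pnatr_eq0.
Qed.

(** Inner product of the relation with [p]. *)
Lemma normal_coefficient (p u v : 'rV[R]_3) (x y z : R) : sphere p ->
  \sum_i p 0 i * u 0 i = 0 -> \sum_i p 0 i * v 0 i = 0 ->
  x *: p + y *: u + z *: v = 0 -> x = 0.
Proof.
move=> sp pu pv lin.
have : \sum_i p 0 i * (x *: p + y *: u + z *: v) 0 i = 0.
  by rewrite lin big1 // => i _; rewrite mxE mulr0.
rewrite (eq_bigr (fun i => x * p 0 i ^+ 2 + y * (p 0 i * u 0 i)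
    + z * (p 0 i * v 0 i))); last by move=> i _; rewrite !mxE; ring.
rewrite !big_split /= -!mulr_sumr pu pv !mulr0 !addr0.
by move: sp; rewrite /sphere /= => ->; rewrite mulr1.
Qed.

End SphereCurves.

Section IsotopySign.
Variables (R : realType) (H : R^o * 'rV[R]_3 -> 'rV[R]_3).
Hypothesis iso : ambient_isotopy H.

Lemma derive_slice (F : R^o * 'rV[R]_3 -> 'rV[R]_3) (g : R -> 'rV[R]_3)
    (tau s : R) : smooth F -> differentiable (g : R^o -> 'rV[R]_3) s ->
  differentiable ((fun x => F (tau, g x)) : R^o -> 'rV[R]_3) s /\
  derive1 (fun x => F (tau, g x)) s = 'D_(0, derive1 g s) F (tau, g s).
Proof.
move=> sF dg.
have [dp pE] := derive1_pair (differentiable_cst (tau : R^o) (s : R^o)) dg.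
have dF z : differentiable F z := smooth_differentiable z sF.
split; first exact: (differentiable_comp dp (dF _)).
by rewrite (derive1_comp_diff dp (dF _)) pE derive1_cst.
Qed.

Section Pair.
Variables (g h : R -> 'rV[R]_3) (a b : R) (P : 'rV[R]_3).
Hypotheses (dg : differentiable (g : R^o -> 'rV[R]_3) a)
  (dh : differentiable (h : R^o -> 'rV[R]_3) b)
  (sg : \forall x \near a, sphere (g x)) (sh : \forall x \near b, sphere (h x))
  (ga : g a = P) (hb : h b = P) (tr : orient P (derive1 h b) (derive1 g a) != 0).

Let O tau := orient (H (tau, P)) ('D_(0, derive1 h b) H (tau, P))
  ('D_(0, derive1 g a) H (tau, P)).

Lemma isotopy_orient0 : O 0 = orient P (derive1 h b) (derive1 g a).
Proof.
have [sH H0 _] := iso; have sP : sphere P by rewrite -ga; exact: nbhs_singleton sg.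
have Dg : 'D_(0, derive1 g a) H (0, P) = derive1 g a.
  rewrite -ga; have [_ <-] := derive_slice 0 sH dg; apply: derive1_near.
  by apply: filterS sg => x /H0.
have Dh : 'D_(0, derive1 h b) H (0, P) = derive1 h b.
  rewrite -hb; have [_ <-] := derive_slice 0 sH dh; apply: derive1_near.
  by apply: filterS sh => x /H0.
by rewrite /O Dg Dh (H0 P sP).
Qed.

(** A linear relation between H_t(p) and the images of the two tangent vectors
    has no component along H_t(p), to which these images are orthogonal;
    applying the differential of the inverse map [K], it becomes a relation
    between the original tangent vectors. *)
Lemma isotopy_orient_neq0 tau : 0 <= tau <= 1 -> O tau <> 0.
Proof.
move=> tau01; have [sH H0 [K [sK HK]]] := iso.
have sP : sphere P by rewrite -ga; exact: nbhs_singleton sg.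
have [dHg Hg] := derive_slice tau sH dg; have [dHh Hh] := derive_slice tau sH dh.
rewrite ga in Hg; rewrite hb in Hh.
have sHP : sphere (H (tau, P)) by have [] := HK tau P tau01 sP.
have ortg := sphere_curve_orthogonal dHg (filterS (fun x sx =>
  let: And4 A _ _ _ := HK tau _ tau01 sx in A) sg).
have orth := sphere_curve_orthogonal dHh (filterS (fun x sx =>
  let: And4 A _ _ _ := HK tau _ tau01 sx in A) sh).
rewrite ga Hg in ortg; rewrite hb Hh in orth.
(* The map K undoes H on the sphere, where the curves lie, so its differential
   undoes that of H on their tangent vectors. *)
have [_ Kg] := derive_slice tau sK dHg; have [_ Kh] := derive_slice tau sK dHh.
rewrite ga Hg in Kg; rewrite hb Hh in Kh.
have {}Kg : derive1 g a = 'D_(0, 'D_(0, derive1 g a) H (tau, P)) K (tau, H (tau, P)).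
  rewrite -Kg; apply: derive1_near; apply: filterS sg => x sx.
  by have [] := HK tau _ tau01 sx.
have {}Kh : derive1 h b = 'D_(0, 'D_(0, derive1 h b) H (tau, P)) K (tau, H (tau, P)).
  rewrite -Kh; apply: derive1_near; apply: filterS sh => x sx.
  by have [] := HK tau _ tau01 sx.
move=> /orient0P[x [y [z [xyz]]]].
move: Kg Kh ortg orth.
set A := 'D_(0, derive1 g a) H (tau, P); set B := 'D_(0, derive1 h b) H (tau, P).
move=> Kg Kh ortg orth lin.
have x0 : x = 0.
  exact: (normal_coefficient sHP (orth _) (ortg _) lin).
move/eqP: tr; apply; apply/orient0P; exists 0, y, z; split.
  by move=> [y0 z0]; apply: xyz; rewrite x0 y0 z0.
have dK : differentiable K (tau, H (tau, P)) := smooth_differentiable _ sK.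
rewrite scale0r add0r Kh Kg -(derive_comb _ _ y z dK).
have -> : y *: ((0, B) : R^o * 'rV[R]_3) + z *: (0, A) = 0.
  apply: (@eq_trans _ _ (y *: (0 : R^o) + z *: (0 : R^o), y *: B + z *: A)) => //.
  rewrite !scaler0 addr0; congr pair.
  by rewrite -lin x0 scale0r add0r.
by rewrite deriveE// linear0.
Qed.

(** Intermediate value theorem, in the time of the isotopy. *)
Lemma isotopy_orient_sign : (0 < O 1) = (0 < orient P (derive1 h b) (derive1 g a)).
Proof.
rewrite -isotopy_orient0; have [sH _ _] := iso.
have cO : continuous O.
  have cp : continuous (fun tau : R => (tau, P) : R^o * 'rV[R]_3).
    move=> x; apply: (@differentiable_continuous _ R^o _ x).
    exact: (differentiable_pair (f := @idfun R^o)).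
  have cc (F : R^o * 'rV[R]_3 -> 'rV[R]_3) : continuous F ->
      continuous (fun tau : R => F (tau, P)).
    move=> cF x.
    exact: (@continuous_comp _ _ _ (fun tau : R => (tau, P)) F x (cp x) (cF _)).
  exact: orient_continuous (cc _ (sH 0)) (cc _ (smooth_derive_continuous sH))
    (cc _ (smooth_derive_continuous sH)).
have IV : ~ (Num.min (O 0) (O 1) <= 0 <= Num.max (O 0) (O 1)).
  move=> /(@IVT _ O 0 1 0 ler01 (continuous_subspaceT cO))[c].
  by rewrite in_itv /= => c01 Oc; exact: (isotopy_orient_neq0 c01).
move: IV; move: (O 0) (O 1) => x y; rewrite ge_min le_max => IV.
apply/idP/idP => [y0|x0]; rewrite ltNge; apply/negP => zn; apply: IV.
- by rewrite zn (ltW y0) orbT.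
- by rewrite zn (ltW x0) orbT.
Qed.

End Pair.
End IsotopySign.

Section IsotopyInvariance.
Variables (R : realType) (n m : nat).
Implicit Types (c : component n m) (r : component n m -> R -> R) (t : R).

Lemma reparametrization_incr c (f : R -> R) : reparametrization c f ->
  {homo f : x y / x < y}.
Proof.
move=> [sf f0 _] x y xy.
have df z : derivable f z 1.
  by apply/derivable1_diffP; exact: (smooth_differentiable z sf).
apply: (@gtr0_derive1_lt_cc R f x y) => //; last 2 first.
- by rewrite in_itv /= lexx ltW.
- by rewrite in_itv /= lexx ltW.
by apply: continuous_subspaceT; exact: (sf 0).
Qed.

Lemma reparametrization_shift j (f : R -> R) (k : int) t :
  reparametrization (inr j : component n m) f -> f (t + k%:~R) = f t + k%:~R.
Proof.
move=> [_ _ f1]; have := @periodicz R R (fun x => f x - x) k t.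
move=> /(_ (fun x => _)) H.
have /H : forall x, f (x + 1) - (x + 1) = f x - x by move=> x; rewrite f1; ring.
by move=> /eqP; rewrite subr_eq => /eqP ->; ring.
Qed.

(** On an open component [r] need not map the line onto itself, but it does map
    [0, 1] onto itself. *)
Definition extend_reparam r c t : R :=
  if c is inl _ then (if 0 <= t <= 1 then r c t else t) else r c t.

Variables r : component n m -> R -> R.
Hypothesis rP : forall c, reparametrization c (r c).

Lemma reparam_itv (i : 'I_n) t : 0 <= t <= 1 -> 0 <= r (inl i) t <= 1.
Proof.
have incr := reparametrization_incr (rP (inl i)); have [_ _ [r0 r1]] := rP (inl i).
move=> /andP[t0 t1]; suff : r (inl i) 0 <= r (inl i) t <= r (inl i) 1.
  by rewrite r0 r1.
apply/andP; split.
- by move: t0; rewrite le_eqVlt => /predU1P[<-//|/incr/ltW].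
- by move: t1; rewrite le_eqVlt => /predU1P[->//|/incr/ltW].
Qed.

Lemma extend_reparamE c t : in_domain c t -> extend_reparam r c t = r c t.
Proof. by case: c => //= i ->. Qed.

Lemma extend_incr c : {homo extend_reparam r c : x y / x < y}.
Proof.
have incr := reparametrization_incr (rP c); case: c incr => //= i incr x y xy.
rewrite /extend_reparam.
case: ifPn => xI; case: ifPn => yI //; first exact: incr.
- have /andP[_ r1] := reparam_itv i xI; apply: le_lt_trans r1 _.
  by move: xI yI; rewrite negb_and -!ltNge => /andP[? ?] /orP[|]; lra.
- have /andP[r0 _] := reparam_itv i yI; apply: lt_le_trans _ r0.
  by move: xI yI; rewrite negb_and -!ltNge => /orP[|] ? /andP[? ?]; lra.
Qed.

Lemma extend_surj c y : exists t, extend_reparam r c t = y.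
Proof.
have [sr _ rc] := rP c.
have cr : continuous (r c) by exact: (sr 0).
have incr := reparametrization_incr (rP c).
case: c cr incr {sr} rc => [i|j] cr incr.
- move=> [r0 r1]; have [yI|yI] := boolP (0 <= y <= 1); last first.
    by exists y; rewrite /= (negbTE yI).
  have [] := @IVT _ (r (inl i)) 0 1 y ler01 (continuous_subspaceT cr).
    by rewrite r0 r1 (min_idPl ler01) (max_idPr ler01).
  by move=> t; rewrite in_itv /= => tI <-; exists t; rewrite /= tI.
- move=> _; pose k : int := Num.floor (y - r (inr j) 0).
  have /andP[k1 k2] := floor_itv (y - r (inr j) 0); rewrite intrD1 -/k in k1 k2.
  have rk (l : int) : r (inr j) l%:~R = r (inr j) 0 + l%:~R.
    by rewrite -[in LHS](add0r l%:~R) (reparametrization_shift _ _ (rP (inr j))).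
  have kk : k%:~R <= (k + 1)%:~R :> R by rewrite ler_int lerDl.
  have [] := @IVT _ (r (inr j)) k%:~R (k + 1)%:~R y kk (continuous_subspaceT cr).
    rewrite !rk intrD1 ge_min le_max; apply/andP; split; apply/orP; [left|right]; lra.
  by move=> t _ <-; exists t.
Qed.

Variables (L L' : diagram R n m) (H : R^o * 'rV[R]_3 -> 'rV[R]_3) (s : 'S_m).
Hypotheses (iso : ambient_isotopy H)
  (LL' : forall c t, in_domain c t ->
    curve L' (relabel s c) t = H (1, curve L c (r c t)) /\
    (is_under L' (relabel s c) t <-> is_under L c (r c t))).

Lemma reparam_domain c t : in_domain c t -> in_domain c (r c t).
Proof. by case: c => //= i; exact: reparam_itv. Qed.

Lemma isotopic_curve c d t u : in_domain c t -> in_domain d u ->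
  (curve L' (relabel s c) t = curve L' (relabel s d) u <->
   curve L c (r c t) = curve L d (r d u)).
Proof.
move=> dt du; have [-> _] := LL' dt; have [-> _] := LL' du; split => [E|->//].
have [_ _ [K [_ HK]]] := iso.
have one : ((0 : R) <= 1) && ((1 : R) <= 1) by rewrite ler01 lexx.
have [_ _ Kt _] := HK 1 _ one (curve_sphere L (reparam_domain dt)).
have [_ _ Ku _] := HK 1 _ one (curve_sphere L (reparam_domain du)).
by rewrite -Kt E Ku.
Qed.

Lemma isotopic_derive c t : (\forall x \near t, in_domain c x) ->
  derive1 (curve L' (relabel s c)) t =
  derive1 (r c) t *: 'D_(0, derive1 (curve L c) (r c t)) H (1, curve L c (r c t)).
Proof.
move=> dt; have [sr _ _] := rP c.
have dr : differentiable (r c : R^o -> R^o) t := smooth_differentiable _ sr.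
have dL x : differentiable (curve L c : R^o -> 'rV[R]_3) x :=
  smooth_differentiable _ (curve_smooth L c).
have [sH _ _] := iso.
have [dHL <-] := derive_slice 1 sH (dL (r c t)).
rewrite (@derive1_near _ _ _ ((fun x => H (1, curve L c x)) \o r c)); last first.
  by apply: filterS dt => x /LL'[].
rewrite (derive1_comp_diff dr dHL) deriveE// (derive1E' dHL).
by rewrite -linearZ /= /GRing.scale /= mulr1.
Qed.

Lemma isotopic_sign c d t u :
  crossing L' (relabel s c, t) (relabel s d, u) ->
  crossing_sign L' (relabel s c, t) (relabel s d, u) =
  crossing_sign L (c, r c t) (d, r d u).
Proof.
move=> cr; have [/= nt nu] := crossing_near_domain cr.
have {}nt : \forall x \near t, in_domain c x.
  by apply: filterS nt => x; rewrite domain_relabel.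
have {}nu : \forall x \near u, in_domain d x.
  by apply: filterS nu => x; rewrite domain_relabel.
have dt := nbhs_singleton nt; have du := nbhs_singleton nu.
have crL : crossing L (c, r c t) (d, r d u).
  case: cr => /= _ _ /(isotopic_curve dt du) E.
  have [_ ->] := LL' dt; have [_ ->] := LL' du => ut uu.
  by split => //; exact: reparam_domain.
have [/= nrt nru] := crossing_near_domain crL.
have E : curve L d (r d u) = curve L c (r c t) by case: crL.
have := isotopy_orient_sign iso
  (smooth_differentiable (r c t) (curve_smooth L c))
  (smooth_differentiable (r d u) (curve_smooth L d))
  (filterS (fun x => @curve_sphere _ _ _ L c x) nrt)
  (filterS (fun x => @curve_sphere _ _ _ L d x) nru) erefl E
  (crossing_transverse crL).
move=> sgn; rewrite [RHS]crossing_signE; refine (etrans _ (sgn _ _)).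
have cE : curve L' (relabel s c) t = H (1, curve L c (r c t)) := (LL' dt).1.
have [_ r0 _] := rP c; have [_ r0' _] := rP d.
rewrite crossing_signE (isotopic_derive nt) (isotopic_derive nu) orient_scale.
rewrite cE E; exact: pmulr_rgt0 (mulr_gt0 (r0' u) (r0 t)).
Qed.

(** The points of [L] where two branches meet are those of [L'] because the
    final map of the isotopy is injective on the sphere; the sign is the
    content of [isotopic_sign]. *)
Lemma isotopic_equiv : exists taui, diagram_equiv L L' s (extend_reparam r) taui.
Proof.
have surj c y := cid (extend_surj c y).
have incr := extend_incr.
have inj c : injective (extend_reparam r c).
  move=> x y xy; apply/le_anti; rewrite !leNgt.
  by apply/andP; split; apply/negP => lt; have := incr c _ _ lt; rewrite xy ltxx.
exists (fun c y => sval (surj c y)); split.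
- exact: incr.
- by move=> c x; case: surj => y /= /inj.
- by move=> c x; case: surj.
- by move=> j t /=; have [_ _ ->] := rP (inr j).
- by move=> i /=; rewrite lexx ler01; have [_ _ []] := rP (inl i).
- by move=> i /=; rewrite lexx ler01; have [_ _ []] := rP (inl i).
- by move=> c t dt; rewrite (extend_reparamE dt); have [] := LL' dt.
- by move=> c d t u dt du; rewrite !extend_reparamE//; exact: isotopic_curve.
- move=> c d t u cr; have [/= nt nu] := crossing_near_domain cr.
  have {}nt : \forall x \near t, in_domain c x.
    by apply: filterS nt => x; rewrite domain_relabel.
  have {}nu : \forall x \near u, in_domain d x.
    by apply: filterS nu => x; rewrite domain_relabel.
  have dt := nbhs_singleton nt; have du := nbhs_singleton nu.
  rewrite (extend_reparamE dt) (extend_reparamE du); exact: isotopic_sign.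
Qed.

End IsotopyInvariance.

(** * Changing a diagram in a disk *)

Section LocalChange.
Variables (R : realType) (n m k : nat).
Implicit Types (c : component n m) (t : R) (L : diagram R n m).
Variable st : 'I_k -> strand R n m.

Definition outside c t :=
  in_fundamental c t /\ forall i, ~ on_strand (st i) c t.

(** What remains of a local change once the disk is forgotten; strands and
    outside points never meet, in either diagram. *)
Record local_pair L L' : Prop := LocalPair {
  pair_bounds : forall i, [/\ 0 < strand_start (st i),
    strand_start (st i) < strand_end (st i) & strand_end (st i) < 1];
  pair_disjoint : forall i j c t,
    on_strand (st i) c t -> on_strand (st j) c t -> i = j;
  pair_curve : forall c t, outside c t -> curve L c t = curve L' c t;
  pair_under : forall c t, outside c t -> is_under L c t <-> is_under L' c t;
  pair_sep : forall c t i d u, outside c t -> on_strand (st i) d u ->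
    curve L c t <> curve L d u;
  pair_sep' : forall c t i d u, outside c t -> on_strand (st i) d u ->
    curve L' c t <> curve L' d u
}.

Lemma local_pair_sym L L' : local_pair L L' -> local_pair L' L.
Proof.
move=> [H1 H2 H3 H4 H5 H6]; split => //.
- by move=> c t /H3.
- by move=> c t /H4 H; split => /H.
Qed.

Lemma local_change_pair e L L' : local_change e st L L' ->
  (forall i t, on_strand (st i) (strand_comp (st i)) t ->
    (e @` @square R) (curve L (strand_comp (st i)) t)) ->
  (forall i t, on_strand (st i) (strand_comp (st i)) t ->
    (e @` @square R) (curve L' (strand_comp (st i)) t)) ->
  local_pair L L'.
Proof.
move=> [_ bnd dis out] sL sL'.
have outP c t : outside c t -> [/\ curve L c t = curve L' c t,
    ~ (e @` @square R) (curve L c t) & (is_under L c t <-> is_under L' c t)].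
  by case=> /out H /H.
split => //.
- by move=> c t /outP[].
- by move=> c t /outP[].
- move=> c t i d u /outP[_ no _] on E; apply: no; rewrite E.
  by have [-> _] := on; apply: sL; case: on.
- move=> c t i d u /outP[<- no _] on E; apply: no; rewrite E.
  by have [-> _] := on; apply: sL'; case: on.
Qed.

Section Pair.
Variables L L' : diagram R n m.
Hypothesis LL' : local_pair L L'.

Lemma on_strand_itv i c t : on_strand (st i) c t -> 0 < t < 1.
Proof.
case=> _ /andP[t1 t2]; have [b1 b2 b3] := pair_bounds LL' i.
by apply/andP; split; lra.
Qed.

Lemma strand_fundamental i c t : on_strand (st i) c t -> in_fundamental c t.
Proof.
by move=> /on_strand_itv/andP[t0 t1]; case: c => c /=; apply/andP; split=> //; apply: ltW.
Qed.

Lemma strand_dichotomy c t : in_fundamental c t ->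
  outside c t \/ exists i, on_strand (st i) c t.
Proof.
move=> dt; have [|no] := pselect (exists i, on_strand (st i) c t); first by right.
by left; split => // i on; apply: no; exists i.
Qed.

(** The strands are closed and keep away from the parameters 0 and 1, so the
    outside is open even across the point where a closed component closes
    up. *)
Lemma outside_near c t : outside c t ->
  \forall r \near t, in_domain c r -> outside c (reduce c r).
Proof.
move=> [ft ot].
have H i : \forall r \near t, in_domain c r -> ~ on_strand (st i) c (reduce c r).
  have [b1 b2 b3] := pair_bounds LL' i.
  have [cE|nc] := pselect (c = strand_comp (st i)); last first.
    by apply: filterE => r _ [].
  have t01 : 0 <= t <= 1 by case: (c) ft => //= _ /andP[-> /ltW].
  have {t01}/andP[t0 t1] := t01.
  have /orP[ta|tb] : (t < strand_start (st i)) || (strand_end (st i) < t).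
    rewrite !ltNge -negb_and; apply/negP => H; exact: (ot i).
  - have /near_open_itv : strand_end (st i) - 1 < t < strand_start (st i).
      by apply/andP; split; lra.
    apply: filterS => r /andP[r1 r2] dr [_].
    case: c dr {ft ot cE} => [c|j] dr; first by rewrite /= => /andP[? ?]; lra.
    have [r0|r0] := leP 0 r.
      by rewrite reduce_id /=; [move=> /andP[? ?]; lra|apply/andP; split; lra].
    by rewrite (@reduce_shift R n m j 1) => [/andP[? ?]|]; first lra; apply/andP; split; lra.
  - have /near_open_itv : strand_end (st i) < t < 1 + strand_start (st i).
      by apply/andP; split; lra.
    apply: filterS => r /andP[r1 r2] dr [_].
    case: c dr {ft ot cE} => [c|j] dr; first by rewrite /= => /andP[? ?]; lra.
    have [r0|r0] := ltP r 1.
      by rewrite reduce_id /=; [move=> /andP[? ?]; lra|apply/andP; split; lra].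
    by rewrite (@reduce_shift R n m j (-1)) => [/andP[? ?]|]; first lra; apply/andP; split; lra.
apply: filterS (filter_forall _ H) => r ro dr; split; last by move=> i; exact: ro.
exact: reduce_fundamental.
Qed.

Lemma near_off_strand j c t : ~ on_strand (st j) c t ->
  \forall r \near t, ~ on_strand (st j) c r.
Proof.
move=> nt; have [cE|nc] := pselect (c = strand_comp (st j)); last first.
  by apply: filterE => r [].
have /orP[ta|tb] : (t < strand_start (st j)) || (strand_end (st j) < t).
  by rewrite !ltNge -negb_and; apply/negP => H; apply: nt.
- have /near_open_itv : t - 1 < t < strand_start (st j) by apply/andP; split; lra.
  by apply: filterS => r /andP[_ r1] [_ /andP[]]; rewrite leNgt r1.
- have /near_open_itv : strand_end (st j) < t < t + 1 by apply/andP; split; lra.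
  by apply: filterS => r /andP[r1 _] [_ /andP[_]]; rewrite leNgt r1.
Qed.

Lemma near_off_others i c t : on_strand (st i) c t ->
  \forall r \near t, 0 < r < 1 /\ forall j, j != i -> ~ on_strand (st j) c r.
Proof.
move=> ti; have H j : \forall r \near t, j != i -> ~ on_strand (st j) c r.
  have [->|ji] := eqVneq j i; first by apply: filterE.
  have nj : ~ on_strand (st j) c t.
    by move=> tj; move/eqP: ji; apply; apply: pair_disjoint LL' _ _ _ _ tj ti.
  by apply: filterS (near_off_strand nj) => r.
by apply: filterS2 (near_open_itv (on_strand_itv ti)) (filter_forall _ H).
Qed.

Lemma strand_start_on i : on_strand (st i) (strand_comp (st i)) (strand_start (st i)).
Proof. by have [b1 b2 b3] := pair_bounds LL' i; split => //; rewrite lexx ltW. Qed.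

Lemma strand_end_on i : on_strand (st i) (strand_comp (st i)) (strand_end (st i)).
Proof. by have [b1 b2 b3] := pair_bounds LL' i; split => //; rewrite lexx ltW. Qed.

Lemma strand_start_outside i :
  \forall r \near (strand_start (st i))^'-, outside (strand_comp (st i)) r.
Proof.
apply: filterS2 (near_two_left (near_off_others (strand_start_on i))) (nbhs_left_lt _).
move=> r [r01 ro] ra; split; first exact: unit_fundamental.
move=> j; have [->|/ro//] := eqVneq j i.
by move=> [_ /andP[+ _]]; rewrite leNgt ra.
Qed.

Lemma strand_end_outside i :
  \forall r \near (strand_end (st i))^'+, outside (strand_comp (st i)) r.
Proof.
apply: filterS2 (near_two_right (near_off_others (strand_end_on i))) (nbhs_right_gt _).
move=> r [r01 ro] ra; split; first exact: unit_fundamental.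
move=> j; have [->|/ro//] := eqVneq j i.
by move=> [_ /andP[_]]; rewrite leNgt ra.
Qed.

Lemma outside_derive c t : outside c t -> (\forall r \near t, in_domain c r) ->
  derive1 (curve L c) t = derive1 (curve L' c) t.
Proof.
move=> ot dt; apply: derive1_near.
apply: filterS2 dt (outside_near ot) => r dr /(_ dr) or.
by rewrite -(reduce_curve L) -(reduce_curve L') (pair_curve LL' or).
Qed.

Lemma outside_sign c t d u : crossing L (c, t) (d, u) ->
  outside c t -> outside d u ->
  crossing_sign L (c, t) (d, u) = crossing_sign L' (c, t) (d, u).
Proof.
move=> /crossing_near_domain[/= nt nu] ot ou.
by rewrite !crossing_signE (pair_curve LL' ot) !outside_derive.
Qed.

Variable X : pointed_quandle (2 * n).
Implicit Types phi : component n m -> R -> X.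

Definition agree phi psi := forall c t, outside c t -> ~ is_under L c t ->
  phi c t = psi c t.

(** A function that extends the outside part of a coloring of [L] has to be
    checked on the strands only, since at outside points [L] and [L'] have the
    same germ. *)
Lemma coloring_local phi psi : coloring L phi ->
  (forall j t, psi (inr j) (t + 1) = psi (inr j) t) ->
  (forall c t, outside c t -> psi c t = phi c t) ->
  (forall i c t, on_strand (st i) c t -> ~ is_under L' c t ->
    \forall r \near t, psi c r = psi c t) ->
  (forall i j c t d u, on_strand (st i) c t -> on_strand (st j) d u ->
    crossing L' (c, t) (d, u) -> exists x z,
    [/\ \forall r \near t^'-, psi c r = x,
        \forall r \near t^'+, psi c r = z &
        z = qact (crossing_sign L' (c, t) (d, u)) x (psi d u)]) ->
  coloring L' psi.
Proof.
move=> col per out con cro.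
have pred c r : psi c (reduce c r) = psi c r.
  by have [->//|[j [l [-> ->]]]] := reduceE c r; apply: periodicz.
have nout c t : outside c t -> \forall r \near t, in_domain c r -> psi c r = phi c r.
  move=> ot; apply: filterS (outside_near ot) => r or /or {}or.
  by rewrite -pred out// (color_reduce col).
split => //.
- move=> c t ft; have [ot|[i ti]] := strand_dichotomy ft; last first.
    by move=> ut; apply: filterS (con i c t ti ut) => r ->.
  move=> ut'; have ut : ~ is_under L c t by move=> /(pair_under LL' ot).
  apply: filterS2 (nout c t ot) (color_const col ft ut) => r out_r const_r dr.
  by rewrite out_r// const_r// out.
- move=> [c t] [d u] /= cd uc; have cr := double_crossing cd uc.
  have [fc fd _ /= E] := cd; rewrite /= in fc fd.
  have [ot|[i ti]] := strand_dichotomy fc; have [ou|[j uj]] := strand_dichotomy fd.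
  + have crL : crossing L (c, t) (d, u).
      case: cr => /= dt du _ utc utd; split => //=.
      * by rewrite !(pair_curve LL').
      * exact/(pair_under LL' ot).
      * by move=> /(pair_under LL' ou).
    have [x [z [/= xl zr zE]]] := color_crossing col crL.
    have [/= nt _] := crossing_near_domain crL.
    exists x, z; split.
    * by apply: filterS3 xl (near_two_left nt) (near_two_left (nout _ _ ot)) => r <- dr ->.
    * by apply: filterS3 zr (near_two_right nt) (near_two_right (nout _ _ ot)) => r <- dr ->.
    * by rewrite (out _ _ ou) -(outside_sign crL ot ou); exact: zE.
  + by case: (pair_sep' LL' ot uj).
  + by case: (pair_sep' LL' ou ti).
  + exact: cro ti uj cr.
- move=> h; rewrite -(color_ends col) out //; split.
    by case: (odd h); rewrite /= ?lexx ?ler01.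
  by move=> i /on_strand_itv; case: (odd h); rewrite ltxx ?andbF.
Qed.

End Pair.

(** The correspondence is agreement on the outside; it is one-to-one as soon as
    colors on the outside determine those on the strands. *)
Lemma local_card (X : pointed_quandle (2 * n)) L L' : local_pair L L' ->
  (forall phi : component n m -> R -> X, coloring L phi ->
    exists2 phi', coloring L' phi' & agree L phi phi') ->
  (forall phi' : component n m -> R -> X, coloring L' phi' ->
    exists2 phi, coloring L phi & agree L phi phi') ->
  (forall phi psi : component n m -> R -> X, coloring L phi -> coloring L psi ->
    agree L phi psi -> forall i c t, on_strand (st i) c t ->
    ~ is_under L c t -> phi c t = psi c t) ->
  (forall phi psi : component n m -> R -> X, coloring L' phi -> coloring L' psi ->
    agree L phi psi -> forall i c t, on_strand (st i) c t ->
    ~ is_under L' c t -> phi c t = psi c t) ->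
  (counting_homs X L #= counting_homs X L')%card.
Proof.
move=> LL' fwd bwd uniq uniq'.
have LL'' := local_pair_sym LL'.
have eqg (K K' : diagram R n m) : local_pair K K' ->
  (forall phi psi : component n m -> R -> X, coloring K phi -> coloring K psi ->
    agree K phi psi -> forall i c t, on_strand (st i) c t ->
    ~ is_under K c t -> phi c t = psi c t) ->
  forall phi psi : component n m -> R -> X, coloring K phi -> coloring K psi ->
    agree K phi psi -> eq_good K phi psi.
  move=> KK' un phi psi cphi cpsi ag [c t] [/= /reduce_fundamental dt ut].
  rewrite -(color_reduce cphi) -(color_reduce cpsi).
  rewrite -(reduce_under K) in ut.
  have [ot|[i ti]] := strand_dichotomy dt; first exact: ag.
  exact: un cphi cpsi ag i _ _ ti ut.
have goodP (K : diagram R n m) (phi psi : component n m -> R -> X) :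
    eq_good K phi psi -> agree K phi psi.
  move=> e c t [ft _] ut; apply: (e (c, t)); split => //=.
  exact: fundamental_domain.
have agP (phi psi : component n m -> R -> X) : agree L phi psi <-> agree L' phi psi.
  by split=> H c t ot ut; apply: H => // u; apply: ut; apply/(pair_under LL' ot).
refine (@card_homs_coloring R n m X L L' (@agree L X) fwd bwd _).
move=> phi phi' psi psi' c1 c2 c3 c4 r1 r2; split=> e.
- apply: (eqg _ _ LL'') => //.
    by move=> f g cf cg /agP; exact: uniq'.
  apply/agP => c t ot ut.
  by rewrite -r1// -r2//; apply: goodP e _ _ ot ut.
- apply: (eqg _ _ LL') => // c t ot ut.
  rewrite r1// r2//; apply: (goodP _ _ _ e _ _ ot).
  by move=> /(pair_under LL' ot).
Qed.

End LocalChange.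

(** * The first Reidemeister move *)

Section Kink.
Variables (R : realType) (n m : nat) (X : pointed_quandle (2 * n)).
Variables (K : diagram R n m) (phi : component n m -> R -> X).
Hypothesis col : coloring K phi.

Lemma color_left_of c (u t : R) x : 0 < t -> u < 1 -> t < u ->
  (forall w, t <= w < u -> ~ is_under K c w) ->
  (\forall r \near u^'-, phi c r = x) -> phi c t = x.
Proof.
move=> t0 u1 tu nu /near_leftP[d d0 dP].
have m0 : Num.min d (u - t) <= u - t by rewrite ge_min lexx orbT.
have m1 : Num.min d (u - t) <= d by rewrite ge_min lexx.
have m2 : 0 < Num.min d (u - t) by rewrite lt_min d0 subr_gt0.
rewrite -(dP (u - Num.min d (u - t) / 2)); last by apply/andP; split; lra.
apply: (color_itv col); first by lra.
- move=> w /andP[w1 w2]; apply/fundamental_domain/unit_fundamental.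
  by apply/andP; split; lra.
- by move=> w /andP[w1 w2]; apply: nu; apply/andP; split; lra.
Qed.

Lemma color_right_of c (u t : R) x : 0 < u -> t < 1 -> u < t ->
  (forall w, u < w <= t -> ~ is_under K c w) ->
  (\forall r \near u^'+, phi c r = x) -> phi c t = x.
Proof.
move=> u0 t1 ut nu /near_rightP[d d0 dP].
have m0 : Num.min d (t - u) <= t - u by rewrite ge_min lexx orbT.
have m1 : Num.min d (t - u) <= d by rewrite ge_min lexx.
have m2 : 0 < Num.min d (t - u) by rewrite lt_min d0 subr_gt0.
rewrite -(dP (u + Num.min d (t - u) / 2)); last by apply/andP; split; lra.
symmetry; apply: (color_itv col); first by lra.
- move=> w /andP[w1 w2]; apply/fundamental_domain/unit_fundamental.
  by apply/andP; split; lra.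
- by move=> w /andP[w1 w2]; apply: nu; apply/andP; split; lra.
Qed.

Lemma near_color c t : 0 < t < 1 -> ~ is_under K c t ->
  \forall r \near t, phi c r = phi c t.
Proof.
move=> t01 ut; have ft := unit_fundamental c t01.
apply: filterS2 (near_open_itv t01) (color_const col ft ut) => r r01; apply.
exact/fundamental_domain/unit_fundamental.
Qed.

(** Let x and z be the colors before and after the under-passage [u].  If the
    over-passage comes first it has color x, and z is x acting on itself;
    otherwise it has color z, and z = x |> z or its inverse again forces x =
    z. *)
Lemma kink_color c (a b u o : R) : 0 < a -> b < 1 -> a <= u <= b -> a <= o <= b ->
  crossing K (c, u) (c, o) ->
  (forall w, a <= w <= b -> w <> u -> ~ is_under K c w) ->
  exists x, [/\ \forall r \near a^'-, phi c r = x,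
    \forall r \near b^'+, phi c r = x &
    forall t, a <= t <= b -> ~ is_under K c t -> phi c t = x].
Proof.
move=> a0 b1 /andP[au ub] /andP[ao ob] cr nu.
have [x [z [/= xl zr zE]]] := color_crossing col cr.
have ou : o <> u by move=> ou; case: cr => /= _ _ _; rewrite ou.
have lx t : a <= t -> t < u -> phi c t = x.
  move=> at_ tu; apply: color_left_of (xl) => //; try lra.
  by move=> w /andP[w1 w2]; apply: nu; [apply/andP; split; lra|lra].
have rz t : u < t -> t <= b -> phi c t = z.
  move=> ut tb; apply: color_right_of (zr) => //; try lra.
  by move=> w /andP[w1 w2]; apply: nu; [apply/andP; split; lra|lra].
have xz : z = x.
  have [ltou|ltuo] : o < u \/ u < o by case: (ltgtP o u) ou => //; [left|right].
  - by rewrite zE lx// qact_idem.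
  - have zE' := zE; rewrite rz// in zE'.
    by rewrite -[RHS](qactK (crossing_sign K (c, u) (c, o)) x z) -zE' qact_idem.
exists x; split.
- move: au; rewrite le_eqVlt => /predU1P[->//|au].
  have na : ~ is_under K c a by apply: nu; [rewrite lexx; lra|lra].
  have /near_two_left : \forall r \near a, phi c r = phi c a.
    by apply: near_color => //; apply/andP; split; lra.
  by apply: filterS => r ->; exact: lx.
- rewrite -xz; move: ub; rewrite le_eqVlt => /predU1P[<-//|ub].
  have nb : ~ is_under K c b by apply: nu; [rewrite lexx; lra|lra].
  have /near_two_right : \forall r \near b, phi c r = phi c b.
    by apply: near_color => //; apply/andP; split; lra.
  by apply: filterS => r ->; exact: rz.
- move=> t /andP[t1 t2] ut; have [tu|tu|tE] := ltgtP t u; first exact: lx.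
  + by rewrite -xz; apply: rz.
  + by case: ut; rewrite tE; case: cr.
Qed.

End Kink.

Section R1.
Variables (R : realType) (n m : nat) (X : pointed_quandle (2 * n)).
Implicit Types (L : diagram R n m).

(** The strand has one color in both diagrams.  From [L] to [L'] the coloring
    need not even be changed; from [L'] to [L] it is given the right value at
    the under-passage, which has become an ordinary point. *)
Lemma R1_card L L' : R1_move L L' ->
  (counting_homs X L #= counting_homs X L')%card.
Proof.
move=> [e [st [lc [[sL _] [sL' _]] inj [s0 [t0 [as0 s0t0 t0b cr]]]]]].
set c := strand_comp (st 0) in sL sL' inj cr *.
set a := strand_start (st 0) in sL sL' inj as0 cr *.
set b := strand_end (st 0) in sL sL' inj t0b cr *.
have LL' : local_pair st L L'.
  by apply: local_change_pair lc _ _ => i t; rewrite (ord1 i) => -[_]; [exact: sL|exact: sL'].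
have LL'' := local_pair_sym LL'.
have [a0 ab b1] := pair_bounds LL' 0; rewrite -/a -/b in a0 ab b1.
have onE i d t : on_strand (st i) d t <-> d = c /\ a <= t <= b by rewrite (ord1 i).
have onc t : a <= t <= b -> on_strand (st 0) c t by move=> ?; exact/onE.
have partner (K K' : diagram R n m) (KK' : local_pair st K K') t :
    a <= t <= b -> is_under K c t -> exists2 u, a <= u <= b & 
    t <> u /\ curve K c t = curve K c u.
  move=> tab ut; have [[d u] dp] := under_double (strand_fundamental KK' (onc t tab)) ut.
  have [_ /= fu tu E] := dp.
  have [ou|[i /onE[dE uab]]] := strand_dichotomy st fu.
    by case: (pair_sep KK' ou (onc t tab)).
  by exists u => //; rewrite dE in tu E; split => // tuE; apply: tu; rewrite tuE.
have nuL t : a <= t <= b -> ~ is_under L c t.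
  move=> tab ut; have [u /andP[u1 u2] [tu E]] := partner _ _ LL' t tab ut.
  have /andP[t1 t2] := tab.
  by have [lt|lt|//] := ltgtP t u; [apply: (inj t u)|apply: (inj u t)].
have uL' t : a <= t <= b -> is_under L' c t -> t = s0 \/ t = t0.
  move=> tab ut; have [u /andP[u1 u2] [tu E]] := partner _ _ LL'' t tab ut.
  have /andP[t1 t2] := tab.
  have [lt|lt|//] := ltgtP t u.
  - by left; case: ((cr t u t1 lt u2).1 E).
  - by right; case: ((cr u t u1 lt t2).1 (esym E)).
have s0ab : a <= s0 <= b by apply/andP; split; lra.
have t0ab : a <= t0 <= b by apply/andP; split; lra.
have [u [v [uab vab cuv nu]]] : exists u v, [/\ a <= u <= b, a <= v <= b,
    crossing L' (c, u) (c, v) & forall w, a <= w <= b -> w <> u -> ~ is_under L' c w].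
  have st0 : curve L' c s0 = curve L' c t0 by apply/(cr s0 t0).
  have dom w : a <= w <= b -> in_fundamental c w.
    by move=> wab; exact: (strand_fundamental LL' (onc w wab)).
  have dp : double_point (curve L') (c, s0) (c, t0).
    by split => /=; [exact: dom|exact: dom|case; lra|].
  have dp' : double_point (curve L') (c, t0) (c, s0).
    by split => /=; [exact: dom|exact: dom|case; lra|].
  have [us|us] := pselect (is_under L' c s0).
  - exists s0, t0; split => //; first exact: double_crossing.
    have nt : ~ is_under L' c t0 := (under_over dp).1 us.
    by move=> w wab ws uw; have [//|wE] := uL' w wab uw; rewrite -wE in nt.
  - have ut : is_under L' c t0 by apply/(under_over dp').
    exists t0, s0; split => //; first exact: double_crossing.
    by move=> w wab wt uw; have [wE|//] := uL' w wab uw; rewrite -wE in us.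
have kink phi : coloring (X := X) L' phi -> exists x,
    [/\ \forall r \near a^'-, phi c r = x,
        \forall r \near b^'+, phi c r = x &
        forall t, a <= t <= b -> ~ is_under L' c t -> phi c t = x].
  by move=> col; exact: (kink_color col a0 b1 uab vab cuv nu).
have sta := strand_start_outside LL' 0; have enb := strand_end_outside LL' 0.
rewrite -/a -/c in sta; rewrite -/b -/c in enb.
have flat phi : coloring (X := X) L phi -> forall t, a <= t <= b -> phi c t = phi c a.
  move=> col t /andP[t1 t2]; symmetry; apply: (color_itv col) => // w /andP[w1 w2].
    by apply/fundamental_domain/(strand_fundamental LL' (onc w _)); apply/andP; split; lra.
  by apply: nuL; apply/andP; split; lra.
have itv01 t : a <= t <= b -> 0 < t < 1.
  by move=> /andP[t1 t2]; apply/andP; split; lra.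
have flat_near phi : coloring (X := X) L phi -> forall t, a <= t <= b ->
    \forall r \near t, phi c r = phi c a.
  move=> col t tab; rewrite -(flat _ col t tab).
  exact: (near_color col (itv01 t tab) (nuL t tab)).
(* Just before the strand, two colorings that agree on the outside can be
   compared. *)
have good_start (K : diagram R n m) : \forall r \near a^'-, outside st c r /\ ~ is_under K c r.
  apply: filterS3 sta (near_two_left (under_isolated K c a)) (nbhs_left_lt a).
  move=> r or ur ra; split=> //; apply: ur; first by rewrite lt_eqF.
  by case: or => /fundamental_domain.
have aab : a <= a <= b by rewrite lexx ltW.
apply: (local_card LL').
- move=> phi col; exists phi => //.
  apply: (coloring_local LL' col) => //; first exact: color_periodic col.
  + move=> i d t /onE[-> tab] _; rewrite (flat _ col t tab).
    exact: (flat_near _ col t tab).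
  + move=> i j d t d' w /onE[-> tab] /onE[-> wab] _.
    exists (phi c a), (phi c a); split.
    * exact: near_two_left (flat_near _ col t tab).
    * exact: near_two_right (flat_near _ col t tab).
    * by rewrite (flat _ col w wab) qact_idem.
- move=> phi' col; have [x [xl xr xE]] := kink _ col.
  pose phi d t := if pselect (on_strand (st 0) d (reduce d t)) then x
                  else phi' d t.
  have phi_on t : a <= t <= b -> phi c t = x.
    move=> tab; rewrite /phi (reduce_id (strand_fundamental LL' (onc t tab))).
    by case: pselect => // nt; case: (nt (onc t tab)).
  have phi_out d t : outside st d t -> phi d t = phi' d t.
    move=> [fd ot]; rewrite /phi (reduce_id fd); case: pselect => // on.
    by case: (ot 0).
  exists phi; last by move=> d t ot _; exact: phi_out.
  apply: (coloring_local LL'' col) => //.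
  + by move=> j t; rewrite /phi (color_periodic col) reduce_periodic.
  + move=> i d t /onE[-> tab] _; rewrite (phi_on t tab).
    have inab r : a < r < b -> phi c r = x.
      by move=> /andP[r1 r2]; apply: phi_on; apply/andP; split; lra.
    have near_in : a < t < b -> \forall r \near t, phi c r = x.
      by move=> /near_open_itv; apply: filterS => r /inab.
    have [/eqP tE|at_] := boolP (t == a).
      rewrite tE; apply: near_sides; last 2 first.
      - by apply: phi_on; rewrite lexx ltW.
      - apply: filterS2 (nbhs_right_gt a) (nbhs_right_lt ab) => r ra rb.
        by apply: inab; rewrite ra.
      by apply: filterS2 sta xl => r /phi_out ->.
    have [/eqP tE|bt] := boolP (t == b).
      rewrite tE; apply: near_sides.
      - apply: filterS2 (nbhs_left_lt b) (nbhs_left_gt ab) => r rb ra.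
        by apply: inab; rewrite ra.
      - by apply: phi_on; rewrite lexx ltW.
      - by apply: filterS2 enb xr => r /phi_out ->.
    by apply: near_in; have /andP[t1 t2] := tab; rewrite !lt_neqAle t1 t2 eq_sym at_ bt.
  + move=> i j d t d' w /onE[-> tab] _ [_ _ _ /= ut _].
    by case: (nuL t tab).
- move=> phi psi cphi cpsi ag i d t /onE[-> tab] _.
  rewrite (flat _ cphi t tab) (flat _ cpsi t tab).
  apply: (@germ_unique _ _ a^'- _ (phi c)).
    exact: (near_two_left (flat_near _ cphi a aab)).
  apply: filterS2 (good_start L) (near_two_left (flat_near _ cpsi a aab)).
  by move=> r [or ur] <-; exact: ag.
- move=> phi psi cphi cpsi ag i d t /onE[-> tab] ut.
  have [x [xl _ xE]] := kink _ cphi; have [y [yl _ yE]] := kink _ cpsi.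
  rewrite xE// yE//; apply: (@germ_unique _ _ a^'- _ (phi c)) => //.
  by apply: filterS2 (good_start L) yl => r [or ur] <-; exact: ag.
Qed.

End R1.

(** * Colorings of abstract tangles *)

Section Tangles.
Variables (R : realType) (k : nat) (X : quandle).

(** A crossing of a tangle of graphs: its abscissa, the lower and the upper
    strand, and the sign with which the upper strand acts on the color of the
    lower one when the abscissa increases. *)
Record event := Event {
  ev_pos : R;
  ev_under : 'I_k;
  ev_over : 'I_k;
  ev_sign : bool
}.
Implicit Types (ev : event) (evs : seq event) (v : 'I_k -> X).
Implicit Types (psi : 'I_k -> R -> X) (x y : R).

Definition ev_step v ev : 'I_k -> X := fun i =>
  if i == ev_under ev then qact (ev_sign ev) (v (ev_under ev)) (v (ev_over ev))
  else v i.

Fixpoint ordered evs : Prop :=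
  if evs is ev :: evs' then
    [/\ forall ev', List.In ev' evs' -> ev_pos ev < ev_pos ev',
        ev_under ev <> ev_over ev & ordered evs']
  else True.

Definition under_at evs i x :=
  exists ev, [/\ List.In ev evs, ev_pos ev = x & ev_under ev = i].

(** The abscissa plays the role of the parameter on all strands, whatever their
    directions in the diagram. *)
Record tangle_coloring evs psi : Prop := TangleColoring {
  tangle_const : forall i x, -1 <= x <= 1 -> ~ under_at evs i x ->
    \forall y \near x, -1 <= y <= 1 -> psi i y = psi i x;
  tangle_cross : forall ev, List.In ev evs -> exists l r,
    [/\ \forall y \near (ev_pos ev)^'-, psi (ev_under ev) y = l,
        \forall y \near (ev_pos ev)^'+, psi (ev_under ev) y = r &
        r = qact (ev_sign ev) l (psi (ev_over ev) (ev_pos ev))]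
}.

(** The color vector is constant between crossings.  By induction on the list:
    to the right of the first crossing, continue with the solution for the
    remaining ones and the vector changed by this crossing. *)
Lemma tangle_exists evs v : ordered evs -> exists psi,
  [/\ tangle_coloring evs psi,
      forall i x, (forall ev, List.In ev evs -> x <= ev_pos ev) -> psi i x = v i &
      forall i x, (forall ev, List.In ev evs -> ev_pos ev < x) ->
        psi i x = foldl ev_step v evs i].
Proof.
elim: evs v => [v _|ev evs IH v [/= lt uo /(IH (ev_step v ev))[psi [col ini fin]]]].
  by exists (fun i _ => v i); split => //; split => // i x _ _; apply: filterE.
(* At the abscissa of the crossing itself the old colors are kept: the
   over-strand has the same color on both sides, and the value on the
   under-strand is not constrained. *)
pose phi i x := if x <= ev_pos ev then v i else psi i x.
have phi_le i x : x <= ev_pos ev -> phi i x = v i by rewrite /phi => ->.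
have phi_gt i x : ev_pos ev < x -> phi i x = psi i x.
  by rewrite /phi leNgt => ->.
have near_gt x : ev_pos ev < x -> \forall y \near x, forall i, phi i y = psi i y.
  move=> xe; have /near_open_itv : ev_pos ev < x < x + 1 by apply/andP; split; lra.
  by apply: filterS => y /andP[ye _] i; exact: phi_gt.
have left_germ i : \forall y \near (ev_pos ev)^'-, phi i y = v i.
  by apply: filterS (nbhs_left_lt _) => y /ltW; exact: phi_le.
have right_germ i : \forall y \near (ev_pos ev)^'+, phi i y = ev_step v ev i.
  have H ev' : List.In ev' evs -> \forall y \near (ev_pos ev)^'+, y <= ev_pos ev'.
    by move=> /lt; exact: nbhs_right_le.
  have : \forall y \near (ev_pos ev)^'+, forall ev', List.In ev' evs -> y <= ev_pos ev'.
    elim: (evs) H => [|e s IHs] H; first exact: filterE.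
    apply: filterS2 (H e (or_introl erefl)) (IHs (fun e' h => H e' (or_intror h))).
    by move=> y ye ys e' /= [<-|/ys].
  apply: filterS2 (nbhs_right_gt _) => y ye le_y.
  by rewrite phi_gt// ini.
exists phi; split.
- split => [i x xI ux|e /= [<-|ein]].
  + have [xe|xe|xe] := ltgtP x (ev_pos ev).
    * rewrite phi_le; last exact: ltW.
      have /near_open_itv : x - 1 < x < ev_pos ev by apply/andP; split; lra.
      by apply: filterS => y /andP[_ /ltW ye] _; exact: phi_le.
    * have ux' : ~ under_at evs i x.
        by move=> [e [ein ex ei]]; apply: ux; exists e; split => //; right.
      apply: filterS2 (near_gt x xe) (tangle_const col xI ux') => y -> H yI.
      by rewrite phi_gt// H.
    * have iu : i != ev_under ev.
        by apply/eqP => iE; apply: ux; exists ev; split => //; left.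
      have : \forall y \near x, phi i y = v i.
        rewrite xe; apply: near_sides => //; first exact: phi_le.
        by apply: filterS (right_germ i) => y ->; rewrite /ev_step (negbTE iu).
      by apply: filterS => y -> _; rewrite phi_le// xe.
  + exists (v (ev_under ev)), (ev_step v ev (ev_under ev)); split => //.
    by rewrite /ev_step eqxx phi_le.
  + have [l [r [gl gr E]]] := tangle_cross col ein; exists l, r.
    have ge := near_gt _ (lt _ ein); split.
    * by apply: filterS2 gl (near_two_left ge) => y <- ->.
    * by apply: filterS2 gr (near_two_right ge) => y <- ->.
    * by rewrite phi_gt// lt.
- by move=> i x H; apply: phi_le; apply: H; left.
- move=> i x H; rewrite phi_gt; last by apply: H; left.
  by apply: fin => e ein; apply: H; right.
Qed.

Lemma ordered_inj evs ev ev' : ordered evs -> List.In ev evs ->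
  List.In ev' evs -> ev_pos ev = ev_pos ev' -> ev = ev'.
Proof.
elim: evs => [//|e evs IH] /= [lt _ /IH{}IH] [<-|h] [<-|h'] E //.
- by have := lt _ h'; rewrite E ltxx.
- by have := lt _ h; rewrite E ltxx.
- exact: IH.
Qed.

Lemma ordered_neq evs ev : ordered evs -> List.In ev evs -> ev_under ev <> ev_over ev.
Proof. by elim: evs => [//|e evs IH] /= [_ eo /IH{}IH] [<-//|/IH]. Qed.

Lemma near_no_event evs x : \forall y \near x, y != x ->
  forall ev, List.In ev evs -> ev_pos ev <> y.
Proof.
elim: evs => [|e evs IH]; first exact: filterE.
have H : \forall y \near x, y != x -> ev_pos e <> y.
  apply: filterS (near_notin_finite x (finite_set1 (ev_pos e))) => y H yx E.
  by apply: H yx _; rewrite -E.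
apply: filterS2 H IH => y H IH yx ev /= [<-|]; first exact: H.
exact: IH.
Qed.

(** Real induction on the abscissa: agreement of the colors on the left of a
    crossing gives agreement on its right, because the over-strand is not
    itself passing under at that abscissa. *)
Lemma tangle_unique evs psi phi : ordered evs ->
  (forall ev, List.In ev evs -> -1 < ev_pos ev < 1) ->
  tangle_coloring evs psi -> tangle_coloring evs phi ->
  (forall i, psi i (-1) = phi i (-1)) ->
  forall x, -1 <= x <= 1 -> forall i, ~ under_at evs i x -> psi i x = phi i x.
Proof.
move=> ord bnd cpsi cphi ini.
have leftP x : -1 < x <= 1 ->
    (forall y, -1 <= y < x -> forall i, ~ under_at evs i y -> psi i y = phi i y) ->
    forall i, \forall y \near x^'-, psi i y = phi i y.
  move=> /andP[x1 x2] IH i.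
  apply: filterS3 (near_two_left (near_no_event evs x)) (nbhs_left_lt x) (nbhs_left_gt x1).
  move=> y ne yx y1; apply: IH; first by rewrite (ltW y1).
  by move=> [ev [ein ey _]]; apply: ne ein ey; rewrite lt_eqF.
apply: real_induction => [i _|x /andP[x1 x2] IH|x /andP[x1 x2] IH i ux].
- exact: ini.
- have xI : -1 <= x <= 1 by rewrite x1 ltW.
  have H i : \forall y \near x^'+, psi i y = phi i y.
    have [[ev [ein ex ei]]|ux] := pselect (under_at evs i x).
    + subst x i; have /andP[b1 b2] := bnd _ ein.
      have [l [r [gl gr E]]] := tangle_cross cpsi ein.
      have [l' [r' [gl' gr' E']]] := tangle_cross cphi ein.
      have lE : l = l'.
        apply: germ_unique gl _.
        apply: filterS2 gl' (leftP _ _ _ (ev_under ev)) => [y <- ->//||].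
          by rewrite b1 ltW.
        by move=> y /andP[y1 y2]; apply: IH; rewrite y1 ltW.
      have oE : psi (ev_over ev) (ev_pos ev) = phi (ev_over ev) (ev_pos ev).
        apply: IH; first by rewrite x1 lexx.
        move=> [ev' [ein' ex' eu']].
        have evE := ordered_inj ord ein' ein ex'.
        by apply: (ordered_neq ord ein); rewrite -eu' evE.
      have rE : r = r' by rewrite E E' lE oE.
      by apply: filterS2 gr gr' => y -> ->.
    + apply: filterS3 (near_two_right (tangle_const cpsi xI ux))
        (near_two_right (tangle_const cphi xI ux))
        (filterI (nbhs_right_gt x) (nbhs_right_lt x2)).
      move=> y Hpsi Hphi [xy y2]; have yI : -1 <= y <= 1.
        by rewrite (ltW y2) (le_trans x1 (ltW xy)).
      by rewrite Hpsi// Hphi//; apply: IH; rewrite // x1 lexx.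
  by apply: filterS (filter_forall _ H) => y Hy i _; exact: Hy.
- have xI : -1 <= x <= 1 by rewrite x2 ltW.
  have x12 : -1 < x <= 1 by rewrite x1.
  apply: (@germ_unique _ _ x^'- _ (psi i)).
    apply: filterS3 (near_two_left (tangle_const cpsi xI ux)) (nbhs_left_gt x1)
      (nbhs_left_lt x) => y H y1 yx; apply: H.
    by rewrite (ltW y1) (le_trans (ltW yx)).
  apply: filterS3 (near_two_left (tangle_const cphi xI ux)) (leftP x x12 IH i)
      (filterI (nbhs_left_gt x1) (nbhs_left_lt x)) => y H -> [y1 yx]; apply: H.
  by rewrite (ltW y1) (le_trans (ltW yx)).
Qed.

Lemma tangle_end evs psi : ordered evs ->
  (forall ev, List.In ev evs -> -1 < ev_pos ev < 1) ->
  tangle_coloring evs psi ->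
  forall i, psi i 1 = foldl ev_step (fun i => psi i (-1)) evs i.
Proof.
move=> ord bnd col i.
have [phi [cphi ini fin]] := tangle_exists (fun i => psi i (-1)) ord.
rewrite -(fin i 1); last by move=> ev /bnd/andP[].
apply: (tangle_unique ord bnd col cphi).
- by move=> j; rewrite ini// => ev /bnd/andP[/ltW].
- by rewrite lexx andbT; lra.
- by move=> [ev [/bnd/andP[_ +] e1 _]]; rewrite e1 ltxx.
Qed.

End Tangles.

(** * Tangles of graphs in a diagram *)

Section GraphCurves.
Variable R : realType.

Lemma derive1_affine (al be t : R) :
  differentiable ((fun s => be * s + al) : R^o -> R^o) t /\
  derive1 (fun s : R => be * s + al : R^o) t = be.
Proof.
have H : is_derive (t : R^o) 1 ((fun s => be * s + al) : R^o -> R^o) be.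
  have -> : ((fun s => be * s + al) : R^o -> R^o) = (be *: (@idfun R^o) + cst al).
    by apply/funext.
  by apply: is_derive_eq; rewrite addr0 /GRing.scale /= mulr1.
split; first by apply/derivable1_diffP; case: H.
by rewrite derive1E; case: H.
Qed.

Lemma derive1_graph (e : R^o * R^o -> 'rV[R]_3) (g : R -> R) (al be t : R) :
  smooth e -> smooth (g : R^o -> R^o) -> let x := be * t + al in
  derive1 (fun s => e (be * s + al, g (be * s + al))) t =
  be *: 'D_(1, 0) e (x, g x) + (be * derive1 g x) *: 'D_(0, 1) e (x, g x).
Proof.
move=> se sg x; have [da da1] := derive1_affine al be t.
have dg : differentiable (g : R^o -> R^o) x := smooth_differentiable _ sg.
have dga : differentiable ((fun s => g (be * s + al)) : R^o -> R^o) t.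
  exact: (differentiable_comp da dg).
have dga1 : derive1 (fun s => g (be * s + al) : R^o) t = be * derive1 g x.
  have -> := derive1_comp_diff da dg.
  by rewrite da1 deriveE// (derive1E' dg) -[RHS]/(be *: _) -linearZ /= /GRing.scale /= mulr1.
have [dp dp1] := derive1_pair da dga.
have de : differentiable e (x, g x) := smooth_differentiable _ se.
have -> := derive1_comp_diff dp de.
rewrite dp1 da1 dga1 -(derive_comb _ _ _ _ de); congr ('D_ _ _ _).
rewrite -[LHS]/(_, _); congr pair; rewrite /= /GRing.scale /=.
  by rewrite mulr1 mulr0 addr0.
by rewrite mulr1 mulr0 add0r.
Qed.

End GraphCurves.

Section Abscissa.
Variables (R : realType) (n m : nat) (s : strand R n m) (d : bool).
Hypothesis se : strand_start s < strand_end s.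

Let a := strand_start s.
Let b := strand_end s.

Definition slope : R := (if d then 1 else -1) * (2 / (b - a)).
Definition offset : R := - (if d then 1 else -1) * (2 * a / (b - a) + 1).
(** The inverse of [abscissa]; it runs backwards along the strand when [d] is
    false. *)
Definition param (x : R) : R := a + (b - a) * ((if d then 1 else -1) * x + 1) / 2.

Lemma abscissaE t : abscissa s d t = slope * t + offset.
Proof.
rewrite /abscissa /slope /offset /a /b.
by case: d; move: (strand_start s) (strand_end s) => x y; move: (y - x)^-1 => z; ring.
Qed.

Lemma paramK x : abscissa s d (param x) = x.
Proof.
have : b - a != 0 by rewrite subr_eq0 gt_eqF.
by rewrite /abscissa /param -/a -/b; case: d => ?; field.
Qed.

Lemma abscissaK t : param (abscissa s d t) = t.
Proof.
have : b - a != 0 by rewrite subr_eq0 gt_eqF.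
by rewrite /abscissa /param -/a -/b; case: d => ?; field.
Qed.

Lemma param_lt x y : (param x < param y) = (if d then x < y else y < x).
Proof.
have h2 : 0 < (b - a) / 2 by rewrite divr_gt0// subr_gt0.
rewrite -subr_gt0 (_ : param y - param x = (b - a) / 2 * (if d then y - x else x - y)).
  by rewrite pmulr_rgt0//; case: d; rewrite subr_gt0.
by rewrite /param; case: d; field.
Qed.

Lemma param_itv x : (a <= param x <= b) = (-1 <= x <= 1).
Proof.
have h2 : 0 < (b - a) / 2 by rewrite divr_gt0// subr_gt0.
rewrite -subr_ge0 -[param x <= b]subr_ge0.
rewrite (_ : param x - a = (b - a) / 2 * ((if d then 1 else -1) * x + 1)); last first.
  by rewrite /param; case: d; field.
rewrite (_ : b - param x = (b - a) / 2 * (1 - (if d then 1 else -1) * x)); last first.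
  by rewrite /param; case: d; field.
by rewrite !(pmulr_rge0 _ h2); case: d; apply/idP/idP => /andP[? ?]; apply/andP; split; lra.
Qed.

Lemma param_open_itv x : (a < param x < b) = (-1 < x < 1).
Proof.
have h2 : 0 < (b - a) / 2 by rewrite divr_gt0// subr_gt0.
rewrite -subr_gt0 -[param x < b]subr_gt0.
rewrite (_ : param x - a = (b - a) / 2 * ((if d then 1 else -1) * x + 1)); last first.
  by rewrite /param; case: d; field.
rewrite (_ : b - param x = (b - a) / 2 * (1 - (if d then 1 else -1) * x)); last first.
  by rewrite /param; case: d; field.
by rewrite !(pmulr_rgt0 _ h2); case: d; apply/idP/idP => /andP[? ?]; apply/andP; split; lra.
Qed.

Lemma slope_gt0 : (0 < slope) = d.
Proof.
have h2 : 0 < 2 / (b - a) by rewrite divr_gt0// subr_gt0.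
by rewrite /slope; case: d; rewrite ?mul1r ?mulN1r ?h2// oppr_gt0 ltNge ltW.
Qed.

Lemma slope_neq0 : slope != 0.
Proof.
have h2 : 0 < 2 / (b - a) by rewrite divr_gt0// subr_gt0.
by rewrite /slope; case: d; rewrite ?mul1r ?mulN1r ?oppr_eq0 gt_eqF.
Qed.

Lemma abscissa_lt t u :
  (abscissa s d t < abscissa s d u) = (if d then t < u else u < t).
Proof.
have E v w : (v < w) = (if d then abscissa s d v < abscissa s d w
                        else abscissa s d w < abscissa s d v).
  by rewrite -param_lt !abscissaK.
by have := E t u; have := E u t; case: d.
Qed.

End Abscissa.

Section GraphTangle.
Variables (R : realType) (n m k : nat) (X : pointed_quandle (2 * n)).
Variables (e : R^o * R^o -> 'rV[R]_3) (st : 'I_k -> strand R n m).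
Variables (d : 'I_k -> bool) (level : 'I_k -> nat) (f : 'I_k -> R -> R).
Variables (K K' : diagram R n m).
Hypotheses (chart : disk_chart e) (lev : injective level).
Hypotheses (graph : graph_tangle e st d level f K) (KK' : local_pair st K K').
Implicit Types (i j : 'I_k) (c : component n m) (t x : R).

Let se i : strand_start (st i) < strand_end (st i).
Proof. by have [] := pair_bounds KK' i. Qed.

Let pm i x := param (st i) (d i) x.
Let ab i t := abscissa (st i) (d i) t.
Let comp i := strand_comp (st i).

Lemma strand_abscissa i c t : on_strand (st i) c t ->
  [/\ c = comp i, -1 <= ab i t <= 1 & t = pm i (ab i t)].
Proof.
move=> [-> ti]; split => //; last by rewrite /pm /ab abscissaK.
by rewrite -(param_itv (d i) (se i)) abscissaK.
Qed.

Lemma param_on i x : -1 <= x <= 1 -> on_strand (st i) (comp i) (pm i x).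
Proof. by move=> xI; split => //; rewrite param_itv. Qed.

Lemma graph_curve i x : -1 <= x <= 1 -> curve K (comp i) (pm i x) = e (x, f i x).
Proof.
move=> xI; have [_ _ /(_ i (pm i x))] := graph.
by rewrite param_itv // => /(_ xI)[]; rewrite paramK.
Qed.

Lemma graph_under i x : -1 <= x <= 1 ->
  is_under K (comp i) (pm i x) <-> exists j, f j x = f i x /\ (level i < level j)%N.
Proof.
move=> xI; have [_ _ /(_ i (pm i x))] := graph.
by rewrite param_itv // => /(_ xI)[_]; rewrite paramK.
Qed.

Lemma graph_square i x : -1 <= x <= 1 -> square (x, f i x).
Proof.
move=> xI; have [_ /(_ i x xI)/andP[f1 f2] _] := graph.
by split => //=; rewrite !ltW.
Qed.

Lemma graph_inj i j x y : -1 <= x <= 1 -> -1 <= y <= 1 ->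
  curve K (comp i) (pm i x) = curve K (comp j) (pm j y) -> x = y /\ f i x = f j x.
Proof.
move=> xI yI; rewrite !graph_curve//; have [_ _ inj _] := chart.
by move=> /(inj _ _ (graph_square i xI) (graph_square j yI))[-> ->].
Qed.

Lemma graph_crossing i j x : -1 <= x <= 1 -> f i x = f j x ->
  (level i < level j)%N -> crossing K (comp i, pm i x) (comp j, pm j x).
Proof.
move=> xI fij ij.
have ui : is_under K (comp i) (pm i x) by apply/graph_under => //; exists j.
have oni := param_on i xI; have onj := param_on j xI.
apply: double_crossing => //; split => /=.
- exact: (strand_fundamental KK' oni).
- exact: (strand_fundamental KK' onj).
- move=> [cE tE]; have ijE : i = j.
    by apply: pair_disjoint KK' _ _ _ _ oni _; rewrite cE tE.
  by rewrite ijE ltnn in ij.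
- by rewrite !graph_curve// fij.
Qed.

Lemma crossing_graph i j x y : -1 <= x <= 1 -> -1 <= y <= 1 ->
  crossing K (comp i, pm i x) (comp j, pm j y) ->
  [/\ x = y, f i x = f j x & (level i < level j)%N].
Proof.
move=> xI yI [/= _ _ cE ui nuj]; have [xy fij] := graph_inj xI yI cE.
subst y; split => //.
rewrite ltnNge; apply/negP; rewrite leq_eqVlt => /predU1P[/lev ji|ji].
  by apply: nuj; rewrite ji.
by apply: nuj; apply/graph_under => //; exists i.
Qed.

Lemma graph_derive i x : -1 < x < 1 ->
  derive1 (curve K (comp i)) (pm i x) =
  slope (st i) (d i) *: 'D_(1, 0) e (x, f i x) +
  (slope (st i) (d i) * derive1 (f i) x) *: 'D_(0, 1) e (x, f i x).
Proof.
move=> xI; have [fs _ gr] := graph; have [es _ _ _] := chart.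
have -> : derive1 (curve K (comp i)) (pm i x) =
    derive1 (fun s => e (slope (st i) (d i) * s + offset (st i) (d i),
      f i (slope (st i) (d i) * s + offset (st i) (d i)))) (pm i x).
  apply: derive1_near.
  have /near_open_itv : strand_start (st i) < pm i x < strand_end (st i).
    by rewrite param_open_itv.
  apply: filterS => t /andP[t1 t2]; rewrite -abscissaE.
  by have [] := gr i t (ltac:(apply/andP; split; exact: ltW)).
rewrite (derive1_graph _ _ _ es (fs i)).
by rewrite -abscissaE paramK.
Qed.

(** Both tangent vectors are expressed in the frame of the chart at the
    crossing, where they are proportional to (1, f_i') and (1, f_j'). *)
Lemma graph_orient i j x : -1 < x < 1 -> f i x = f j x ->
  exists2 w : R, 0 < w &
  orient (curve K (comp i) (pm i x)) (derive1 (curve K (comp j)) (pm j x))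
    (derive1 (curve K (comp i)) (pm i x)) =
  slope (st j) (d j) * slope (st i) (d i) * (derive1 (f i) x - derive1 (f j) x) * w.
Proof.
move=> xI fij; have xI' : -1 <= x <= 1.
  by case/andP: xI => ? ?; apply/andP; split; apply: ltW.
have [_ _ _ /(_ _ (graph_square i xI')) w0] := chart.
exists (orient (e (x, f i x)) ('D_(1, 0) e (x, f i x)) ('D_(0, 1) e (x, f i x))) => //.
rewrite (graph_curve i xI') (graph_derive i xI) (graph_derive j xI) -fij.
by rewrite orient_comb; ring.
Qed.

Lemma graph_transverse i j x : -1 < x < 1 -> f i x = f j x ->
  (level i < level j)%N -> derive1 (f i) x != derive1 (f j) x.
Proof.
move=> xI fij ij; have xI' : -1 <= x <= 1.
  by case/andP: xI => ? ?; apply/andP; split; apply: ltW.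
have := crossing_transverse (graph_crossing xI' fij ij).
have [w w0 ->] := graph_orient xI fij.
by apply: contraNneq => ->; rewrite subrr mulr0 mul0r.
Qed.

(** The sign of the crossing in terms of the abscissa: the comparison of the
    slopes is corrected by the direction of the over-strand and by that of the
    under-strand.  The latter correction disappears in [coloring_tangle], where
    reading a backward strand from left to right exchanges its incoming and
    outgoing colors. *)
Lemma graph_sign i j x : -1 < x < 1 -> f i x = f j x -> (level i < level j)%N ->
  crossing_sign K (comp i, pm i x) (comp j, pm j x) =
  (d i == (d j == (derive1 (f j) x < derive1 (f i) x))).
Proof.
move=> xI fij ij; rewrite crossing_signE; have tr := graph_transverse xI fij ij.
have [w w0 ->] := graph_orient xI fij; rewrite pmulr_lgt0//.
have sg i' := slope_gt0 (d i') (se i'); have s0 i' := slope_neq0 (d i') (se i').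
have pos (u v : R) : u != 0 -> v != 0 -> (0 < u * v) = ((0 < u) == (0 < v)).
  move=> u0 v0; have [up|un|/eqP] := ltgtP 0 u; last by rewrite eq_sym (negbTE u0).
    by rewrite pmulr_rgt0//.
  rewrite nmulr_rgt0// eq_sym eqbF_neg -leNgt lt_neqAle v0 //.
have d0 : derive1 (f i) x - derive1 (f j) x != 0 by rewrite subr_eq0.
rewrite pos//; last by rewrite mulf_neq0.
rewrite pos// !sg subr_gt0.
by case: (d i); case: (d j); case: (_ < _).
Qed.

Variable evs : seq (event R k).

(** The list [evs] contains exactly the crossings of the graphs, from left to
    right. *)
Definition lists_crossings :=
  [/\ ordered evs, forall ev, List.In ev evs -> -1 < ev_pos ev < 1 &
  forall x i j sg, List.In (Event x i j sg) evs <->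
    [/\ -1 <= x <= 1, (level i < level j)%N, f i x = f j x &
        sg = (d j == (derive1 (f j) x < derive1 (f i) x))]].

Hypothesis evsP : lists_crossings.

Let ord : ordered evs. Proof. by case: evsP. Qed.
Let bnd ev : List.In ev evs -> -1 < ev_pos ev < 1. Proof. by case: evsP => _ + _; exact. Qed.
Let evE x i j sg : List.In (Event x i j sg) evs <->
    [/\ -1 <= x <= 1, (level i < level j)%N, f i x = f j x &
        sg = (d j == (derive1 (f j) x < derive1 (f i) x))].
Proof. by case: evsP. Qed.

Lemma under_atE i x : -1 <= x <= 1 ->
  is_under K (comp i) (pm i x) <-> under_at evs i x.
Proof.
move=> xI; rewrite graph_under//; split.
- move=> [j [fij ij]].
  by exists (Event x i j (d j == (derive1 (f j) x < derive1 (f i) x))); split=> //; exact/evE.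
- by move=> [[y i' j sg] [/evE[_ ij fij _] /= yx ii]]; subst; exists j.
Qed.

Lemma under_inside i t : on_strand (st i) (comp i) t -> is_under K (comp i) t ->
  -1 < ab i t < 1.
Proof.
move=> on; have [_ tI {1}->] := strand_abscissa on.
by move=> /(under_atE i tI)[ev [ein <- _]]; exact: bnd.
Qed.

Lemma coloring_tangle phi : coloring (X := X) K phi ->
  tangle_coloring evs (fun i x => phi (comp i) (pm i x)).
Proof.
move=> col; split => [i x xI ux|[x i j sg] ein].
- have nu : ~ is_under K (comp i) (pm i x) by move=> /(under_atE i xI).
  have on := param_on i xI.
  have := monotone_near (abscissaK (d i) (se i)) (param_lt (d i) (se i))
    (near_color col (on_strand_itv KK' on) nu).
  by apply: filterS => y -> _.
- have xI := bnd ein; move/evE: (ein) => [xI' /= ij fij sgE].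
  have [l [r [/= gl gr E]]] := color_crossing col (graph_crossing xI' fij ij).
  rewrite graph_sign// -sgE in E.
  exists (if d i then l else r), (if d i then r else l); split => /=.
  + apply: (monotone_near_left (P := fun t => phi (comp i) t = _)
      (abscissaK (d i) (se i)) (param_lt (d i) (se i))).
    by rewrite -/(pm i x); case: (d i).
  + apply: (monotone_near_right (P := fun t => phi (comp i) t = _)
      (abscissaK (d i) (se i)) (param_lt (d i) (se i))).
    by rewrite -/(pm i x); case: (d i).
  + rewrite -/(pm i x) E; case: (d i) => //=.
    by rewrite [false == _]eq_sym eqbF_neg qactVK.
Qed.

(** Converse of [coloring_tangle] at the crossings: gluing the strands of a
    tangle coloring into a diagram gives the required germs. *)
Lemma tangle_local phi psi : tangle_coloring evs psi ->
  (forall i t, on_strand (st i) (comp i) t -> phi (comp i) t = psi i (ab i t)) ->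
  forall i j t u, on_strand (st i) (comp i) t -> on_strand (st j) (comp j) u ->
    crossing K (comp i, t) (comp j, u) -> exists x z : X,
    [/\ \forall r \near t^'-, phi (comp i) r = x,
        \forall r \near t^'+, phi (comp i) r = z &
        z = qact (crossing_sign K (comp i, t) (comp j, u)) x (phi (comp j) u)].
Proof.
move=> col phiE i j t u on onj cr.
have [_ tI' tP] := strand_abscissa on; have [_ uI' uP] := strand_abscissa onj.
have crE := cr; rewrite tP uP in crE.
have [uE fij ij] := crossing_graph tI' uI' crE; rewrite -uE in uP.
have tI : -1 < ab i t < 1 by apply: under_inside => //; case: cr.
move xE : (ab i t) => x in tI tI' tP uP fij uE.
have ein : List.In (Event x i j (d j == (derive1 (f j) x < derive1 (f i) x))) evs.
  exact/evE.
have [l [r [/= gl gr E]]] := tangle_cross col ein.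
have sgE : crossing_sign K (comp i, t) (comp j, u) =
    (d i == (d j == (derive1 (f j) x < derive1 (f i) x))).
  by have := graph_sign tI fij ij; rewrite -tP -uP.
have inner : \forall s \near t, phi (comp i) s = psi i (ab i s).
  have /near_open_itv : strand_start (st i) < t < strand_end (st i).
    by rewrite tP param_open_itv.
  by apply: filterS => s /andP[s1 s2]; apply: phiE; split => //; rewrite !ltW.
exists (if d i then l else r), (if d i then r else l); split.
- apply: filterS2 (near_two_left inner) (monotone_near_left
    (P := fun y => psi i y = (if d i then l else r)) (paramK (d i) (se i))
    (abscissa_lt (d i) (se i)) _) => [s -> ->//|].
  by rewrite -/(ab i t) xE; case: (d i).
- apply: filterS2 (near_two_right inner) (monotone_near_right
    (P := fun y => psi i y = (if d i then r else l)) (paramK (d i) (se i))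
    (abscissa_lt (d i) (se i)) _) => [s -> ->//|].
  by rewrite -/(ab i t) xE; case: (d i).
- rewrite sgE (phiE j u onj) -uE E; case: (d i) => //=.
  by rewrite [false == _]eq_sym eqbF_neg qactK.
Qed.

End GraphTangle.

Section TangleChange.
Variables (R : realType) (n m k : nat) (X : pointed_quandle (2 * n)).
Variables (e : R^o * R^o -> 'rV[R]_3) (st : 'I_k -> strand R n m).
Variables (d : 'I_k -> bool) (level : 'I_k -> nat).
Hypotheses (chart : disk_chart e) (lev : injective level).
Implicit Types (f g : 'I_k -> R -> R) (K : diagram R n m).
Implicit Types (i j : 'I_k) (c : component n m) (t x : R).

Lemma param_end i x :
  x = -1 \/ x = 1 ->
  param (st i) (d i) x = strand_start (st i) \/
  param (st i) (d i) x = strand_end (st i).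
Proof.
rewrite /param; case: (d i) => -[->|->].
- by left; field.
- by right; field.
- by right; field.
- by left; field.
Qed.

(** The outside part of a coloring determines the colors of the strands at both
    ends, hence at the left side of the square, where [tangle_unique]
    applies. *)
Lemma tangle_strand_unique f evs K K' (phi psi : component n m -> R -> X) :
  graph_tangle e st d level f K -> local_pair st K K' ->
  lists_crossings d level f evs ->
  coloring K phi -> coloring K psi -> agree st K phi psi ->
  forall i c t, on_strand (st i) c t -> ~ is_under K c t -> phi c t = psi c t.
Proof.
move=> gr KK' evsP cphi cpsi ag i c t ti ut.
have [ord bnd _] := evsP.
have se j : strand_start (st j) < strand_end (st j) by have [] := pair_bounds KK' j.
have endE j x : x = -1 \/ x = 1 ->
    phi (strand_comp (st j)) (param (st j) (d j) x) =
    psi (strand_comp (st j)) (param (st j) (d j) x).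
  move=> xE; have xI : -1 <= x <= 1 by case: xE => ->; apply/andP; split; lra.
  have on := param_on d KK' j xI.
  have nu : ~ is_under K (strand_comp (st j)) (param (st j) (d j) x).
    move=> /(under_inside gr KK' evsP on).
    by rewrite paramK//; case: xE => ->; rewrite ltxx ?andbF.
  have cp := near_color cphi (on_strand_itv KK' on) nu.
  have cs := near_color cpsi (on_strand_itv KK' on) nu.
  have iso := under_isolated K (strand_comp (st j)) (param (st j) (d j) x).
  have [tE|tE] := param_end j xE; rewrite tE in cp cs iso *.
  - apply: (@germ_unique _ _ (strand_start (st j))^'- _ (phi (strand_comp (st j)))).
      exact: near_two_left.
    apply: filterS3 (near_two_left cs) (near_two_left iso)
      (filterI (strand_start_outside KK' j) (nbhs_left_lt _)) => r <- ur [or rt].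
    by apply: ag => //; apply: ur; [rewrite lt_eqF|exact: fundamental_domain or.1].
  - apply: (@germ_unique _ _ (strand_end (st j))^'+ _ (phi (strand_comp (st j)))).
      exact: near_two_right.
    apply: filterS3 (near_two_right cs) (near_two_right iso)
      (filterI (strand_end_outside KK' j) (nbhs_right_gt _)) => r <- ur [or rt].
    by apply: ag => //; apply: ur; [rewrite gt_eqF|exact: fundamental_domain or.1].
have [cE xI tE] := strand_abscissa d KK' ti; subst c.
rewrite tE in ut *.
apply: (tangle_unique ord bnd (coloring_tangle chart gr KK' evsP cphi)
  (coloring_tangle chart gr KK' evsP cpsi) _ xI).
- by move=> j; apply: endE; left.
- by move=> /(under_atE gr KK' evsP i xI).
Qed.

(** The strands of the new tangle are colored starting from the colors of the
    old one at the left side of the square.  Equality of the composites makes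
    the colors agree at the right side too, so that they match the outside
    part. *)
Lemma tangle_transfer f g evs evs' K K' (phi : component n m -> R -> X) :
  graph_tangle e st d level f K -> graph_tangle e st d level g K' ->
  local_pair st K K' ->
  lists_crossings d level f evs -> lists_crossings d level g evs' ->
  (forall v : 'I_k -> X, foldl (@ev_step R k X) v evs =1 foldl (@ev_step R k X) v evs') ->
  coloring K phi -> exists2 phi', coloring K' phi' & agree st K phi phi'.
Proof.
move=> gr gr' KK' evsP evsP' folds col; have K'K := local_pair_sym KK'.
have [ord bnd _] := evsP; have [ord' bnd' _] := evsP'.
have se i : strand_start (st i) < strand_end (st i) by have [] := pair_bounds KK' i.
pose psi i x := phi (strand_comp (st i)) (param (st i) (d i) x).
have cpsi : tangle_coloring evs psi := coloring_tangle chart gr KK' evsP col.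
have [psi' [cpsi' ini fin]] := tangle_exists (fun i => psi i (-1)) ord'.
have endE i x : x = -1 \/ x = 1 -> psi' i x = psi i x.
  move=> [->|->]; first by rewrite ini// => ev /bnd'/andP[/ltW].
  rewrite fin; last by move=> ev /bnd'/andP[].
  by rewrite -folds -(tangle_end ord bnd cpsi).
pose phi' c t := if pselect (exists i, on_strand (st i) c (reduce c t)) is left h
  then psi' (projT1 (cid h)) (abscissa (st (projT1 (cid h))) (d (projT1 (cid h))) (reduce c t))
  else phi c t.
have phi'_on i t : on_strand (st i) (strand_comp (st i)) t ->
    phi' (strand_comp (st i)) t = psi' i (abscissa (st i) (d i) t).
  move=> on; rewrite /phi' (reduce_id (strand_fundamental KK' on)).
  case: pselect => [h|no]; last by case: no; exists i.
  by case: cid => j /= onj; rewrite (pair_disjoint KK' onj on).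
have phi'_out c t : outside st c t -> phi' c t = phi c t.
  move=> [ft no]; rewrite /phi' (reduce_id ft); case: pselect => // -[i on].
  by case: (no i).
exists phi'; last by move=> c t ot _; rewrite phi'_out.
apply: (coloring_local KK' col).
- by move=> j t; rewrite /phi' (color_periodic col) reduce_periodic.
- exact: phi'_out.
- move=> i c t ti ut; have [cE xI tE] := strand_abscissa d KK' ti; subst c.
  have nux : ~ under_at evs' i (abscissa (st i) (d i) t).
    by move=> /(under_atE gr' K'K evsP' i xI); rewrite -tE.
  have near_psi := monotone_near (paramK (d i) (se i)) (abscissa_lt (d i) (se i))
    (tangle_const cpsi' xI nux).
  (* Only an end of the strand has outside points nearby, and there the old and
     the new colors agree. *)
  have near_out : \forall r \near t, ~ on_strand (st i) (strand_comp (st i)) r ->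
      phi (strand_comp (st i)) r = psi' i (abscissa (st i) (d i) t).
    have [xin|xout] := boolP (-1 < abscissa (st i) (d i) t < 1).
      have /near_open_itv : strand_start (st i) < t < strand_end (st i).
        by rewrite tE param_open_itv.
      apply: filterS => r /andP[r1 r2] no; case: no; split => //.
      by rewrite !ltW.
    have nu : ~ is_under K (strand_comp (st i)) t.
      by move=> /(under_inside gr KK' evsP ti); apply/negP.
    have := near_color col (on_strand_itv KK' ti) nu.
    apply: filterS => r -> _; rewrite endE.
      by rewrite /psi abscissaK.
    move: xI xout => /andP[x1 x2]; rewrite negb_and -!leNgt => /orP[x3|x3].
      by left; apply/le_anti; rewrite x3.
    by right; apply/le_anti; rewrite x2.
  rewrite (phi'_on i t ti).
  apply: filterS3 near_psi near_out (near_off_others KK' ti) => r psi_r out_r [r01 no].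
  have [on|off] := pselect (on_strand (st i) (strand_comp (st i)) r).
    rewrite phi'_on// psi_r//.
    by have [] := strand_abscissa d KK' on.
  rewrite phi'_out ?out_r//; split; first exact: unit_fundamental.
  by move=> j; have [->|/no] := eqVneq j i.
- move=> i j c t c' u ti uj.
  have [cE _ _] := strand_abscissa d KK' ti; have [cE' _ _] := strand_abscissa d KK' uj.
  subst c c'; exact: (tangle_local chart lev gr' K'K evsP' cpsi' phi'_on).
Qed.

Lemma graph_local_pair f g K K' :
  graph_tangle e st d level f K -> graph_tangle e st d level g K' ->
  local_change e st K K' -> local_pair st K K'.
Proof.
move=> gr gr' lc; have [_ bnd _ _] := lc.
have inD h L : graph_tangle e st d level h L -> forall i t,
    on_strand (st i) (strand_comp (st i)) t ->
    (e @` @square R) (curve L (strand_comp (st i)) t).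
  move=> [_ h1 grh] i t [_ ti]; have [-> _] := grh i t ti; eexists; last by [].
  have se : strand_start (st i) < strand_end (st i) by have [] := bnd i.
  have xI : -1 <= abscissa (st i) (d i) t <= 1.
    by rewrite -(param_itv (d i) se) abscissaK.
  by have /andP[? ?] := h1 i _ xI; split => //=; rewrite !ltW.
exact: local_change_pair lc (inD _ _ gr) (inD _ _ gr').
Qed.

Lemma tangle_card f g evs evs' K K' :
  graph_tangle e st d level f K -> graph_tangle e st d level g K' ->
  local_change e st K K' ->
  lists_crossings d level f evs -> lists_crossings d level g evs' ->
  (forall v : 'I_k -> X, foldl (@ev_step R k X) v evs =1 foldl (@ev_step R k X) v evs') ->
  (counting_homs X K #= counting_homs X K')%card.
Proof.
move=> gr gr' lc evsP evsP' folds.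
have KK' := graph_local_pair gr gr' lc.
have K'K := local_pair_sym KK'.
have agP (phi psi : component n m -> R -> X) :
    agree st K phi psi <-> agree st K' phi psi.
  by split=> H c t ot ut; apply: H => // u; apply: ut; apply/(pair_under KK' ot).
apply: (local_card KK').
- by move=> phi; exact: (tangle_transfer gr gr' KK' evsP evsP' folds).
- move=> phi' col.
  have [phi cphi /agP ag] := tangle_transfer gr' gr K'K evsP' evsP
    (fun v i => esym (folds v i)) col.
  by exists phi => // c t ot ut; rewrite ag.
- by move=> phi psi; exact: (tangle_strand_unique gr KK' evsP).
- move=> phi psi c1 c2 /agP; exact: (tangle_strand_unique gr' K'K evsP' c1 c2).
Qed.

End TangleChange.

(** * The second and third Reidemeister moves *)

Section Slopes.
Variable R : realType.
Implicit Types (f g h : R -> R) (x y : R).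

Lemma smooth_sub f g : smooth (f : R^o -> R^o) -> smooth (g : R^o -> R^o) ->
  forall x, derivable (fun y => f y - g y : R^o) (x : R^o) 1 /\
  derive1 (fun y => f y - g y : R^o) x = derive1 f x - derive1 g x.
Proof.
move=> sf sg x.
have df : derivable (f : R^o -> R^o) x 1.
  by apply/derivable1_diffP; exact: smooth_differentiable.
have dg : derivable (g : R^o -> R^o) x 1.
  by apply/derivable1_diffP; exact: smooth_differentiable.
split; first exact: derivableB.
by rewrite !derive1E -deriveB.
Qed.

(** The derivative of [f - g] is positive on a neighborhood, by continuity. *)
Lemma increasing_near f g x : smooth (f : R^o -> R^o) -> smooth (g : R^o -> R^o) ->
  f x = g x -> derive1 g x < derive1 f x ->
  exists2 dl, 0 < dl & (forall y, x < y < x + dl -> g y < f y) /\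
                       (forall y, x - dl < y < x -> f y < g y).
Proof.
move=> sf sg fg lt; pose h y : R := f y - g y.
have hD := smooth_sub sf sg.
have pos : \forall y \near x, derive1 g y < derive1 f y.
  have c : continuous (fun y : R^o => ('D_1 (f : R^o -> R^o) y : R^o) - 'D_1 (g : R^o -> R^o) y).
    by move=> y; apply: cvgB; exact: smooth_derive_continuous.
  have lt' : 0 < 'D_1 (f : R^o -> R^o) x - 'D_1 (g : R^o -> R^o) x.
    by rewrite subr_gt0 -!derive1E.
  apply: filterS (cvgr_gt _ (c x) _ lt') => y.
  by rewrite subr_gt0 !derive1E.
have /near_twoP[dl dl0 dlP] := pos.
have incr y z : x - dl < y -> y < z -> z < x + dl -> h y < h z.
  move=> y1 yz z1; apply: (@gtr0_derive1_lt_cc R h y z) => //.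
  - by move=> w _; exact: (hD w).1.
  - move=> w; rewrite in_itv /= => /andP[w1 w2]; rewrite (hD w).2 subr_gt0.
    by apply: dlP; apply/andP; split; lra.
  - by apply: derivable_within_continuous => w _; exact: (hD w).1.
  - by rewrite in_itv /= lexx ltW.
  - by rewrite in_itv /= lexx ltW.
have h0 : h x = 0 by rewrite /h fg subrr.
exists dl => //; split => y /andP[y1 y2].
- rewrite -subr_gt0 -/(h y) -h0; apply: incr => //; lra.
- rewrite -subr_lt0 -/(h y) -h0; apply: incr => //; lra.
Qed.

Lemma meet_between f g x y : smooth (f : R^o -> R^o) -> smooth (g : R^o -> R^o) ->
  x <= y -> f x < g x -> g y < f y -> exists2 z, x < z < y & f z = g z.
Proof.
move=> sf sg xy fgx gfy; pose h z : R := f z - g z.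
have hx : h x < 0 by rewrite subr_lt0.
have hy : 0 < h y by rewrite subr_gt0.
have [||z] := @IVT R h x y 0 xy.
- by apply: derivable_within_continuous => w _; exact: (smooth_sub sf sg w).1.
- by rewrite ge_min le_max (ltW hx) (ltW hy) orbT.
rewrite in_itv /= => /andP[xz zy] hz; exists z; last first.
  by apply/eqP; rewrite -subr_eq0; apply/eqP.
rewrite !lt_neqAle xz zy !andbT; apply/andP; split; apply/eqP => zE; subst.
- by move: hx; rewrite hz ltxx.
- by move: hy; rewrite hz ltxx.
Qed.

(** Otherwise [g] would be below [f] just before [x], hence they would have met
    earlier. *)
Lemma single_crossing_slope f g x : smooth (f : R^o -> R^o) ->
  smooth (g : R^o -> R^o) -> f (-1) < g (-1) -> -1 < x < 1 ->
  (forall y, -1 <= y <= 1 -> (f y = g y <-> y = x)) ->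
  derive1 f x != derive1 g x -> derive1 g x < derive1 f x.
Proof.
move=> sf sg fg /andP[x1 x2] cr ne.
have xE : f x = g x by apply/cr => //; rewrite !ltW.
rewrite lt_neqAle eq_sym ne /= leNgt; apply/negP => lt.
have [dl dl0 [_ below]] := increasing_near sg sf (esym xE) lt.
pose m := Num.min dl (x + 1).
have m0 : m <= x + 1 by rewrite ge_min lexx orbT.
have m1 : m <= dl by rewrite ge_min lexx.
have m2 : 0 < m by rewrite lt_min dl0 /=; lra.
have [||z /andP[z1 z2] zE] := meet_between (x := -1) (y := x - m / 2) sf sg _ fg.
- lra.
- by apply: below; apply/andP; split; lra.
have zx : z = x by apply/cr => //; apply/andP; split; lra.
lra.
Qed.

(** If [f - g] increased through two consecutive zeros, it would be positive
    after the first one and negative before the second one. *)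
Lemma adjacent_crossing_slopes f g x y : smooth (f : R^o -> R^o) ->
  smooth (g : R^o -> R^o) -> x < y -> f x = g x -> f y = g y ->
  (forall z, x < z < y -> f z <> g z) ->
  derive1 g x < derive1 f x -> derive1 g y < derive1 f y -> False.
Proof.
move=> sf sg xy fgx fgy ne lx ly.
have [dl dl0 [above _]] := increasing_near sf sg fgx lx.
have [el el0 [_ below]] := increasing_near sf sg fgy ly.
pose m := Num.min (Num.min dl el) (y - x).
have m0 : m <= y - x by rewrite ge_min lexx orbT.
have m1 : m <= dl by rewrite !ge_min lexx.
have m3 : m <= el by rewrite !ge_min lexx orbT.
have m2 : 0 < m by rewrite !lt_min dl0 el0 /=; lra.
have [|||z /andP[z1 z2] zE] := meet_between (x := x + m / 3) (y := y - m / 3) sg sf.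
- lra.
- by apply: above; apply/andP; split; lra.
- by apply: below; apply/andP; split; lra.
by apply: (ne z) => //; apply/andP; split; lra.
Qed.

End Slopes.

Section R2.
Variables (R : realType) (n m : nat) (X : pointed_quandle (2 * n)).

Lemma ord2P (i : 'I_2) : i = 0 \/ i = 1.
Proof. by case: i => [[|[|//]] p]; [left|right]; exact: val_inj. Qed.

(** No crossing on one side; on the other, two crossings with the same
    under-strand and opposite slopes, so that the over-strand acts by a
    translation and then by its inverse. *)
Lemma R2_card (L L' : diagram R n m) : R2_move L L' ->
  (counting_homs X L #= counting_homs X L')%card.
Proof.
move=> [e [st [d [level [f [g [lc lev gr gr' [nof [x1 [x2 [x1I x12 x2I cr]]]]]]]]]]].
have chart : disk_chart e by case: lc.
have K'K := local_pair_sym (graph_local_pair gr gr' lc).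
have [u [w [uw luw pair]]] : exists u w : 'I_2, [/\ u <> w, (level u < level w)%N &
    forall i j, (level i < level j)%N -> i = u /\ j = w].
  have [lt|lt|/lev//] := ltngtP (level 0) (level 1).
  - exists 0, 1; split => // i j; case: (ord2P i) => ->; case: (ord2P j) => ->;
    by rewrite ?ltnn // ltnNge ltnW.
  - exists 1, 0; split => // i j; case: (ord2P i) => ->; case: (ord2P j) => ->;
    by rewrite ?ltnn // ltnNge ltnW.
have nofuw x : -1 <= x <= 1 -> f u x <> f w x.
  move=> /nof; case: (ord2P u) uw => ->; case: (ord2P w) => -> // _ ne.
  by move=> E; apply: ne.
have cruw x : -1 <= x <= 1 -> (g u x = g w x <-> x = x1 \/ x = x2).
  move=> /cr; case: (ord2P u) uw => ->; case: (ord2P w) => -> // _ <-.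
  by split=> E.
have x1J : -1 <= x1 <= 1 by apply/andP; split; lra.
have x2J : -1 <= x2 <= 1 by apply/andP; split; lra.
have g1 : g u x1 = g w x1 by apply/cruw => //; left.
have g2 : g u x2 = g w x2 by apply/cruw => //; right.
have [gs _ _] := gr'.
have t1 := graph_transverse chart gr' K'K (_ : -1 < x1 < 1) g1 luw.
have t2 := graph_transverse chart gr' K'K (_ : -1 < x2 < 1) g2 luw.
have {}t1 : derive1 (g u) x1 != derive1 (g w) x1 by apply: t1; apply/andP; split; lra.
have {}t2 : derive1 (g u) x2 != derive1 (g w) x2 by apply: t2; apply/andP; split; lra.
have ne z : x1 < z < x2 -> g u z <> g w z.
  move=> /andP[z1 z2] /cruw[]; first by apply/andP; split; lra.
  - by move=> zE; lra.
  - by move=> zE; lra.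
(* The two crossings have opposite slopes, hence opposite signs. *)
have flip : (derive1 (g w) x2 < derive1 (g u) x2) =
    ~~ (derive1 (g w) x1 < derive1 (g u) x1).
  have [l1|l1] := boolP (derive1 (g w) x1 < derive1 (g u) x1) => /=.
    apply/negP => l2.
    exact: (adjacent_crossing_slopes (gs u) (gs w) x12 g1 g2 ne l1 l2).
  apply/negPn/negP => l2.
  have l1' : derive1 (g u) x1 < derive1 (g w) x1 by rewrite lt_neqAle t1 leNgt.
  have l2' : derive1 (g u) x2 < derive1 (g w) x2 by rewrite lt_neqAle t2 leNgt.
  apply: (adjacent_crossing_slopes (gs w) (gs u) x12 (esym g1) (esym g2) _ l1' l2').
  by move=> z /ne + E; apply.
pose sg x := d w == (derive1 (g w) x < derive1 (g u) x).
apply: (@tangle_card R n m 2 X e st d level chart lev f g [::]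
  [:: Event x1 u w (sg x1); Event x2 u w (sg x2)] L L' gr gr' lc).
- split => // x i j s; split => // -[xI /pair[-> ->] fE _].
  exact: nofuw xI fE.
- split.
  + by split; [move=> ev [<-|]|exact: uw|split].
  + by move=> ev [<-|[<-|]] //=; apply/andP; split; lra.
  + move=> x i j s; split.
    * by move=> [[<- <- <- <-]|[[<- <- <- <-]|//]].
    * move=> [xI /pair[-> ->] gE ->]; move/(cruw x xI): gE => [->|->]; [by left|by right; left].
- move=> v i /=; rewrite /ev_step /= eqxx.
  have -> : (w == u) = false by apply/eqP => E; apply: uw.
  have -> : sg x2 = ~~ sg x1 by rewrite /sg flip; case: (d w); case: (_ < _).
  by case: eqP => [->|]//; rewrite qactK.
Qed.

End R2.

Section R3.
Variables (R : realType) (n m : nat) (X : pointed_quandle (2 * n)).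

Lemma ord3P (i : 'I_3) : [\/ i = 0, i = 1 | i = 2].
Proof.
by case: i => [[|[|[|//]]] p]; [apply: Or31|apply: Or32|apply: Or33]; exact: val_inj.
Qed.

(** The crossing of the strands [i] and [j] when [i] comes from below, so that
    the slope of [j] at the crossing is the smaller one. *)
Definition pair_event (d : 'I_3 -> bool) (level : 'I_3 -> nat) (i j : 'I_3) (x : R) :=
  if (level i < level j)%N then Event x i j (d j) else Event x j i (~~ d i).

(** Strands are numbered from bottom to top at the left side, and any two of
    them cross once; by [single_crossing_slope] the slopes at the crossings are
    determined, before the move as well as after it. *)
Lemma R3_lists e (st : 'I_3 -> strand R n m) d level f (K K' : diagram R n m)
    (x01 x02 x12 : R) evs : disk_chart e -> injective level ->
  graph_tangle e st d level f K -> local_pair st K K' ->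
  f 0 (-1) < f 1 (-1) -> f 1 (-1) < f 2 (-1) ->
  -1 < x01 < 1 -> -1 < x02 < 1 -> -1 < x12 < 1 ->
  (forall x, -1 <= x <= 1 ->
    [/\ f 0 x = f 1 x <-> x = x01, f 0 x = f 2 x <-> x = x02 &
        f 1 x = f 2 x <-> x = x12]) ->
  ordered evs ->
  (forall ev, List.In ev evs <-> [\/ ev = pair_event d level 0 1 x01,
    ev = pair_event d level 0 2 x02 | ev = pair_event d level 1 2 x12]) ->
  lists_crossings d level f evs.
Proof.
move=> chart lev gr KK' f01 f12 I01 I02 I12 cr ord inE.
have [fs _ _] := gr.
have f02 := lt_trans f01 f12.
have close (x : R) : -1 < x < 1 -> -1 <= x <= 1.
  by move=> /andP[? ?]; apply/andP; split; lra.
have slopes i j x : -1 < x < 1 -> f i (-1) < f j (-1) ->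
    (forall y, -1 <= y <= 1 -> (f i y = f j y <-> y = x)) ->
    derive1 (f j) x < derive1 (f i) x.
  move=> xI fij crx; apply: (single_crossing_slope (fs i) (fs j) fij xI crx).
  have fE : f i x = f j x by apply/crx => //; exact: close.
  have [lt|lt|/lev ijE] := ltngtP (level i) (level j).
  - exact: (graph_transverse chart gr KK' xI fE lt).
  - by rewrite eq_sym; exact: (graph_transverse chart gr KK' xI (esym fE) lt).
  - by move: fij; rewrite ijE ltxx.
have s01 := slopes 0 1 x01 I01 f01 (fun y yI => let: And3 H _ _ := cr y yI in H).
have s02 := slopes 0 2 x02 I02 f02 (fun y yI => let: And3 _ H _ := cr y yI in H).
have s12 := slopes 1 2 x12 I12 f12 (fun y yI => let: And3 _ _ H := cr y yI in H).
(* A pair of strands i, j has a single crossing; either strand can be the lower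
   one. *)
have listed i j x x0 s : i <> j -> -1 < x0 < 1 -> derive1 (f j) x0 < derive1 (f i) x0 ->
    (forall y, -1 <= y <= 1 -> (f i y = f j y <-> y = x0)) ->
    forall i' j', Event x i' j' s = pair_event d level i j x0 <->
    [/\ -1 <= x <= 1, (level i' < level j')%N, f i' x = f j' x,
      s = (d j' == (derive1 (f j') x < derive1 (f i') x)) &
      (i' = i /\ j' = j) \/ (i' = j /\ j' = i)].
  move=> ij x0I sl crx i' j'; have fE : f i x0 = f j x0 by apply/crx => //; exact: close.
  have nsl : (derive1 (f i) x0 < derive1 (f j) x0) = false.
    by apply/negbTE; rewrite -leNgt ltW.
  rewrite /pair_event; split.
  - have [lt [-> -> -> ->]|ge [-> -> -> ->]] := ltnP (level i) (level j).
    + by split => //; [exact: close|rewrite sl eqb_id|left].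
    + split => //; [exact: close| |by rewrite nsl eqbF_neg|by right].
      by rewrite ltn_neqAle ge andbT; apply/eqP => /lev/esym.
  - move=> [xI lt fE' -> [[iE jE]|[iE jE]]]; subst.
    + have xE : x = x0 by apply/crx.
      by rewrite lt xE sl eqb_id.
    + have xE : x = x0 by apply/crx.
      by rewrite ltnNge (ltnW lt) /= xE nsl eqbF_neg.
have L01 := listed 0 1 _ _ _ _ I01 s01 (fun y yI => let: And3 H _ _ := cr y yI in H).
have L02 := listed 0 2 _ _ _ _ I02 s02 (fun y yI => let: And3 _ H _ := cr y yI in H).
have L12 := listed 1 2 _ _ _ _ I12 s12 (fun y yI => let: And3 _ _ H := cr y yI in H).
split => // [ev /inE[]->|x i j s]; rewrite ?/pair_event; try by case: ifP.
split.
- move=> /inE[/L01[]|/L02[]|/L12[]] //.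
- move=> [xI lt fE sE]; apply/inE.
  have : (i = 0 /\ j = 1 \/ i = 1 /\ j = 0) \/
    (i = 0 /\ j = 2 \/ i = 2 /\ j = 0) \/ (i = 1 /\ j = 2 \/ i = 2 /\ j = 1).
    case: (ord3P i) lt => ->; case: (ord3P j) => ->; rewrite ?ltnn //; tauto.
  move=> [H|[H|H]].
  + by apply: Or31; apply/L01.
  + by apply: Or32; apply/L02.
  + by apply: Or33; apply/L12.
Qed.

End R3.

Section R3Fold.
Variables (R : realType) (n m : nat) (X : pointed_quandle (2 * n)).

(** The top strand keeps its color and acts on the two others by automorphisms.
    Whether the bottom strand crosses the middle one before or after the top
    one has acted on them, the result is the same by self-distributivity.  The
    six cases are the six orders of the levels. *)
Lemma R3_fold (d : 'I_3 -> bool) (level : 'I_3 -> nat) (x01 x02 x12 y01 y02 y12 : R)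
    (v : 'I_3 -> X) :
  injective level ->
  foldl (@ev_step R 3 X) v [:: pair_event d level 0 1 x01;
    pair_event d level 0 2 x02; pair_event d level 1 2 x12] =1
  foldl (@ev_step R 3 X) v [:: pair_event d level 1 2 y12;
    pair_event d level 0 2 y02; pair_event d level 0 1 y01].
Proof.
move=> lev.
have lneq i j : i != j -> level i <> level j by move=> /eqP ij /lev.
have e01 := lneq 0 1 isT; have e02 := lneq 0 2 isT; have e12 := lneq 1 2 isT.
have E01 : (0 == 1 :> 'I_3) = false by [].
have E02 : (0 == 2 :> 'I_3) = false by [].
have E10 : (1 == 0 :> 'I_3) = false by [].
have E12 : (1 == 2 :> 'I_3) = false by [].
have E20 : (2 == 0 :> 'I_3) = false by [].
have E21 : (2 == 1 :> 'I_3) = false by [].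
rewrite /pair_event.
case: (ltngtP (level 0) (level 1)) e01 => [a01|a01|//] _;
case: (ltngtP (level 0) (level 2)) e02 => [a02|a02|//] _;
case: (ltngtP (level 1) (level 2)) e12 => [a12|a12|//] _; try lia;
move=> i /=; rewrite /ev_step; case: (ord3P i) => -> /=;
rewrite ?(eqxx, E01, E02, E10, E12, E20, E21) //=.
- exact: qact_distr.
- by rewrite [RHS]qact_distr qactVK.
- by rewrite [LHS]qact_distr qactK.
- exact: qact_distr.
- by rewrite [RHS]qact_distr.
- by rewrite [RHS]qact_distr.
Qed.

Lemma R3_card (L L' : diagram R n m) : R3_move L L' ->
  (counting_homs X L #= counting_homs X L')%card.
Proof.
move=> [e [st [d [level [f [g [lc lev gr gr' [[f01 f12] [g01 g12]]]]]]]]].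
move=> [x01 [x02 [x12 [[a1 [a2 [a3 a4]]] cr]]]].
move=> [y01 [y02 [y12 [[b1 [b2 [b3 b4]]] cr']]]].
have chart : disk_chart e by case: lc.
have LL' := graph_local_pair gr gr' lc; have L'L := local_pair_sym LL'.
have posE i j x : ev_pos (pair_event d level i j x) = x.
  by rewrite /pair_event; case: ifP.
have neqE i j x : i <> j -> ev_under (pair_event d level i j x) <>
    ev_over (pair_event d level i j x).
  by rewrite /pair_event; case: ifP => _ ij //= /esym.
apply: (@tangle_card R n m 3 X e st d level chart lev f g
  [:: pair_event d level 0 1 x01; pair_event d level 0 2 x02; pair_event d level 1 2 x12]
  [:: pair_event d level 1 2 y12; pair_event d level 0 2 y02; pair_event d level 0 1 y01]
  L L' gr gr' lc).
- apply: (R3_lists chart lev gr LL' f01 f12 _ _ _ cr);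
    try by apply/andP; split; lra.
  + split; [|exact: neqE|split; [|exact: neqE|split; [|exact: neqE|]]] => //.
    * by move=> ev [<-|[<-|]] //; rewrite !posE; lra.
    * by move=> ev [<-|] //; rewrite !posE; lra.
  + by move=> ev; split => [[<-|[<-|[<-|//]]]|[]->];
      [constructor 1|constructor 2|constructor 3|left|right; left|right; right; left].
- apply: (R3_lists chart lev gr' L'L g01 g12 _ _ _ cr');
    try by apply/andP; split; lra.
  + split; [|exact: neqE|split; [|exact: neqE|split; [|exact: neqE|]]] => //.
    * by move=> ev [<-|[<-|]] //; rewrite !posE; lra.
    * by move=> ev [<-|] //; rewrite !posE; lra.
  + by move=> ev; split => [[<-|[<-|[<-|//]]]|[]->];
      [constructor 3|constructor 2|constructor 1|right; right; left|right; left|left].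
- by move=> v; exact: R3_fold.
Qed.

End R3Fold.

Local Open Scope card_scope.

Theorem theorem4p30 (R : realType) (n m : nat) (X : pointed_quandle (2 * n))
    (L L' : diagram R n m) :
  reidemeister_equiv L L' -> counting_homs X L #= counting_homs X L'.
Proof.
elim=> {L L'} [L L' [[H [s [r [iso rP LL']]]]|r1|r2|r3]|L|L L' _ LL'|L1 L2 L3 _ + _].
- have [taui E] := isotopic_equiv rP iso LL'.
  exact: equiv_card E.
- exact: R1_card r1.
- exact: R2_card r2.
- exact: R3_card r3.
- exact: card_eqxx.
- by rewrite card_eq_sym.
- exact: card_eq_trans.
Qed.
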